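(* The limiting expected fractions $r_k$ of nodes of rank $k$ and $\ell_k$ of nodes at layer $k$ in random recursive trees have the following values for $k=0,1,\dots,8$, where decimal values are given rounded to three significant digits: $$r_0=\tfrac12,\quad r_1=\tfrac1e,\quad r_2\approx 0.124,\quad r_3\approx 0.00805,\quad r_4\approx 1.68\times10^{-4},\quad r_5\approx 2.14\times 10^{-6},$$ $$r_6\approx 1.88\times 10^{-8},\quad r_7\approx 1.20\times 10^{-10},\quad r_8\approx 5.76\times 10^{-13};$$ $$\ell_0=\tfrac12,\quad \ell_1=e-\tfrac52,\quad \ell_2\approx 0.114,\quad \ell_3\approx 0.0647,\quad \ell_4\approx 0.0384,\quad \ell_5\approx 0.0235,$$ $$\ell_6\approx 0.0146,\quad \ell_7\approx 0.00928,\quad \ell_8\approx 0.00595.$$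
   Context: A random recursive tree (RRT) $G_n$ of size $n$ is a random labeled tree on the node set $\{1,\dots,n\}$ built as follows: start with node $1$; for $t=2,\dots,n$, node $t$ is attached by an edge to one node chosen uniformly at random from the existing nodes $\{1,\dots,t-1\}$, independently of previous choices. A leaf is a node of degree $1$ (the root, node $1$, is also a leaf if it has degree $1$). The rank of a node is its graph distance to the closest leaf, so leaves have rank $0$; in the one-node tree the single node has rank $0$. The layer of a node is the number of times all current leaves must be simultaneously stripped off (removed) from the tree for the node to become a leaf; leaves of the original tree are at layer $0$, and if after some number of rounds the remaining tree consists of a single isolated node, that node counts as a leaf at that stage. Let $R_{n,k}$ and $L_{n,k}$ be the numbers of nodes of rank $k$ and at layer $k$ in $G_n$, let $r_k(n)=\mathbb E[R_{n,k}/n]$ and $\ell_k(n)=\mathbb E[L_{n,k}/n]$, and let $r_k=\lim_{n\to\infty}r_k(n)$ and $\ell_k=\lim_{n\to\infty}\ell_k(n)$ (these limits exist). *)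

(* Defs.v *)
From HB Require Import structures.
From mathcomp Require Import all_boot all_order all_algebra.
From mathcomp Require Import all_classical all_reals all_analysis.

Set Implicit Arguments.
Unset Strict Implicit.
Unset Printing Implicit Defensive.

Import Order.TTheory GRing.Theory Num.Theory.
Import numFieldNormedType.Exports.
Local Open Scope ring_scope.

(* Notions for a finite graph with adjacency relation [e] on [T]; a set
   [S : {set T}] stands for the subgraph induced by the nodes of [S]. *)

Definition degree_in (T : finType) (e : rel T) (S : {set T}) (v : T) : nat :=
  #|[set u in S | e v u]%SET|.

(* The second alternative is the convention that the node of a one-node tree
   is a leaf. *)
Definition leaves (T : finType) (e : rel T) (S : {set T}) : {set T} :=
  [set v in S | (degree_in e S v == 1)%N || (S == [set v])]%SET.

(* Least number of edges of an [e]-path from [x] to [y] ([#|T|] if there is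
   none; a shortest path always has fewer than [#|T|] edges). *)
Definition gdist (T : finType) (e : rel T) (x y : T) : nat :=
  \big[Order.min/#|T|]_(d < #|T|
      | [exists s : d.-tuple T, path e x s && (last x s == y)]) (d : nat).

Definition rank (T : finType) (e : rel T) (v : T) : nat :=
  \big[Order.min/#|T|]_(u in leaves e [set: T]%SET) gdist e v u.

Definition strip (T : finType) (e : rel T) (S : {set T}) : {set T} :=
  (S :\: leaves e S)%SET.

(* Least number of simultaneous strippings after which [v] is a leaf ([#|T|] if
   there is none, which does not happen in a tree). *)
Definition layer (T : finType) (e : rel T) (v : T) : nat :=
  \big[Order.min/#|T|]_(j < #|T|
      | v \in leaves e (iter j (strip e) [set: T]%SET)) (j : nat).

(* The label [i] of {1, ..., n} is represented by [i - 1 : 'I_n].  An outcome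
   [p] of the attachment choices gives, for each [t < n.-1], the node
   [p t <= t] to which node [t.+1] is attached. *)
Definition attachments (n : nat) : finType :=
  {dffun forall t : 'I_n.-1, 'I_t.+1}.

Definition rrt_adj (n : nat) (p : attachments n) : rel 'I_n :=
  [rel u v : 'I_n | [exists t : 'I_n.-1,
     ((u == t.+1 :> nat) && (v == p t :> nat)) ||
     ((v == t.+1 :> nat) && (u == p t :> nat))]].

(* Law of [G_n]: the choices are independent, the [t]-th one being uniform on
   ['I_t.+1]. *)
Definition rrt_prob (R : realType) (n : nat) (p : attachments n) : R :=
  \prod_(t < n.-1) (t.+1%:R)^-1.

Definition rrt_mean (R : realType) (n : nat) (X : attachments n -> R) : R :=
  \sum_(p : attachments n) rrt_prob R p * X p.

Definition rank_count (n k : nat) (p : attachments n) : nat :=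
  #|[set v : 'I_n | rank (rrt_adj p) v == k]%SET|.

Definition layer_count (n k : nat) (p : attachments n) : nat :=
  #|[set v : 'I_n | layer (rrt_adj p) v == k]%SET|.

(* The sequences n |-> r_k(n) and n |-> l_k(n); the value at [n = 0], where
   there is no tree, is irrelevant. *)
Definition rank_frac (R : realType) (k n : nat) : R :=
  rrt_mean (fun p : attachments n => (rank_count k p)%:R / n%:R).

Definition layer_frac (R : realType) (k n : nat) : R :=
  rrt_mean (fun p : attachments n => (layer_count k p)%:R / n%:R).

Definition rank_lim (R : realType) (k : nat) : R := limn (rank_frac R k).

Definition layer_lim (R : realType) (k : nat) : R := limn (layer_frac R k).

(* [x] rounded to three significant digits is [m * 10 ^- e]. *)
Definition rounds3 (R : realType) (x : R) (m e : nat) : Prop :=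
  (100 <= m < 1000)%N /\
  m%:R - 2^-1 <= x * 10 ^+ e < m%:R + 2^-1.

(* Main.v *)
From Stdlib Require Import NArith.
Require Import Defs.
From mathcomp Require Import all_boot all_order all_algebra.
From mathcomp Require Import ring lra zify.
From mathcomp Require Import all_classical all_reals all_analysis.
Set Implicit Arguments.
Unset Strict Implicit.
Unset Printing Implicit Defensive.
Import Order.TTheory GRing.Theory Num.Theory.
Import numFieldNormedType.Exports.
Local Open Scope ring_scope.

(** Deleting the edge between the nodes 1 and 2 of a random recursive tree of size n+1 leaves two
trees which, given their sizes, are independent random recursive trees, and the size of the
one that contains node 1 is uniform on 1, ..., n ([Es_split]).  Encoding a tree by iterating
this split turns every expectation needed below into a recursion for a sequence indexed by
the size.

For the number of nodes whose fringe tree (the subtree of descendants) has a given property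
the recursion can be solved: in the limit a fraction 1 / ((j+1)(j+2)) of the nodes has a
fringe tree of size j+1, and it is then a random recursive tree ([Es_fsum]).  Nodes at bounded
depth are negligible ([edepth_small]), and away from the root both statistics are determined
by fringe trees:

- a node is at layer at most k when its fringe tree has height at most k ([layer_height_le]),
  since stripping removes one level of leaves at a time while the part of the tree above
  survives;
- a node has rank at least k when its own fringe tree has no leaf at distance less than k
  from its root, that of its parent none at distance less than k-1, and so on
  ([rank_prot_chain]): a leaf close to the node is reached by going up and then down.

Hence the limiting fractions exist, and they are differences of the series [lhead] and [rtail].

Let c_k(n) be the probability that the tree of size n+1 has height at most k.  By the split its
generating function satisfies C_{k+1}' = C_k C_{k+1}, starting from C_0 = 1, so that c_1(n) = 1/n!
and [lhead 1] is e - 2.  In general c_k is nonincreasing, which bounds the tail of the series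
by the last term computed.

Let a_m(n) be the probability that the root of the tree of size n+1 is m-protected (no leaf at
distance less than m below it), and b_m(n) the probability that all its children are; then
B_m' = A_m B_m, and a_{m+1} differs from b_m only at n = 0.  The expected number of nodes whose
whole chain of ancestors is suitably protected solves F' = A F + B G, where B' = A B, and
so F = B * (integral of G) ([cv_factor]).  Iterating this writes [rtail] as an iterated
convolution with b_0, b_1, b_2, ... tested against a weight.  The convolutions with b_0 = 1 and
with b_1 are moved to the weight by Tonelli's theorem ([ubs_adjoint]).  For b_1,
whose generating function is exp(-x)/(1-x), this produces the moments of exp(-x) on [0, 1], which
obey a one-step recursion ([v_rec]); in particular [rtail 2] is 1/2 - 1/e.  Moving b_2 as well gives
the weight [omega], which is enclosed and nonincreasing, so that truncation costs little.

The remaining values come from exact integer arithmetic: every sequence is enclosed by lists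
of binary integers at a fixed scale, rounded down on one side and up on the other.  The
truncation errors are controlled by three estimates: the monotonicity of c_k, a potential
argument for b_2 ([b2_Xtail], [b2_Ytail]), and for m > 2 a linear inequality that the tail mass of
b_m satisfies by its own recursion ([mass_sol]). *)

(** * Random recursive trees by splitting *)

(** A recursive tree up to the order-preserving relabelling of its nodes: [Join a b] is the tree
whose first edge, the one between its two oldest nodes, has [a] on the side of the root and [b] on
the other side.  The nodes of the tree are the [Single]s. *)
Inductive rtree := Single | Join of rtree & rtree.

Definition single (T : rtree) := if T is Single then true else false.

(** The possible attachments of one more node, one for each node. *)
Fixpoint grow (T : rtree) : seq rtree :=
  match T with
  | Single => [:: Join Single Single]
  | Join a b => [seq Join a' b | a' <- grow a] ++ [seq Join a b' | b' <- grow b]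
  end.

Fixpoint nodes (T : rtree) : nat :=
  if T is Join a b then (nodes a + nodes b)%N else 1%N.

(** The second subtree of a [Join] is the fringe tree of a nonroot node, and each nonroot node
arises in this way exactly once; so this adds up [F] over the fringe trees of nonroot nodes. *)
Fixpoint fsum (F : rtree -> nat) (T : rtree) : nat :=
  if T is Join a b then (fsum F a + fsum F b + F b)%N else 0%N.

Section Expectation.
Variable R : realType.
Implicit Types (F G : rtree -> R).

(** Expectation for the tree with [n.+1] nodes.  The new node is averaged over inside [F]. *)
Fixpoint Es (n : nat) (F : rtree -> R) : R :=
  if n is m.+1 then Es m (fun T => (\sum_(T' <- grow T) F T') / m.+1%:R)
  else F Single.

Lemma eq_Es n F G : F =1 G -> Es n F = Es n G.
Proof. by move=> /funext ->. Qed.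

Lemma EsD n F G : Es n (fun T => F T + G T) = Es n F + Es n G.
Proof.
elim: n F G => [//|n IH] F G /=; rewrite -IH; apply: eq_Es => T.
by rewrite big_split mulrDl.
Qed.

Lemma EsZ n c F : Es n (fun T => c * F T) = c * Es n F.
Proof.
elim: n F => [//|n IH] F /=; rewrite -IH; apply: eq_Es => T.
by rewrite -mulr_sumr mulrA.
Qed.

Lemma Es_const n c : Es n (fun=> c) = c * Es n (fun=> 1).
Proof. by rewrite -EsZ; apply: eq_Es => T; rewrite mulr1. Qed.

Lemma Es0 n : Es n (fun=> 0) = 0.
Proof. by rewrite Es_const mul0r. Qed.

Lemma EsB n F G : Es n (fun T => F T - G T) = Es n F - Es n G.
Proof.
rewrite EsD; congr (_ + _); rewrite -mulN1r -EsZ; apply: eq_Es => T.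
by rewrite mulN1r.
Qed.

Lemma Es_sum n (I : Type) (r : seq I) (F : I -> rtree -> R) :
  Es n (fun T => \sum_(i <- r) F i T) = \sum_(i <- r) Es n (F i).
Proof.
elim: r => [|i r IH]; first by rewrite big_nil -[RHS](Es0 n); apply: eq_Es => T; rewrite big_nil.
by rewrite big_cons -IH -EsD; apply: eq_Es => T; rewrite big_cons.
Qed.

Lemma le_Es n F G : (forall T, F T <= G T) -> Es n F <= Es n G.
Proof.
elim: n F G => [|n IH] F G FG /=; first exact: FG.
by apply: IH => T; rewrite ler_wpM2r ?invr_ge0 ?ler0n// ler_sum.
Qed.

Lemma Es_ge0 n F : (forall T, 0 <= F T) -> 0 <= Es n F.
Proof. by move=> F0; rewrite -(Es0 n); exact: le_Es. Qed.

Lemma EsS n F : Es n (fun T => \sum_(T' <- grow T) F T') = n.+1%:R * Es n.+1 F.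
Proof.
rewrite /= -EsZ; apply: eq_Es => T.
by rewrite mulrC divfK// pnatr_eq0.
Qed.

(** The sizes of the two sides of the first edge form a Polya urn started from one ball of each
colour, so that they are uniformly distributed; and attachments inside one side are
uniform among the nodes of that side. *)
Lemma Es_split n F : n.+1%:R * Es n.+1 F =
  \sum_(j < n.+1) Es j (fun a => Es (n - j) (fun b => F (Join a b))).
Proof.
elim: n F => [|n IH] F.
  by rewrite big_ord1 /= big_seq1 divr1 mul1r.
rewrite -(EsS n.+1 F).
apply: (@mulfI _ (n.+1%:R)); first by rewrite pnatr_eq0.
rewrite IH.
(* An attachment to the left side moves X i to X i.+1, with multiplicity the size i.+1. *)
pose X j := Es j (fun a => Es (n.+1 - j) (fun b => F (Join a b))).
have -> : \sum_(i < n.+1) Es i (fun a => Es (n - i) (fun b => \sum_(T' <- grow (Join a b)) F T'))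
  = \sum_(i < n.+1) (i.+1%:R * X i.+1 + (n - i).+1%:R * X i).
  apply: eq_bigr => i _.
  have -> : (fun a => Es (n - i) (fun b => \sum_(T' <- grow (Join a b)) F T')) =
     (fun a => (\sum_(a' <- grow a) Es (n - i) (fun b => F (Join a' b)))
        + (n - i).+1%:R * Es (n - i).+1 (fun b => F (Join a b))).
    apply/funext => a; rewrite -EsS -Es_sum -EsD; apply: eq_Es => b /=.
    by rewrite big_cat /= !big_map.
  rewrite EsD EsZ EsS /X subSS subSn //.
  by rewrite -ltnS.
rewrite big_split /=.
have -> : \sum_(i < n.+1) i.+1%:R * X i.+1 = \sum_(i < n.+2) i%:R * X i.
  by rewrite [RHS]big_ord_recl /= mul0r add0r; apply: eq_bigr.
have -> : \sum_(i < n.+1) (n - i).+1%:R * X i = \sum_(i < n.+2) (n.+1 - i)%:R * X i.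
  rewrite [RHS]big_ord_recr /= subnn mul0r addr0; apply: eq_bigr => i _.
  by rewrite subSn // -ltnS.
rewrite -big_split /= mulr_sumr; apply: eq_bigr => i _.
by rewrite -mulrDl -natrD subnKC // -ltnS.
Qed.

Lemma Es_split_mul n (F G : rtree -> R) (H : rtree -> R) :
  (forall a b, H (Join a b) = F a * G b) ->
  n.+1%:R * Es n.+1 H = \sum_(j < n.+1) Es j F * Es (n - j) G.
Proof.
move=> HE; rewrite Es_split; apply: eq_bigr => j _.
rewrite mulrC -EsZ; apply: eq_Es => a.
by rewrite mulrC -EsZ; apply: eq_Es => b; rewrite HE.
Qed.

Lemma Es1 n : Es n (fun=> 1) = 1.
Proof.
elim/ltn_ind: n => -[//|n] IH.
apply: (@mulfI _ (n.+1%:R)); first by rewrite pnatr_eq0.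
rewrite (@Es_split_mul n (fun=> 1) (fun=> 1)); last by move=> *; rewrite mulr1.
rewrite mulr1 (eq_bigr (fun=> 1)) ?sumr_const ?card_ord // => j _.
by rewrite !IH ?mulr1// ltnS leq_subr.
Qed.

Lemma Es_split_add n (F G : rtree -> R) (H : rtree -> R) :
  (forall a b, H (Join a b) = F a + G b) ->
  n.+1%:R * Es n.+1 H = \sum_(j < n.+1) (Es j F + Es j G).
Proof.
move=> HE; rewrite Es_split.
under eq_bigr => j _.
  have -> : (fun a => Es (n - j) (fun b => H (Join a b))) = (fun a => F a + Es (n - j) G).
    apply/funext => a; rewrite -[F a]mulr1 -(Es1 (n - j)) -EsZ -EsD.
    by apply: eq_Es => b; rewrite HE mulr1.
  rewrite EsD [X in _ + X]Es_const Es1 mulr1.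
  over.
rewrite !big_split /=; congr (_ + _).
rewrite (reindex_inj rev_ord_inj) /=; apply: eq_bigr => j _.
by rewrite subSS subKn // -ltnS.
Qed.

Lemma Es_nodes n : Es n (fun T => (nodes T)%:R) = n.+1%:R.
Proof.
elim/ltn_ind: n => -[//|n] IH.
apply: (@mulfI _ (n.+1%:R)); first by rewrite pnatr_eq0.
rewrite (@Es_split_add n (fun T => (nodes T)%:R) (fun T => (nodes T)%:R)); last first.
  by move=> a b; rewrite /= natrD.
rewrite (eq_bigr (fun j : 'I_n.+1 => j.+1%:R *+ 2)); last first.
  by move=> j _; rewrite IH // mulr2n.
have -> : \sum_(i < n.+1) (i.+1%:R : R) *+ 2 = n.+1%:R * n.+2%:R.
  elim: (n.+1) => [|m IHm]; first by rewrite big_ord0 mul0r.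
  rewrite big_ord_recr /= IHm -!natrM -mulrnA -natrD; congr (_%:R); lia.
by [].
Qed.

(** With s_n the left side, the split gives (n+1) s_{n+1} = sum over j <= n of (2 s_j + E_j F).
Subtracting two consecutive instances gives (n+1) s_{n+1} = (n+2) s_n + E_n F, which is solved by
dividing by (n+1)(n+2). *)
Lemma Es_fsum n F (f : rtree -> nat) :
  (forall T, F T = (f T)%:R) ->
  Es n (fun T => (fsum f T)%:R) =
  n.+1%:R * \sum_(j < n) Es j F / (j.+1%:R * j.+2%:R).
Proof.
move=> Ff.
elim: n => [|n IHn]; first by rewrite /= big_ord0 mulr0.
pose s n := Es n (fun T => (fsum f T)%:R).
have rec m : m.+1%:R * s m.+1 = \sum_(j < m.+1) (s j + s j + Es j F).
  rewrite /s (@Es_split_add m (fun T => (fsum f T)%:R) (fun T => (fsum f T)%:R + F T)).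
    by apply: eq_bigr => j _; rewrite EsD addrA.
  by move=> a b; rewrite /= Ff !natrD addrA.
have step : n.+1%:R * s n.+1 = n%:R * s n + (s n + s n + Es n F).
  rewrite rec big_ord_recr /=; congr (_ + _).
  by case: (n) => [|m]; [rewrite big_ord0 mul0r|rewrite rec].
rewrite -/(s n.+1) big_ord_recr /= mulrDr.
apply: (@mulfI _ (n.+1%:R)); first by rewrite pnatr_eq0.
rewrite step {1 2 3}/s IHn.
have n1 : n.+1%:R != 0 :> R by rewrite pnatr_eq0.
have n2 : n.+2%:R != 0 :> R by rewrite pnatr_eq0.
have -> : n%:R = n.+1%:R - 1 :> R by rewrite -natr1 addrK.
have e2 : n.+2%:R = n.+1%:R + 1 :> R by rewrite natr1.
rewrite e2 in n2 *; field.
by rewrite nat1r natr1 !pnatr_eq0.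
Qed.

End Expectation.

(** * Protection, height, and chains of fringe trees *)

(** The children of the root of [Join a b] are those of [a] and the root of [b]. *)
Fixpoint allkids (P : pred rtree) (T : rtree) : bool :=
  if T is Join a b then allkids P a && P b else true.

(** No leaf below the root at distance less than [m]; the root itself counts as a leaf if it has
no child. *)
Fixpoint prot (m : nat) : pred rtree :=
  if m is m'.+1 then fun T => ~~ single T && allkids (prot m') T else xpredT.

Fixpoint height_le (k : nat) : pred rtree :=
  if k is k'.+1 then allkids (height_le k') else single.

(** For every node, the fringe trees of the node, of its parent, and so on, up to the last
ancestor that is not the root; the length of this list is the depth of the node. *)
Fixpoint spines (T : rtree) : seq (seq rtree) :=
  if T is Join a b then spines a ++ [seq rcons s b | s <- spines b] else [:: [::]].

(** The condition that, for a node of depth at least [k], says that its rank is at least [k]: a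
leaf below the i-th ancestor at distance d from it is at distance at most i + d from the node. *)
Fixpoint prot_chain (k : nat) (s : seq rtree) : bool :=
  if s is x :: s' then prot k x && prot_chain k.-1 s' else true.

Lemma allkids_sub (P Q : pred rtree) T :
  (forall x, P x -> Q x) -> allkids P T -> allkids Q T.
Proof.
by move=> PQ; elim: T => //= a IHa b _ /andP[/IHa -> /PQ ->].
Qed.

Arguments prot : simpl never.

Lemma protS m T : prot m.+1 T = ~~ single T && allkids (prot m) T.
Proof. by []. Qed.

Lemma protW m T : prot m.+1 T -> prot m T.
Proof.
elim: m T => [//|m IH] T; rewrite !protS => /andP[->] /=.
by apply: allkids_sub; exact: IH.
Qed.

Lemma prot_chain0 s : prot_chain 0 s.
Proof. by elim: s. Qed.

Lemma prot_chainW k s : prot_chain k.+1 s -> prot_chain k s.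
Proof.
elim: s k => [//|x s IH] [|k]; first by rewrite prot_chain0.
by move=> /= /andP[/protW -> /IH ->].
Qed.

Lemma prot_chain_rcons k s x : prot_chain k (rcons s x) = prot_chain k s && prot (k - size s) x.
Proof.
elim: s k => [|y s IH] k /=; first by rewrite subn0 andbT.
by rewrite IH -andbA; case: k => //= k; rewrite subSS.
Qed.

Lemma count_add (T : Type) (p q r : pred T) (s : seq T) :
  (forall x, p x = q x + r x :> nat)%N -> (count p s = count q s + count r s)%N.
Proof. by move=> pqr; elim: s => //= x s ->; rewrite pqr; lia. Qed.

(** Nodes at depth [i] of [T] for which the chain up to and including the root of [T] is
protected, the root being [r]-protected.  These numbers, unlike the numbers of nodes of given
rank, satisfy a recursion under the split. *)
Definition chaincount i r T :=
  count (fun s => (size s == i) && prot_chain (r + i) (rcons s T)) (spines T).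

Definition deep_rank_count k T := count (fun s => (k <= size s)%N && prot_chain k s) (spines T).

Definition depth_count d T := count (fun s => size s == d) (spines T).

Definition height_count k T :=
  count (fun s => if s is x :: _ then height_le k x else false) (spines T).

(** Only the first [k.+1] entries of the chain of a node matter, and these belong to the fringe
tree of its [k]-th ancestor. *)
Lemma deep_rank_countE k T : deep_rank_count k.+1 T = fsum (chaincount k 1) T.
Proof.
elim: T => [//|a IHa b IHb] /=.
rewrite /deep_rank_count /= count_cat -/(deep_rank_count k.+1 a) IHa -addnA; congr addn.
rewrite count_map -IHb; apply: count_add => s /=.
rewrite size_rcons add1n ltnS !prot_chain_rcons.
case: (ltngtP (size s) k) => [_|lt|->] //=.
by rewrite (eqP (lt : k.+1 - size s == 0)%N) andbT addn0.
Qed.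

Lemma count_spines_nil T : count (fun s => size s == 0%N) (spines T) = 1%N.
Proof.
elim: T => //= a IHa b _; rewrite count_cat IHa count_map.
by rewrite (eq_count (a2 := pred0)) ?count_pred0// => s /=; rewrite size_rcons.
Qed.

Lemma size_spines T : size (spines T) = nodes T.
Proof. by elim: T => //= a IHa b IHb; rewrite size_cat size_map IHa IHb. Qed.

Lemma chaincount0 r T : chaincount 0 r T = prot r T.
Proof.
rewrite /chaincount (eq_count (a2 := fun s => (size s == 0%N) && prot r T)); last first.
  by case=> //=; rewrite addn0 andbT.
case: (prot r T); last by rewrite (eq_count (a2 := pred0)) ?count_pred0// => s; rewrite andbF.
by rewrite -[RHS](count_spines_nil T); apply: eq_count => s; rewrite andbT.
Qed.

Lemma chaincount_Single i r : chaincount i.+1 r Single = 0%N.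
Proof. by []. Qed.

Lemma count_andr (T : Type) (p : pred T) (c : bool) s :
  count (fun x => p x && c) s = (count p s * c)%N.
Proof.
case: c; last by rewrite muln0 (eq_count (a2 := pred0)) ?count_pred0// => x; rewrite andbF.
by rewrite muln1; apply: eq_count => x; rewrite andbT.
Qed.

(** In [Join a b] the chain of a node of [a] only gains the condition on the root of [b], a child
of the common root, while the chain of a node of [b] passes through the root of [b]; the latter is
asked to be [r.+2]-protected from within its own subtree, which is more than the [r.+1]-protection
of the common root requires from it. *)
Lemma chaincountS i r a b : chaincount i.+1 r.+1 (Join a b) =
  (chaincount i.+1 r.+1 a * prot r b + allkids (prot r) a * chaincount i r.+2 b)%N.
Proof.
rewrite {1}/chaincount /= count_cat count_map; congr addn.
  rewrite -count_andr; case: a => [//|a1 a2]; apply: eq_count => s /=.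
  case: eqP => //= sz; rewrite !prot_chain_rcons sz addnK !protS /=.
  by rewrite !andbA.
rewrite mulnC -count_andr; apply: eq_count => s /=.
rewrite size_rcons eqSS; case: eqP => //= sz.
rewrite !prot_chain_rcons size_rcons sz addnK protS /= addnS -addSn addnK.
case pb: (prot r.+2 b); last by rewrite !andbF.
by rewrite (protW (protW pb)) !andbT andbC.
Qed.

Lemma depth_countS d a b : depth_count d.+1 (Join a b) = (depth_count d.+1 a + depth_count d b)%N.
Proof.
rewrite /depth_count /= count_cat count_map; congr addn.
by apply: eq_count => s /=; rewrite size_rcons.
Qed.

Lemma depth_count0 T : depth_count 0 T = 1%N.
Proof. exact: count_spines_nil. Qed.

Lemma height_countE k T : height_count k T = fsum (height_le k) T.
Proof.
elim: T => [//|a IHa b IHb] /=.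
rewrite /height_count /= count_cat -/(height_count k a) IHa -addnA; congr addn.
rewrite count_map -IHb.
have -> : (height_le k b : nat) = count (fun s => (size s == 0%N) && height_le k b) (spines b).
  by rewrite count_andr count_spines_nil mul1n.
by apply: count_add => -[|x s] /=; rewrite ?addn0 ?add0n.
Qed.

(** * Sequences solving the split recursions *)

Section Sequences.
Variable R : realType.
Implicit Types u v w : nat -> R.

Definition cv u v n := \sum_(j < n.+1) u j * v (n - j)%N.

Lemma cv_poly u v n N : (n < N)%N ->
  cv u v n = ((\poly_(i < N) u i) * (\poly_(i < N) v i))`_n.
Proof.
move=> nN; rewrite coefM; apply: eq_bigr => j _.
have jn : (j <= n)%N by rewrite -ltnS.
by rewrite !coef_poly !(leq_ltn_trans _ nN)// leq_subr.
Qed.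

Lemma cvC u v n : cv u v n = cv v u n.
Proof. by rewrite !(@cv_poly _ _ _ n.+1)// mulrC. Qed.

Lemma cvA u v w n : cv u (cv v w) n = cv (cv u v) w n.
Proof.
rewrite (@cv_poly _ _ _ n.+1)// (@cv_poly (cv u v) _ _ n.+1)//.
rewrite [LHS]coefM [RHS]coefM.
pose p x := \poly_(i < n.+1) (x i : R).
transitivity ((p u * (p v * p w))`_n).
  rewrite coefM; apply: eq_bigr => j _; congr (_ * _).
  by rewrite coef_poly ltnS leq_subr (@cv_poly _ _ _ n.+1)// ltnS leq_subr.
rewrite mulrA coefM; apply: eq_bigr => j _; congr (_ * _).
by rewrite coef_poly ltn_ord (@cv_poly _ _ _ n.+1).
Qed.

(** For the generating functions, W' = U W and W(0) = 1. *)
Definition is_sol u w := w 0%N = 1 /\ forall n, n.+1%:R * w n.+1 = cv u w n.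

(** Variation of constants: B' = A B and F' = A F + B G give (F / B)' = G, hence F is B times the
integral of G. *)
Lemma cv_factor (a b g F : nat -> R) :
  is_sol a b -> F 0%N = 0 ->
  (forall n, n.+1%:R * F n.+1 = cv F a n + cv b g n) ->
  forall n, F n.+1 = cv (fun j => g j / j.+1%:R) b n.
Proof.
move=> [b0 bS] F0 FS.
set phi := fun j => _.
suff H n : forall m, (m <= n)%N -> F m = (if m is k.+1 then cv phi b k else 0).
  by move=> n; rewrite (H n.+1).
elim: n => [|n IH] m; first by case: m.
rewrite leq_eqVlt => /orP[/eqP ->|]; last by rewrite ltnS; exact: IH.
apply: (@mulfI _ (n.+1%:R)); first by rewrite pnatr_eq0.
rewrite FS.
(* the derivative of a product: the factor n + 1 is shared between j + 1 and n - j *)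
have -> : n.+1%:R * cv phi b n = cv g b n + \sum_(j < n.+1) phi j * ((n - j)%:R * b (n - j)%N).
  rewrite /cv mulr_sumr -big_split; apply: eq_bigr => j _ /=.
  have -> : g j = phi j * j.+1%:R by rewrite /phi divfK // pnatr_eq0.
  have -> : n.+1%:R = j.+1%:R + (n - j)%:R :> R.
    by rewrite -natrD; congr _%:R; have := ltn_ord j; lia.
  ring.
rewrite addrC [cv b g n]cvC; congr (_ + _).
case: n IH => [|n] IH; first by rewrite /cv !big_ord1 F0 !mul0r mulr0.
rewrite /cv big_ord_recl F0 mul0r add0r [RHS]big_ord_recr /= subnn mul0r mulr0 addr0.
transitivity (cv (cv phi b) a n).
  by apply: eq_bigr => j _; rewrite IH //=; have := ltn_ord j; rewrite /bump; lia.
rewrite -cvA; apply: eq_bigr => j _; congr (_ * _).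
rewrite subSn; last by rewrite -ltnS.
by rewrite bS cvC.
Qed.

Lemma sol_ge0 u w : is_sol u w -> (forall n, 0 <= u n) -> forall n, 0 <= w n.
Proof.
move=> [w0 wS] u0; elim/ltn_ind=> -[|n] IH; first by rewrite w0.
rewrite -(pmulr_rge0 (x := n.+1%:R)) ?ltr0n// wS sumr_ge0// => j _.
by rewrite mulr_ge0 ?u0// IH// ltnS leq_subr.
Qed.

(** The convolutions for w_{n+2} and w_{n+1} differ by the extra term u_0 w_{n+1} <= w_{n+1},
which the factor n+2 on the left absorbs. *)
Lemma sol_noninc u w : is_sol u w -> (forall n, 0 <= u n) -> u 0%N <= 1 ->
  (forall n, u n.+1 <= u n) -> forall n, w n.+1 <= w n.
Proof.
move=> sw u0 u01 uS; have w_ge0 := sol_ge0 sw u0.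
case: sw => w0 wS [|n].
  by have := wS 0%N; rewrite /cv big_ord1 mul1r subnn w0 mulr1 => ->.
rewrite -(ler_pM2l (x := n.+2%:R)) ?ltr0n// wS /cv big_ord_recl subn0.
have -> : n.+2%:R * w n.+1 = w n.+1 + n.+1%:R * w n.+1.
  by rewrite -natr1 mulrDl mul1r addrC.
rewrite wS lerD//; first by rewrite ler_piMl.
by apply: ler_sum => j _; rewrite /= /bump add1n subSS ler_wpM2r.
Qed.

Definition pr (P : pred rtree) n : R := Es n (fun T => (P T)%:R).

Lemma pr_ge0 P n : 0 <= pr P n.
Proof. by apply: Es_ge0 => T; rewrite ler0n. Qed.

Lemma pr_le1 P n : pr P n <= 1.
Proof. by rewrite -(Es1 R n); apply: le_Es => T; rewrite lern1 leq_b1. Qed.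

Lemma pr_allkids P : is_sol (pr P) (pr (allkids P)).
Proof.
split=> [|n]; first by rewrite /pr /=.
rewrite /pr (@Es_split_mul _ n (fun T => (allkids P T)%:R) (fun T => (P T)%:R)).
  by rewrite cvC.
by move=> a b /=; rewrite -natrM mulnb.
Qed.

Lemma pr_prot0 n : pr (prot 0) n = 1.
Proof. by rewrite /pr Es1. Qed.

Lemma Es_single n : pr single n = (n == 0%N)%:R.
Proof.
case: n => [//|n]; rewrite /pr.
apply: (@mulfI _ (n.+1%:R)); first by rewrite pnatr_eq0.
rewrite Es_split big1 ?mulr0// => j _.
by rewrite -[RHS](Es0 R j); apply: eq_Es => a; exact: Es0.
Qed.

Lemma pr_protS m n : pr (prot m.+1) n = pr (allkids (prot m)) n - (n == 0%N)%:R.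
Proof.
rewrite -Es_single -EsB; apply: eq_Es => T; rewrite protS.
by case: T => [|a b] /=; rewrite ?subrr ?subr0.
Qed.

Definition echain i r n : R := Es n (fun T => (chaincount i r T)%:R).

Lemma echain0 r n : echain 0 r n = pr (prot r) n.
Proof. by apply: eq_Es => T; rewrite chaincount0. Qed.

Lemma echainS0 i r : echain i.+1 r 0 = 0.
Proof. by []. Qed.

(** The two summands of [chaincountS] are the two terms of the hypothesis of [cv_factor]. *)
Lemma echainS i r n : echain i.+1 r.+1 n.+1 =
  cv (fun j => echain i r.+2 j / j.+1%:R) (pr (allkids (prot r))) n.
Proof.
apply: (@cv_factor (pr (prot r))); [exact: pr_allkids|exact: echainS0|].
move=> {}n.
have -> : echain i.+1 r.+1 n.+1 =
   Es n.+1 (fun T => if T is Join a b then (chaincount i.+1 r.+1 a * prot r b)%:R else 0) +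
   Es n.+1 (fun T => if T is Join a b then (allkids (prot r) a * chaincount i r.+2 b)%:R else 0).
  by rewrite -EsD; apply: eq_Es => -[|a b]; rewrite ?chaincount_Single ?addr0// chaincountS natrD.
rewrite mulrDr; congr (_ + _).
  rewrite (@Es_split_mul _ n (fun T => (chaincount i.+1 r.+1 T)%:R) (fun T => (prot r T)%:R))//.
  by move=> a b; rewrite natrM.
rewrite (@Es_split_mul _ n (fun T => (allkids (prot r) T)%:R) (fun T => (chaincount i r.+2 T)%:R))//.
by move=> a b; rewrite natrM.
Qed.

Lemma echain_ge0 i r n : 0 <= echain i r n.
Proof. by apply: Es_ge0 => T. Qed.

Definition edepth d n : R := Es n (fun T => (depth_count d T)%:R).

Lemma edepth0 n : edepth 0 n = 1.
Proof. by rewrite -(Es1 R n); apply: eq_Es => T; rewrite depth_count0. Qed.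

Lemma edepthS d n : edepth d.+1 n = \sum_(j < n) edepth d j / j.+1%:R.
Proof.
elim: n => [|n IHn]; first by rewrite big_ord0.
have rec m : m.+1%:R * edepth d.+1 m.+1 = \sum_(j < m.+1) (edepth d.+1 j + edepth d j).
  by rewrite /edepth (@Es_split_add _ m (fun T => (depth_count d.+1 T)%:R) (fun T => (depth_count d T)%:R))//
    => a b; rewrite depth_countS natrD.
have step : n.+1%:R * edepth d.+1 n.+1 =
    n%:R * edepth d.+1 n + (edepth d.+1 n + edepth d n).
  rewrite rec big_ord_recr /=; congr (_ + _).
  by case: (n) => [|m]; [rewrite big_ord0 mul0r|rewrite rec].
rewrite big_ord_recr /= -IHn.
apply: (@mulfI _ (n.+1%:R)); first by rewrite pnatr_eq0.
rewrite step mulrDr mulrCA divff ?pnatr_eq0// mulr1 -natr1; ring.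
Qed.

End Sequences.

(** * Labelled trees and sequences of attachment choices *)

(** The same binary encoding with the labels of the nodes kept; [graft i m T] attaches the new
node [m] to the node [i], and the sequence [s] of choices attaches the node t+1 to the t-th entry.
*)
Inductive ltree := Lf of nat | Nd of ltree & ltree.

Fixpoint labels T := match T with Lf a => [:: a] | Nd a b => labels a ++ labels b end.
Fixpoint erase T := match T with Lf _ => Single | Nd a b => Join (erase a) (erase b) end.
Fixpoint lroot T := match T with Lf a => a | Nd a _ => lroot a end.
Fixpoint graft (i m : nat) T := match T with
  | Lf a => if a == i then Nd (Lf a) (Lf m) else Lf a
  | Nd a b => Nd (graft i m a) (graft i m b) end.
Fixpoint kids T (u : nat) : seq nat := match T with
  | Lf _ => [::]
  | Nd a b => (if u == lroot a then [:: lroot b] else [::]) ++ kids a u ++ kids b u end.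
Fixpoint spine T (v : nat) : seq rtree := match T with
  | Lf _ => [::]
  | Nd a b => if v \in labels a then spine a v else rcons (spine b v) (erase b) end.
Definition fringe T v := head (erase T) (spine T v).

Definition build (s : seq nat) := foldl (fun T i => graft i (size (labels T)) T) (Lf 0) s.

Lemma lroot_labels T : lroot T \in labels T.
Proof. by elim: T => [a|a IHa b _] /=; rewrite ?inE// mem_cat IHa. Qed.

Lemma graft_notin i m T : i \notin labels T -> graft i m T = T.
Proof.
elim: T => [a|a IHa b IHb] /=; first by rewrite inE eq_sym => /negbTE ->.
by rewrite mem_cat negb_or => /andP[/IHa -> /IHb ->].
Qed.

Lemma labels_graft i m T : uniq (labels T) -> i \in labels T ->
  perm_eq (labels (graft i m T)) (m :: labels T).
Proof.
elim: T => [a|a IHa b IHb] /=.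
  by move=> _; rewrite inE => /eqP ->; rewrite eqxx /= (perm_catC [:: a] [:: m]).
rewrite cat_uniq mem_cat => /and3P[ua /hasPn ab ub] /orP[ia|ib].
  rewrite (graft_notin m (T := b)); last by apply/negP => /ab; rewrite ia.
  by rewrite -cat_cons perm_cat2r; exact: IHa.
rewrite (graft_notin m (T := a)); last by exact: ab.
apply: (@perm_trans _ (labels a ++ m :: labels b)).
  by rewrite perm_cat2l; exact: IHb.
by rewrite perm_catC /= perm_cons perm_catC.
Qed.

Lemma lroot_graft i m T : lroot (graft i m T) = lroot T.
Proof. by elim: T => [a|a IHa b _] //=; case: eqP. Qed.

Lemma kids_graft i m T u c : uniq (labels T) -> i \in labels T ->
  (c \in kids (graft i m T) u) = (c \in kids T u) || ((u == i) && (c == m)).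
Proof.
elim: T => [a|a IHa b IHb] /=.
  by move=> _; rewrite inE => /eqP ->; rewrite eqxx /= !cats0; case: eqP => //=; rewrite inE.
rewrite cat_uniq mem_cat => /and3P[ua /hasPn ab ub] ii.
rewrite !mem_cat !lroot_graft; case/orP: ii => [ia|ib].
  rewrite (graft_notin m (T := b)); last by apply/negP => /ab; rewrite ia.
  by rewrite IHa// !orbA; do !case: (_ \in _) => //=; rewrite ?orbT ?orbF.
rewrite (graft_notin m (T := a)); last by exact: ab.
by rewrite IHb// !orbA.
Qed.

Section SumGraft.
Variable R : realType.
(** The link between labelled attachments and [grow]: each label is the target of one growth. *)
Lemma sum_graft (F : rtree -> R) m T : uniq (labels T) ->
  \sum_(i <- labels T) F (erase (graft i m T)) = \sum_(T' <- grow (erase T)) F T'.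
Proof.
elim: T F => [a|a IHa b IHb] F; first by rewrite /= !big_seq1 eqxx.
rewrite [labels _]/= cat_uniq => /and3P[ua /hasPn ab ub].
rewrite !big_cat !big_map -(IHa (fun x => F (Join x (erase b))))// -(IHb (fun x => F (Join (erase a) x)))//.
congr (_ + _); apply: eq_big_seq => i il /=.
  by rewrite (graft_notin m (T := b))//; apply/negP => /ab; rewrite il.
by rewrite (graft_notin m (T := a))//; exact: ab.
Qed.
End SumGraft.

Fixpoint choices (n : nat) : seq (seq nat) :=
  if n is m.+1 then [seq rcons s i | s <- choices m, i <- iota 0 m.+1] else [:: [::]].

Lemma mem_choicesS n s : reflect
  (exists2 s', s' \in choices n & exists2 i, (i <= n)%N & s = rcons s' i)
  (s \in choices n.+1).
Proof.
apply: (iffP allpairsP) => [[[s' i] /= [sn + ->]]|[s' sn [i ile ->]]].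
  by rewrite (mem_iota 0 n.+1) add0n ltnS; exists s' => //; exists i.
by exists (s', i); split=> //=; rewrite (mem_iota 0 n.+1) add0n ltnS.
Qed.

Lemma choicesP n s : reflect (size s = n /\ forall i, (i < n)%N -> (nth 0%N s i <= i)%N)
  (s \in choices n).
Proof.
apply: (iffP idP).
  elim: n s => [|n IH] s; first by rewrite inE => /eqP ->.
  move=> /mem_choicesS[s' /IH[sz H] [i ile ->]].
  split=> [|j]; first by rewrite size_rcons sz.
  rewrite ltnS leq_eqVlt nth_rcons sz => /orP[/eqP ->|jn]; first by rewrite ltnn eqxx.
  by rewrite jn; exact: H.
elim: n s => [|n IH] s [sz H]; first by case: s sz {H}.
case/lastP: s sz H => // s x; rewrite size_rcons => -[sz] H.
apply/mem_choicesS; exists s; last first.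
  by exists x => //; have := H _ (ltnSn n); rewrite nth_rcons sz ltnn eqxx.
apply: IH; split=> // i lti; have := H i (ltnW lti).
by rewrite nth_rcons sz lti.
Qed.

Lemma uniq_choices n : uniq (choices n).
Proof.
elim: n => [//|n IH].
apply: (@allpairs_uniq _ _ _ (@rcons nat) (choices n) (iota 0 n.+1)) => //; first exact: iota_uniq.
by move=> [s i] [s' i'] _ _ /= /rcons_inj[-> ->].
Qed.

Lemma build_rcons s i : build (rcons s i) = graft i (size (labels (build s))) (build s).
Proof. by rewrite /build -cats1 foldl_cat. Qed.

Lemma labels_build n s : s \in choices n -> perm_eq (labels (build s)) (iota 0 n.+1).
Proof.
elim: n s => [|n IH] s; first by rewrite inE => /eqP ->.
move=> /mem_choicesS[s' /[dup] sn /IH H [i ile ->]].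
rewrite build_rcons.
have u : uniq (labels (build s')) by rewrite (perm_uniq H) iota_uniq.
have ii : i \in labels (build s') by rewrite (perm_mem H) mem_iota.
apply: (perm_trans (labels_graft _ u ii)).
rewrite (perm_size H) size_iota.
rewrite -[n.+2]addn1 iotaD cats1 perm_sym perm_rcons perm_cons perm_sym.
exact: H.
Qed.

Lemma uniq_build n s : s \in choices n -> uniq (labels (build s)).
Proof. by move=> /labels_build H; rewrite (perm_uniq H) iota_uniq. Qed.

Lemma mem_build n s v : s \in choices n -> (v \in labels (build s)) = (v < n.+1)%N.
Proof. by move=> /labels_build H; rewrite (perm_mem H) mem_iota. Qed.

Lemma lroot_build s : lroot (build s) = 0%N.
Proof.
elim/last_ind: s => [//|s i IH].
by rewrite build_rcons lroot_graft.
Qed.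

Lemma kids_build n s u c : s \in choices n ->
  (c \in kids (build s) u) = [&& (0 < c)%N, (c <= n)%N & u == nth 0%N s c.-1].
Proof.
elim: n s c => [|n IH] s c.
  by rewrite inE => /eqP -> /=; rewrite in_nil; case: c.
move=> /mem_choicesS[s' sn [i ile ->]].
have szl : size (labels (build s')) = n.+1 by rewrite (perm_size (labels_build sn)) size_iota.
have /choicesP[sz _] := sn.
rewrite build_rcons kids_graft; [|exact: uniq_build sn|by rewrite (mem_build _ sn)].
rewrite (IH _ _ sn) szl nth_rcons sz.
case: c => [|c] /=; first by rewrite andbF.
rewrite eqSS ltnS; case: ltngtP => //=; rewrite ?andbF ?orbF ?andbT//.
Qed.

Section Mean.
Variable R : realType.

Definition pseq n (p : attachments n.+1) : seq nat := [seq (p t : nat) | t <- enum 'I_n].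

Lemma nth_pseq n (p : attachments n.+1) (t : 'I_n) : nth 0%N (pseq p) t = p t.
Proof. by rewrite (nth_map t) ?size_enum_ord// nth_ord_enum. Qed.

Lemma pseq_choices n (p : attachments n.+1) : pseq p \in choices n.
Proof.
apply/choicesP; split=> [|i lti]; first by rewrite size_map size_enum_ord.
by rewrite (nth_pseq p (Ordinal lti)) -ltnS.
Qed.

Lemma pseq_inj n : injective (@pseq n).
Proof.
move=> p q pq; apply/ffunP => t; apply: val_inj => /=.
by rewrite -!nth_pseq pq.
Qed.

Lemma perm_pseq n : perm_eq [seq pseq p | p <- index_enum (attachments n.+1)] (choices n).
Proof.
apply: uniq_perm; [|exact: uniq_choices|].
  by rewrite map_inj_uniq ?index_enum_uniq//; exact: pseq_inj.
move=> s; apply/mapP/idP => [[p _ ->]|sn]; first exact: pseq_choices.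
pose p : attachments n.+1 := [ffun t : 'I_n => inord (nth 0%N s t)].
exists p; first by rewrite mem_index_enum.
have /choicesP[sz H] := sn.
apply: (@eq_from_nth _ 0%N) => [|i]; first by rewrite size_map size_enum_ord.
rewrite sz => lti; rewrite (nth_pseq p (Ordinal lti)) ffunE inordK//=.
by rewrite ltnS H.
Qed.

Lemma prob_fact n (p : attachments n.+1) : rrt_prob R p = (n`!%:R)^-1.
Proof.
rewrite /rrt_prob /= prodfV; congr (_^-1).
elim: n {p} => [|n IH]; first by rewrite big_ord0.
by rewrite big_ord_recr /= IH factS mulnC natrM.
Qed.

Lemma sum_choices n (F : rtree -> R) :
  \sum_(s <- choices n) F (erase (build s)) = n`!%:R * Es n F.
Proof.
elim: n F => [|n IH] F; first by rewrite big_seq1 mul1r.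
have -> : choices n.+1 = [seq rcons s i | s <- choices n, i <- iota 0 n.+1] by [].
rewrite big_allpairs_dep factS mulnC natrM -mulrA -EsS -IH.
apply: eq_big_seq => s sn.
rewrite -(@sum_graft R F n.+1)//; last exact: uniq_build sn.
rewrite (perm_big _ (labels_build sn)); apply: eq_big_seq => i _.
by rewrite build_rcons (perm_size (labels_build sn)) size_iota.
Qed.

Lemma rrt_mean_Es n (F : rtree -> R) :
  rrt_mean (fun p : attachments n.+1 => F (erase (build (pseq p)))) = Es n F.
Proof.
rewrite /rrt_mean.
under eq_bigr do rewrite prob_fact.
rewrite -mulr_sumr.
rewrite -(big_map (@pseq n) xpredT (fun s => F (erase (build s)))) (perm_big _ (perm_pseq n)) /=.
by rewrite sum_choices mulrA mulVf ?mul1r// pnatr_eq0 -lt0n fact_gt0.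
Qed.

Lemma ler_rrt_mean n (X Y : attachments n -> R) :
  (forall p, X p <= Y p) -> rrt_mean X <= rrt_mean Y.
Proof.
move=> XY; apply: ler_sum => p _; rewrite ler_wpM2l//.
by apply: prodr_ge0 => t _; rewrite invr_ge0.
Qed.

End Mean.

Lemma kids_labels T u c : c \in kids T u -> (u \in labels T) && (c \in labels T).
Proof.
elim: T => [//|a IHa b IHb] /=; rewrite !mem_cat => /orP[|/orP[/IHa/andP[-> ->]//|/IHb/andP[-> ->]]].
  by case: eqP => // ->; rewrite inE => /eqP ->; rewrite !lroot_labels orbT.
by rewrite !orbT.
Qed.

Lemma spine_lroot T : spine T (lroot T) = [::].
Proof. by elim: T => //= a IHa b _; rewrite lroot_labels. Qed.

Lemma spine_nonroot T u : u \in labels T -> u <> lroot T -> spine T u <> [::].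
Proof.
elim: T => [a|a IHa b _] /=; first by rewrite inE => /eqP.
rewrite mem_cat; case: ifP => [ua _|_ _ _]; first exact: IHa.
by case: (spine b u).
Qed.

(** The bridge from nodes with labels to the label-free lists counted above. *)
Lemma map_spine T : uniq (labels T) -> [seq spine T v | v <- labels T] = spines (erase T).
Proof.
elim: T => [//|a IHa b IHb] /=; rewrite cat_uniq => /and3P[ua /hasPn ab ub].
rewrite map_cat -IHa// -IHb// -map_comp; congr cat; apply/eq_in_map => v vl /=.
  by rewrite vl.
by rewrite (negbTE (ab _ vl)).
Qed.

Lemma spine_kids T u c : uniq (labels T) -> c \in kids T u -> spine T c = fringe T c :: spine T u.
Proof.
elim: T => [//|a IHa b IHb] /=; rewrite cat_uniq => /and3P[ua /hasPn ab ub].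
rewrite /fringe /= !mem_cat => /orP[|/orP[child|child]].
- case: eqP => // ->; rewrite inE => /eqP ->.
  by rewrite lroot_labels (negbTE (ab _ (lroot_labels _))) !spine_lroot.
- have /andP[-> ->] := kids_labels child.
  by rewrite IHa.
- have /andP[/ab /negbTE -> /ab /negbTE ->] := kids_labels child.
  by rewrite IHb.
Qed.

Lemma fringe_allkids P T u : uniq (labels T) -> u \in labels T ->
  allkids P (fringe T u) = all (P \o fringe T) (kids T u).
Proof.
elim: T => [a|a IHa b IHb]; first by rewrite /= /fringe.
rewrite [labels _]/= cat_uniq mem_cat => /and3P[ua /hasPn ab ub] /orP[ul|ul].
- have kb : kids b u = [::].
    case E: (kids b u) => [//|c s].
    have /andP[/ab] : (u \in labels b) && (c \in labels b) by apply: kids_labels; rewrite E mem_head.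
    by rewrite ul.
  have ka : all (P \o fringe (Nd a b)) (kids a u) = all (P \o fringe a) (kids a u).
    apply: eq_in_all => c child; rewrite /= /fringe /=.
    have /andP[_ ->] := kids_labels child.
    by rewrite (spine_kids ua child).
  rewrite /= kb cats0 all_cat ka -IHa//.
  case: eqP => [ur|ur].
    rewrite /= andbT andbC /fringe /= ul ur spine_lroot /=; congr (_ && P _).
    by rewrite (negbTE (ab _ (lroot_labels b))) spine_lroot.
  congr allkids; rewrite /fringe /= ul.
  by have := spine_nonroot ul ur; case: (spine a u).
- have hd c : c \in labels b -> fringe (Nd a b) c = fringe b c.
    by move=> cl; rewrite /fringe /= (negbTE (ab _ cl)); case: (spine b c).
  have ka : kids a u = [::].
    case E: (kids a u) => [//|c s].
    have /andP[] : (u \in labels a) && (c \in labels a) by apply: kids_labels; rewrite E mem_head.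
    by rewrite (negbTE (ab _ ul)).
  have ur : (u == lroot a) = false.
    by apply: contraNF (ab _ ul) => /eqP ->; rewrite lroot_labels.
  rewrite hd//= ka ur /= IHb//; apply: eq_in_all => c child /=.
  by rewrite hd//; case/andP: (kids_labels child).
Qed.

Lemma allkids0 T : allkids xpred0 T = single T.
Proof. by case: T => //= a b; rewrite andbF. Qed.

(** * Rank and layer of deep nodes *)

(** Only the following is used of a rooted tree: the adjacency, the chain [u_ v] of fringe trees
of [v] and its nonroot ancestors, and the fringe tree [f_ v].  Nodes of positive depth have a
unique parent, so that their degree is governed by their children. *)
Section Graph.
Implicit Types P : pred rtree.
Variables (V : finType) (e child : rel V) (u_ : V -> seq rtree) (f_ : V -> rtree).
Hypothesis eE : forall u v, e u v = child u v || child v u.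
Hypothesis child_spine : forall u c, child u c -> u_ c = f_ c :: u_ u.
Hypothesis child_par : forall v, u_ v <> [::] -> exists u, child u v.
Hypothesis child_uniq : forall u u' v, child u v -> child u' v -> u = u'.
Hypothesis f_kids : forall P u, allkids P (f_ u) = [forall c, child u c ==> P (f_ c)].

Lemma f_single u : single (f_ u) = [forall c, ~~ child u c].
Proof. by rewrite -allkids0 f_kids; apply: eq_forallb => c; rewrite implybF. Qed.

Lemma child_asym u v : child u v -> child v u = false.
Proof.
move=> uv; apply/negP => /child_spine; rewrite (child_spine uv) => /(congr1 size) /=; lia.
Qed.

Lemma child_irr u : child u u = false.
Proof. by apply/negP => uu; have := child_asym uu; rewrite uu. Qed.

Lemma degree_par (S : {set V}) u v : child u v -> u \in S ->
  (degree_in e S v == 1)%N = [forall c, child v c ==> (c \notin S)].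
Proof.
move=> uv uS.
have -> : degree_in e S v = #|[set c in S | child v c]|.+1.
  rewrite /degree_in (cardsD1 u) inE uS eE uv orbT add1n; congr _.+1.
  apply: eq_card => c; rewrite !inE eE.
  case: (eqVneq c u) => [->|cu] /=; first by rewrite (child_asym uv) andbF.
  case cv: (child c v); last by rewrite orbF.
  by rewrite (child_uniq cv uv) eqxx in cu.
rewrite eqSS cards_eq0; apply/eqP/forallP => [/setP H c|H].
  by have := H c; rewrite !inE; case: (child v c) => //=; case: (c \in S).
apply/setP => c; rewrite !inE; have := H c.
by case: (child v c) => /=; rewrite ?andbF// andbT => /negbTE.
Qed.

Lemma leaf_par (S : {set V}) u v : child u v -> u \in S ->
  (v \in leaves e S) = (v \in S) && [forall c, child v c ==> (c \notin S)].
Proof.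
move=> uv uS; rewrite inE (degree_par uv uS).
suff -> : (S == [set v]) = false by rewrite orbF.
apply/eqP => SE; move: uS; rewrite SE inE => /eqP uE.
by move: uv; rewrite uE child_irr.
Qed.

(** The failure of rank >= k, in the form in which it propagates along edges. *)
Definition near k v := exists s, [/\ (size s < k)%N, path e v s & last v s \in leaves e [set: V]].

Lemma nearS k v : near k.+1 v <-> v \in leaves e [set: V] \/ exists2 u, e v u & near k u.
Proof.
split=> [[[|x s] /= [sz]]|].
- by move=> _; left.
- by move=> /andP[vx p] l; right; exists x => //; exists s.
case=> [vl|[u vu [s [sz p l]]]]; first by exists [::].
by exists (u :: s) => /=; rewrite vu.
Qed.

(** Induction on [k]: a short path to a leaf starts either with a child or with the parent.  In
the chain of a child less is required of [v] and its ancestors than in the chain of [v], so that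
only the protection of the child matters. *)
Lemma nearE k v : (k <= size (u_ v))%N -> near k v <-> ~~ prot_chain k (u_ v).
Proof.
elim: k v => [|k IH] v szv; first by rewrite prot_chain0; split=> // -[s []].
have [u uv] : exists u, child u v by apply: child_par => E; rewrite E in szv.
have uE := child_spine uv; rewrite uE /= ltnS in szv.
have key : prot_chain k.+1 (u_ v) = prot k.+1 (f_ v) && prot_chain k (u_ u) by rewrite uE.
rewrite nearS key (leaf_par uv) ?inE//= negb_and protS f_single f_kids.
have kidE c : child v c -> near k c <-> ~~ (prot k (f_ c) && prot_chain k.-1 (f_ v :: u_ u)).
  move=> vc; rewrite IH; first by rewrite (child_spine vc) uE.
  by rewrite (child_spine vc) uE /=; lia.
split=> [[/forallP lf|[w]]|].
- apply/orP; left; rewrite negb_and; apply/orP; left; rewrite negbK.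
  by apply/forallP => c; have := lf c; rewrite inE.
- rewrite eE => /orP[vw|wv].
    move=> /(kidE _ vw); rewrite negb_and => /orP[npw|nch].
      by apply/orP; left; rewrite negb_and; apply/orP; right; apply/forallPn; exists w; rewrite vw.
    rewrite -f_single -f_kids -protS -negb_and; apply: contra nch.
    case: (k) => [|k']; first by rewrite !prot_chain0.
    by move=> /andP[/protW/protW /= -> /prot_chainW]; case: (k') => //= k'' /prot_chainW.
  by rewrite (child_uniq wv uv) IH// => ->; rewrite orbT.
move=> /orP[|nch]; last by right; exists u; rewrite ?eE ?uv ?orbT//; apply/IH.
rewrite negb_and negbK => /orP[/forallP lf|/forallPn[c]].
  by left; apply/forallP => c; rewrite inE /= implybF.
rewrite negb_imply => /andP[vc nc]; right; exists c; first by rewrite eE vc.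
by apply/(kidE _ vc); rewrite negb_and nc.
Qed.

Lemma leq_bigmin (I : finType) (P : pred I) (F : I -> nat) x k :
  (k <= \big[Order.min/x]_(i | P i) F i)%N =
  (k <= x)%N && [forall i, P i ==> (k <= F i)%N].
Proof.
apply/idP/andP => [kb|[kx /forallP H]].
  split; first by apply: (leq_trans kb); rewrite -leEnat; exact: bigmin_le_id.
  apply/forallP => i; apply/implyP => Pi; apply: (leq_trans kb).
  by rewrite -leEnat; exact: bigmin_le_cond.
by rewrite -leEnat; apply: le_bigmin => // i Pi; have := H i; rewrite Pi.
Qed.

Lemma rank_near k v : (k <= #|V|)%N -> (k <= rank e v)%N <-> ~ near k v.
Proof.
move=> kV; rewrite /rank leq_bigmin kV /=; split=> [/forallP H [s [sz p l]]|nn].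
  have := H (last v s); rewrite l /gdist leq_bigmin kV /= => /forallP.
  move=> /(_ (Ordinal (leq_trans sz kV))) /implyP /= H'.
  suff /H' : [exists s0 : (size s).-tuple V, path e v s0 && (last v s0 == last v s)].
    by rewrite leqNgt sz.
  by apply/existsP; exists (in_tuple s); rewrite /= p eqxx.
apply/forallP => u; apply/implyP => ul; rewrite /gdist leq_bigmin kV /=.
apply/forallP => d; apply/implyP => /existsP[s /andP[p /eqP l]].
rewrite leqNgt; apply/negP => dk; apply: nn; exists s.
by rewrite size_tuple p l.
Qed.

Lemma rank_prot_chain k v : (k <= #|V|)%N -> (k <= size (u_ v))%N ->
  (k <= rank e v)%N = prot_chain k (u_ v).
Proof.
move=> kV szv; apply/idP/idP.
  by move=> /(rank_near _ kV) nn; apply/negPn/negP => /nearE -/(_ szv).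
by move=> c; apply/(rank_near _ kV) => /(nearE szv); rewrite c.
Qed.

Fixpoint survives j : pred rtree := if j is j'.+1 then fun x => ~~ height_le j' x else xpredT.

Lemma height_le_mono k x : height_le k x -> height_le k.+1 x.
Proof.
elim: k x => [|k IH] x /=; first by case: x.
by apply: allkids_sub; exact: IH.
Qed.

Lemma kids_survives j v : [forall c, child v c ==> ~~ survives j (f_ c)] = height_le j (f_ v).
Proof.
case: j => [|j] /=; first by rewrite f_single; apply: eq_forallb => c; rewrite implybF.
by rewrite f_kids; apply: eq_forallb => c; rewrite negbK.
Qed.

(** The parent of [v] is present whenever [v] is, having larger height; so [v] becomes
a leaf as soon as its children are gone. *)
Lemma strip_survives j v : (j <= size (u_ v))%N ->
  (v \in iter j (strip e) [set: V]) = survives j (f_ v).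
Proof.
elim: j v => [|j IH] v szv; first by rewrite inE.
have [u uv] : exists u, child u v by apply: child_par => E; rewrite E in szv.
have szu : (j <= size (u_ u))%N by rewrite (child_spine uv) in szv.
have kidE c : child v c -> (c \in iter j (strip e) [set: V]) = survives j (f_ c).
  by move=> vc; apply: IH; rewrite (child_spine vc) /=; lia.
case hv: (survives j (f_ v)); last first.
  rewrite /= inE IH ?hv ?andbF//; last by lia.
  case: (j) hv => [//|j'] /=; rewrite -/(height_le j'.+1 (f_ v)) => /negbFE.
  by move=> /height_le_mono ->.
have uS : u \in iter j (strip e) [set: V].
  rewrite IH//; case: (j) hv => [//|j'] /=; apply: contra => /height_le_mono /=.
  by rewrite f_kids => /forallP /(_ v); rewrite uv.
rewrite [LHS]inE (leaf_par uv uS) IH ?hv /=; last by lia.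
rewrite andbT -kids_survives; congr (~~ _); apply: eq_forallb => c.
by case vc: (child v c) => //=; rewrite kidE.
Qed.

Lemma leaves_survives j v : (j < size (u_ v))%N ->
  (v \in leaves e (iter j (strip e) [set: V])) = survives j (f_ v) && height_le j (f_ v).
Proof.
move=> szv; have := strip_survives szv; rewrite [LHS]inE (strip_survives (ltnW szv)) /=.
case lv: (v \in leaves _ _) => /=; first last.
  by move=> ->; case: (height_le j _).
move=> /esym/negbFE ->; move: lv; rewrite inE (strip_survives (ltnW szv)).
by case/andP => ->.
Qed.

Lemma first_height_le k x : height_le k x = [exists j : 'I_k.+1, survives j x && height_le j x].
Proof.
apply/idP/existsP => [|[[j /= jk] /andP[_ hj]]]; last first.
  have -> : k = ((k - j) + j)%N by rewrite subnK.
  by elim: (k - j)%N => //= d IH; exact: height_le_mono.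
elim: k x => [|k IH] x hk; first by exists ord0; move: hk => /= ->.
case h: (height_le k x); last by exists ord_max; rewrite /= h.
by have [j] := IH x h; exists (widen_ord (leqnSn _) j).
Qed.

(** Height at most [k] means that for some j <= k the node is present after j rounds and has no
child left. *)
Lemma layer_height_le k v : (k < #|V|)%N -> (k < size (u_ v))%N ->
  (layer e v <= k)%N = height_le k (f_ v).
Proof.
move=> kV szv; rewrite leqNgt /layer leq_bigmin kV /= negb_forall first_height_le.
apply/existsP/existsP => [[j]|[j]].
  rewrite negb_imply -leqNgt => /andP[jl jk].
  exists (Ordinal (jk : j < k.+1)%N) => /=.
  by rewrite -leaves_survives// (leq_ltn_trans jk).
have jk : (j <= k)%N by rewrite -ltnS.
move=> H; exists (Ordinal (leq_ltn_trans jk kV)).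
by rewrite negb_imply -leqNgt jk andbT /= leaves_survives// (leq_ltn_trans jk).
Qed.

End Graph.

(** * Comparison of graph statistics with fringe counts *)

Section Attach.
Variables (n : nat) (p : attachments n.+1).
Let T := build (pseq p).
Let sn : pseq p \in choices n := pseq_choices p.
Let uT : uniq (labels T) := uniq_build sn.

Definition tchild : rel 'I_n.+1 := [rel u c : 'I_n.+1 | (c : nat) \in kids T u].
Definition tspine (v : 'I_n.+1) := spine T v.
Definition tfringe (v : 'I_n.+1) := fringe T v.

Let vT (v : 'I_n.+1) : (v : nat) \in labels T.
Proof. by rewrite (mem_build _ sn). Qed.

Lemma tchildE u c : tchild u c = [exists t : 'I_n, (c == t.+1 :> nat) && (u == p t :> nat)].
Proof.
rewrite /tchild /= (kids_build _ _ sn); apply/and3P/existsP => [[c0 cn /eqP uc]|[t /andP[/eqP ct /eqP ut]]].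
  have ct : (c.-1 < n)%N by rewrite prednK.
  exists (Ordinal ct); have /= E := nth_pseq p (Ordinal ct).
  by apply/andP; split; [rewrite /= prednK|rewrite uc -E].
by rewrite ct /= ut nth_pseq.
Qed.

Lemma adj_tchild u v : rrt_adj p u v = tchild u v || tchild v u.
Proof.
rewrite !tchildE /=; apply/existsP/orP => [[t /orP[H|H]]|[/existsP[t H]|/existsP[t H]]].
- by right; apply/existsP; exists t.
- by left; apply/existsP; exists t.
- by exists t; rewrite H orbT.
- by exists t; rewrite H.
Qed.

Lemma tchild_spine u c : tchild u c -> tspine c = tfringe c :: tspine u.
Proof. exact: spine_kids. Qed.

Lemma tchild_par v : tspine v <> [::] -> exists u, tchild u v.
Proof.
move=> uv; have v0 : (0 < v)%N.
  by rewrite lt0n; apply/eqP => v0; apply: uv; rewrite /tspine v0 -(lroot_build (pseq p)) spine_lroot.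
have vn : (v <= n)%N by rewrite -ltnS.
have /choicesP[_ H] := sn.
have lt : (nth 0%N (pseq p) v.-1 < n.+1)%N.
  by rewrite ltnS (leq_trans (H _ _))//; lia.
by exists (Ordinal lt); rewrite /tchild /= (kids_build _ _ sn) v0 vn /=.
Qed.

Lemma tchild_uniq u u' v : tchild u v -> tchild u' v -> u = u'.
Proof.
rewrite /tchild /= !(kids_build _ _ sn) => /and3P[_ _ /eqP e1] /and3P[_ _ /eqP e2].
by apply: val_inj; rewrite /= e1 e2.
Qed.

Lemma tfringe_kids P u : allkids P (tfringe u) = [forall c, tchild u c ==> P (tfringe c)].
Proof.
rewrite /tfringe fringe_allkids//; apply/allP/forallP => [H c|H c child].
  by apply/implyP => /H.
have cn : (c < n.+1)%N by rewrite -(mem_build _ sn); case/andP: (kids_labels child).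
by have := H (Ordinal cn); rewrite /tchild /= child.
Qed.

Lemma card_spine (q : pred (seq rtree)) :
  #|[set v : 'I_n.+1 | q (tspine v)]| = count q (spines (erase T)).
Proof.
rewrite -map_spine// count_map (permP (labels_build sn)) -val_enum_ord count_map.
rewrite cardsE cardE size_filter enumT; exact: eq_count.
Qed.

Definition rank_tail k := #|[set v : 'I_n.+1 | (k <= rank (rrt_adj p) v)%N]|.
Definition layer_head k := #|[set v : 'I_n.+1 | (layer (rrt_adj p) v <= k)%N]|.

Lemma rank_countE k : (rank_count k p + rank_tail k.+1 = rank_tail k)%N.
Proof.
rewrite /rank_tail -[RHS](cardsID [set v : 'I_n.+1 | (k < rank (rrt_adj p) v)%N]) addnC.
congr addn; apply: eq_card => v; rewrite !inE; last first.
  by rewrite -leqNgt andbC -eqn_leq eq_sym.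
by case: ltnP => [/ltnW ->|]; rewrite ?andbF.
Qed.

Lemma layer_countE k : (layer_count k.+1 p + layer_head k = layer_head k.+1)%N.
Proof.
rewrite /layer_head -[RHS](cardsID [set v : 'I_n.+1 | (layer (rrt_adj p) v <= k)%N]) addnC.
congr addn; apply: eq_card => v; rewrite !inE; last first.
  by rewrite -ltnNge eqn_leq andbC.
by rewrite andbC; case: leqP => //= H; rewrite (leqW H).
Qed.

Lemma layer_count0 : layer_count 0 p = layer_head 0.
Proof. by apply: eq_card => v; rewrite !inE leqn0. Qed.

Lemma rank_tail0 : rank_tail 0 = n.+1.
Proof. by rewrite /rank_tail -[RHS]card_ord -cardsT; apply: eq_card => v; rewrite !inE. Qed.

Lemma card_shallow k : #|[set v | (size (tspine v) < k)%N]| = (\sum_(d < k) depth_count d (erase T))%N.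
Proof.
rewrite (card_spine (fun s => size s < k)%N).
elim: k => [|k IH]; first by rewrite big_ord0 (eq_count (a2 := pred0)) ?count_pred0.
rewrite big_ord_recr /= -IH; apply: count_add => s.
by rewrite ltnS; case: ltngtP.
Qed.

(** The nodes of small depth form the exceptional set [D] in the two comparisons below. *)
Lemma leq_card_exc (A B D : {set 'I_n.+1}) : (forall v, v \notin D -> v \in A -> v \in B) ->
  (#|A| <= #|B| + #|D|)%N.
Proof.
move=> H; suff /subset_leq_card/leq_trans : A \subset (B :|: D)%SET.
  by apply; rewrite cardsU leq_subr.
apply/fintype.subsetP => v vA; rewrite finset.in_setU orbC.
by case vD: (v \in D) => //=; apply: H; rewrite ?vD.
Qed.

Lemma rank_tail_bounds k (D := (\sum_(d < k) depth_count d (erase T))%N) : (k <= n.+1)%N ->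
  (rank_tail k <= deep_rank_count k (erase T) + D)%N /\ (deep_rank_count k (erase T) <= rank_tail k + D)%N.
Proof.
move=> kn; rewrite /D -card_shallow /deep_rank_count.
rewrite -(card_spine (fun s => (k <= size s)%N && prot_chain k s)).
have E v : v \notin [set v | (size (tspine v) < k)%N] ->
    (k <= rank (rrt_adj p) v)%N = (k <= size (tspine v))%N && prot_chain k (tspine v).
  rewrite inE -leqNgt => szv; rewrite szv /=.
  apply: (rank_prot_chain adj_tchild tchild_spine tchild_par tchild_uniq tfringe_kids) => //.
  by rewrite card_ord.
by split; apply: leq_card_exc => v /E Ev; rewrite !inE Ev.
Qed.

Lemma layer_head_bounds k (D := (\sum_(d < k.+1) depth_count d (erase T))%N) : (k <= n)%N ->
  (layer_head k <= height_count k (erase T) + D)%N /\ (height_count k (erase T) <= layer_head k + D)%N.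
Proof.
move=> kn; rewrite /D -card_shallow /height_count.
rewrite -(card_spine (fun s => if s is x :: _ then height_le k x else false)).
have E v : v \notin [set v | (size (tspine v) < k.+1)%N] ->
    (layer (rrt_adj p) v <= k)%N = (if tspine v is x :: _ then height_le k x else false).
  rewrite inE -leqNgt => szv.
  rewrite (layer_height_le adj_tchild tchild_spine tchild_par tchild_uniq tfringe_kids) ?card_ord//.
  by rewrite /tfringe /fringe -/(tspine v); case: (tspine v) szv.
by split; apply: leq_card_exc => v /E Ev; rewrite !inE Ev.
Qed.

End Attach.

(** * Existence of the limits *)

Local Open Scope classical_set_scope.
Local Open Scope ring_scope.
Section Limits.
Variable R : realType.

Definition psum (f : nat -> R) (n : nat) := \sum_(j < n) f j / (j.+1%:R * j.+2%:R).

Lemma edepth_ge0 d n : 0 <= edepth R d n.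
Proof. by apply: Es_ge0 => T. Qed.

(** The expected number of nodes at depth d+1, divided by the size, is an arithmetic mean
of the same quantity for depth d. *)
Lemma edepth_small d : (fun n => edepth R d n / n.+1%:R) @ \oo --> (0 : R).
Proof.
elim: d => [|d IH].
  rewrite (_ : (fun n => _) = @harmonic R); first exact: cvg_harmonic.
  by apply/funext => n; rewrite edepth0 mul1r.
apply: (@squeeze_cvgr _ _ _ _ (cst 0) (arithmetic_mean (fun n => edepth R d n / n.+1%:R))).
- apply: nearW => n; apply/andP; split; first by rewrite divr_ge0// edepth_ge0.
  rewrite /arithmetic_mean /= edepthS mulrC ler_wpM2l ?invr_ge0//.
  rewrite /series /= big_mkord big_ord_recr /= lerDl.
  by rewrite divr_ge0// edepth_ge0.
- exact: cvg_cst.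
- exact: cesaro.
Qed.

(** By [Es_fsum], n+1 times the n-th partial sum is at most the expected number of nodes, which is
n+1. *)
Lemma psum_cvg (f : rtree -> nat) : (forall T, fsum f T <= nodes T)%N ->
  cvgn (psum (fun j => Es j (fun T => (f T)%:R))).
Proof.
move=> fn; apply: nondecreasing_is_cvgn.
  apply/nondecreasing_seqP => n; rewrite /psum big_ord_recr /= lerDl.
  by rewrite divr_ge0// ?mulr_ge0//; apply: Es_ge0.
exists 1 => _ [n _ <-]; rewrite -(ler_pM2l (x := n.+1%:R)) ?ltr0n// mulr1.
rewrite -(@Es_fsum _ n (fun T => (f T)%:R) f)// -Es_nodes.
by apply: le_Es => T; rewrite ler_nat.
Qed.

Lemma rrt_mean_sandwich n (X : attachments n.+1 -> nat) (Y D : rtree -> nat) :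
  (forall p (T := erase (build (pseq p))), (X p <= Y T + D T)%N /\ (Y T <= X p + D T)%N) ->
  Es n (fun T => (Y T)%:R) - Es n (fun T => (D T)%:R) <= rrt_mean (fun p => (X p)%:R : R)
   <= Es n (fun T => (Y T)%:R) + Es n (fun T => (D T)%:R).
Proof.
move=> H; rewrite -EsB -EsD -!rrt_mean_Es; apply/andP; split; apply: ler_rrt_mean => p.
  by rewrite lerBlDr -natrD ler_nat; case: (H p).
by rewrite -natrD ler_nat; case: (H p).
Qed.

Lemma rrt_meanZ n (X : attachments n -> R) c : rrt_mean (fun p => X p * c) = rrt_mean X * c.
Proof. by rewrite /rrt_mean mulr_suml; apply: eq_bigr => p _; rewrite mulrA. Qed.

Lemma rrt_meanB n (X Y : attachments n -> R) :
  rrt_mean (fun p => X p - Y p) = rrt_mean X - rrt_mean Y.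
Proof. by rewrite /rrt_mean -sumrB; apply: eq_bigr => p _; rewrite mulrBr. Qed.

Lemma Es_natsum n (k : nat) (f : nat -> rtree -> nat) :
  Es n (fun T => (\sum_(d < k) f d T)%N%:R) = \sum_(d < k) Es n (fun T => (f d T)%:R) :> R.
Proof. by rewrite -Es_sum; apply: eq_Es => T; rewrite natr_sum. Qed.

Lemma mean_cvg (X : forall n, attachments n.+1 -> nat) (f : rtree -> nat) (k N : nat) :
  (forall T, fsum f T <= nodes T)%N ->
  (forall n (p : attachments n.+1) (T := erase (build (pseq p)))
     (D := (\sum_(d < k) depth_count d T)%N), (N <= n)%N ->
     (X n p <= fsum f T + D)%N /\ (fsum f T <= X n p + D)%N) ->
  (fun n => rrt_mean (fun p => (X n p)%:R / n.+1%:R : R)) @ \oo -->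
    limn (psum (fun j => Es j (fun T => (f T)%:R))).
Proof.
move=> fn H; set s := psum _.
pose d n := \sum_(i < k) edepth R i n / n.+1%:R.
have d0 : d @ \oo --> (0 : R).
  rewrite /d; elim: (k) => [|m IHm].
    by rewrite (_ : (fun n => _) = cst 0); [exact: cvg_cst|apply/funext => n; rewrite big_ord0].
  rewrite (_ : (fun n => _) = (fun n => \sum_(i < m) edepth R i n / n.+1%:R + edepth R m n / n.+1%:R)).
    by rewrite -[X in _ --> X]addr0; apply: cvgD => //; exact: edepth_small.
  by apply/funext => n; rewrite big_ord_recr.
have sc : s @ \oo --> limn s by exact: psum_cvg.
apply: (@squeeze_cvgr _ _ _ _ (fun n => s n - d n) (fun n => s n + d n)).
- near=> n.
  have Nn : (N <= n)%N by near: n; exact: nbhs_infty_ge.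
  have := @rrt_mean_sandwich n (X n) (fsum f) (fun T => \sum_(d < k) depth_count d T)%N
    (fun p => H n p Nn).
  rewrite (@Es_fsum _ n (fun T => (f T)%:R) f)// Es_natsum -/(s n).
  rewrite rrt_meanZ ler_pdivlMr ?ltr0n// ler_pdivrMr ?ltr0n//.
  have dE : d n * n.+1%:R = \sum_(i < k) edepth R i n.
    by rewrite /d mulr_suml; apply: eq_bigr => i _; rewrite divfK// pnatr_eq0.
  by rewrite mulrBl mulrDl dE [s n * _]mulrC.
- by rewrite -[X in _ --> X]subr0; apply: cvgB.
- by rewrite -[X in _ --> X]addr0; apply: cvgD.
Unshelve. all: by end_near. Qed.

(** Limiting fractions of the nodes of rank at least [k], respectively at layer at most [k]. *)
Definition rtail k : R := if k is k'.+1 then limn (psum (echain R k' 1)) else 1.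
Definition lhead k : R := limn (psum (pr R (height_le k))).

Definition rank_mean k n : R :=
  rrt_mean (fun p : attachments n.+1 => (rank_tail p k)%:R / n.+1%:R).
Definition layer_mean k n : R :=
  rrt_mean (fun p : attachments n.+1 => (layer_head p k)%:R / n.+1%:R).

Lemma cvg_rank_tail k : rank_mean k @ \oo --> rtail k.
Proof.
rewrite /rank_mean.
case: k => [|k] /=.
  rewrite (_ : (fun n => _) = cst 1); first exact: cvg_cst.
  apply/funext => n /=; rewrite -[RHS](Es1 R n) -[RHS]rrt_mean_Es; congr rrt_mean.
  by apply/funext => p; rewrite rank_tail0 mulfV ?pnatr_eq0.
apply: (@mean_cvg _ (chaincount k 1) k.+1 k) => [T|n p T D kn].
  by rewrite -deep_rank_countE -size_spines; exact: count_size.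
by rewrite -deep_rank_countE; exact: rank_tail_bounds.
Qed.

Lemma cvg_layer_head k : layer_mean k @ \oo --> lhead k.
Proof.
rewrite /layer_mean.
apply: (@mean_cvg _ (fun T => height_le k T : nat) k.+1 k) => [T|n p T D kn].
  by rewrite -height_countE -size_spines; exact: count_size.
by rewrite -height_countE; exact: layer_head_bounds.
Qed.

Lemma cvg_rank_frac k : rank_frac R k @ \oo --> rtail k - rtail k.+1.
Proof.
rewrite -cvg_shiftS.
suff -> : [sequence rank_frac R k n.+1]_n = rank_mean k - rank_mean k.+1.
  exact: cvgB (@cvg_rank_tail k) (@cvg_rank_tail k.+1).
apply/funext => n; rewrite -[RHS]/(_ - _) -rrt_meanB /=; congr rrt_mean.
by apply/funext => p; rewrite -mulrBl -(rank_countE p k) natrD addrK.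
Qed.

Lemma cvg_layer_frac k : layer_frac R k.+1 @ \oo --> lhead k.+1 - lhead k.
Proof.
rewrite -cvg_shiftS.
suff -> : [sequence layer_frac R k.+1 n.+1]_n = layer_mean k.+1 - layer_mean k.
  exact: cvgB (@cvg_layer_head k.+1) (@cvg_layer_head k).
apply/funext => n; rewrite -[RHS]/(_ - _) -rrt_meanB /=; congr rrt_mean.
by apply/funext => p; rewrite -mulrBl -(layer_countE p k) natrD addrK.
Qed.

Lemma cvg_layer_frac0 : layer_frac R 0 @ \oo --> lhead 0.
Proof.
rewrite -cvg_shiftS.
suff -> : [sequence layer_frac R 0 n.+1]_n = layer_mean 0 by exact: cvg_layer_head.
apply/funext => n /=; rewrite /layer_frac; congr rrt_mean.
by apply/funext => p; rewrite layer_count0.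
Qed.

End Limits.

(** * Series of nonnegative terms, weights and their moments *)

Section Bounds.
Variable R : realType.
Implicit Types (u w f g G b phi F : nat -> R) (x y : R).

(** For nonnegative terms this says that the sum of the series is at most [y], without mentioning
convergence. *)
Definition ubs f y := forall n, \sum_(j < n) f j <= y.

Lemma sum_nneg_le f m n : (forall j, 0 <= f j) -> (m <= n)%N ->
  \sum_(j < m) f j <= \sum_(j < n) f j.
Proof.
move=> f0 mn; rewrite -!(big_mkord xpredT f) (big_cat_nat _ mn)//= lerDl.
by apply: sumr_ge0.
Qed.

Lemma ubs_cvg f y : (forall j, 0 <= f j) -> ubs f y ->
  cvgn (fun n => \sum_(j < n) f j).
Proof.
move=> f0 fy; apply: nondecreasing_is_cvgn.
  by apply/nondecreasing_seqP => n; rewrite big_ord_recr lerDl.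
by exists y => _ [n _ <-].
Qed.

Lemma lim_ubs f y : (forall j, 0 <= f j) -> cvgn (fun n => \sum_(j < n) f j) ->
  (limn (fun n => \sum_(j < n) f j) <= y) <-> ubs f y.
Proof.
move=> f0 cf; split=> [fy n|fy]; last by apply: limr_le => //; exact: nearW.
apply: (le_trans _ fy).
apply: (@nondecreasing_cvgn_le R (fun n => \sum_(j < n) f j)) => //.
by apply/nondecreasing_seqP => m; rewrite big_ord_recr lerDl.
Qed.

Lemma cvg_fsum (J : nat) (c : nat -> R) (s : nat -> nat -> R) (l : nat -> R) :
  (forall j, s j @ \oo --> l j) ->
  (fun L => \sum_(j < J) c j * s j L) @ \oo --> \sum_(j < J) c j * l j.
Proof.
move=> sl; elim: J => [|J IH].
  rewrite big_ord0 (_ : (fun L => _) = cst 0); first exact: cvg_cst.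
  by apply/funext => L; rewrite big_ord0.
rewrite big_ord_recr /= (_ : (fun L => _) =
  (fun L => \sum_(j < J) c j * s j L + c J * s J L)).
  by apply: cvgD => //; apply: cvgMr.
by apply/funext => L; rewrite big_ord_recr.
Qed.

Lemma cv_triangle phi b g n :
  \sum_(m < n) cv phi b m * g m.+1 = \sum_(j < n) phi j * \sum_(l < n - j) b l * g (j + l).+1.
Proof.
elim: n => [|n IH]; first by rewrite !big_ord0.
rewrite big_ord_recr /= IH [RHS]big_ord_recr /= subSnn big_ord1 addn0.
rewrite /cv mulr_suml [X in _ + X]big_ord_recr /= subnn addrA -mulrA; congr (_ + _).
rewrite -big_split; apply: eq_bigr => j _ /=.
rewrite subSn; last by rewrite ltnW.
by rewrite big_ord_recr /= mulrDr mulrA subnKC// ltnW.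
Qed.

(** Tonelli: the sum of (phi * b) g, for a convolution shifted by one, is the sum of phi against
the correlation [G] of b and g. *)
Lemma ubs_adjoint phi b g F G y :
  (forall n, 0 <= phi n) -> (forall n, 0 <= b n) -> (forall n, 0 <= g n) ->
  F 0%N = 0 -> (forall n, F n.+1 = cv phi b n) ->
  (forall j, (fun L => \sum_(l < L) b l * g (j + l).+1) @ \oo --> G j) ->
  ubs (fun n => F n * g n) y <-> ubs (fun j => phi j * G j) y.
Proof.
move=> phi0 b0 g0 F0 FS cG.
have bg0 j l : 0 <= b l * g (j + l).+1 by rewrite mulr_ge0.
have FE n : \sum_(m < n.+1) F m * g m = \sum_(j < n) phi j * \sum_(l < n - j) b l * g (j + l).+1.
  rewrite big_ord_recl F0 mul0r add0r -cv_triangle; apply: eq_bigr => m _.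
  by rewrite FS.
split=> H n.
  have := @cvg_fsum n phi (fun j L => \sum_(l < L) b l * g (j + l).+1) G cG.
  move=> c; rewrite -(cvg_lim _ c)//; apply: limr_le; first by apply/cvg_ex; eexists; exact: c.
  apply: nearW => L; apply: (le_trans _ (H (n + L).+1)); rewrite FE.
  apply: (@le_trans _ _ (\sum_(j < n) phi j * \sum_(l < n + L - j) b l * g (j + l).+1)).
    apply: ler_sum => j _; rewrite ler_wpM2l//.
    apply: (@sum_nneg_le (fun l => b l * g (j + l).+1)) => //; have := ltn_ord j; lia.
  apply: (@sum_nneg_le (fun j => phi j * \sum_(l < n + L - j) b l * g (j + l).+1)).
    by move=> j; rewrite mulr_ge0// sumr_ge0.
  exact: leq_addr.
case: n => [|n]; first by have := H 0%N; rewrite !big_ord0.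
rewrite FE; apply: (le_trans _ (H n)); apply: ler_sum => j _; rewrite ler_wpM2l//.
rewrite -(cvg_lim _ (cG j))//.
apply: (@nondecreasing_cvgn_le R (fun L => \sum_(l < L) b l * g (j + l).+1)).
  by apply/nondecreasing_seqP => m; rewrite big_ord_recr lerDl.
by apply/cvg_ex; eexists; exact: cG.
Qed.

Notation a_ m := (pr R (prot m)).
Notation b_ m := (pr R (allkids (prot m))).

Lemma a0E n : a_ 0 n = 1. Proof. exact: pr_prot0. Qed.

Lemma b_sol m : is_sol (a_ m) (b_ m). Proof. exact: pr_allkids. Qed.

Lemma b0E n : b_ 0 n = 1.
Proof.
have [b00 bS] := b_sol 0.
elim/ltn_ind: n => -[//|n] IH; apply: (@mulfI _ (n.+1%:R)); first by rewrite pnatr_eq0.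
rewrite bS mulr1 /cv (eq_bigr (fun=> 1)) ?sumr_const ?card_ord// => j _.
by rewrite a0E IH ?mulr1// ltnS leq_subr.
Qed.

Lemma b1S n : n.+2%:R * b_ 1 n.+2 = n.+1%:R * b_ 1 n.+1 + b_ 1 n.
Proof.
have [b00 bS] := b_sol 1.
have E m : m.+1%:R * b_ 1 m.+1 = \sum_(i < m) b_ 1 i.
  rewrite bS cvC /cv big_ord_recr /= subnn pr_protS b0E subrr mulr0 addr0.
  apply: eq_bigr => j _; rewrite pr_protS b0E.
  by rewrite subn_eq0 leqNgt ltn_ord subr0 mulr1.
by rewrite !E big_ord_recr.
Qed.

Lemma b10 : b_ 1 0 = 1. Proof. by have [] := b_sol 1. Qed.

Lemma b11 : b_ 1 1 = 0.
Proof.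
have [_ /(_ 0%N)] := b_sol 1; rewrite mul1r => ->.
by rewrite /cv big_ord1 subnn pr_protS b0E subrr mul0r.
Qed.

(** The generating function exp(-x) / (1 - x), read off from the second order recursion [b1S]. *)
Lemma b1E n : b_ 1 n = series (exp_coeff (-1)) n.+1.
Proof.
suff H k : b_ 1 k.+1 - b_ 1 k = exp_coeff (-1) k.+1.
  rewrite /series /= big_mkord; elim: n => [|n IH].
    by rewrite big_ord1 /exp_coeff /= expr0 fact0 divr1 b10.
  by rewrite big_ord_recr /= -IH -H addrC subrK.
elim: k => [|k IH].
  by rewrite b10 b11 /exp_coeff /= expr1 divr1 sub0r.
apply: (@mulfI _ (k.+2%:R)); first by rewrite pnatr_eq0.
have -> : k.+2%:R * exp_coeff (-1) k.+2 = - exp_coeff (-1 : R) k.+1.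
  rewrite /exp_coeff /= exprS (factS k.+1) natrM invfM mulN1r !mulNr mulrN; congr (- _).
  by rewrite mulrCA mulVKf ?pnatr_eq0.
by rewrite -IH mulrBr b1S -[k.+2%:R]natr1 mulrDl mul1r; ring.
Qed.

Definition inve : R := expR (-1).

Lemma b1_cvg : b_ 1 @ \oo --> inve.
Proof.
rewrite (_ : b_ 1 = [sequence series (exp_coeff (-1)) n.+1]_n); last first.
  by apply/funext => n; rewrite b1E.
by rewrite cvg_shiftS; exact: is_cvg_series_exp_coeff.
Qed.

(** By [b1S] each term is a convex combination of the two preceding ones. *)
Lemma b1_stay n lo hi : lo <= b_ 1 n <= hi -> lo <= b_ 1 n.+1 <= hi ->
  forall m, (n <= m)%N -> lo <= b_ 1 m <= hi.
Proof.
move=> h0 h1.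
suff H k : (lo <= b_ 1 (n + k) <= hi) && (lo <= b_ 1 (n + k).+1 <= hi).
  by move=> m nm; have /andP[] := H (m - n)%N; rewrite subnKC.
elim: k => [|k /andP[IH0 IH1]]; first by rewrite addn0 h0 h1.
rewrite addnS IH1 /=; have := b1S (n + k); move: IH0 IH1.
set x := b_ 1 (n + k); set y := b_ 1 _.+1; set z := b_ 1 _.+2.
rewrite -[(n + k).+2%:R]natr1.
have c0 : 0 < (n + k).+1%:R :> R by rewrite ltr0n.
set c := (n + k).+1%:R in c0 *; move=> /andP[x1 x2] /andP[y1 y2] E.
have c1 : 0 < c + 1 by rewrite addr_gt0.
apply/andP; split; rewrite -(ler_pM2l c1) E; nra.
Qed.

Lemma inve_stay n lo hi : lo <= b_ 1 n <= hi -> lo <= b_ 1 n.+1 <= hi -> lo <= inve <= hi.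
Proof.
move=> h0 h1; have H := b1_stay h0 h1.
rewrite -(cvg_lim _ b1_cvg)//; apply/andP; split.
  apply: limr_ge; first by apply/cvg_ex; eexists; exact: b1_cvg.
  by exists n => // m /= nm; case/andP: (H m nm).
apply: limr_le; first by apply/cvg_ex; eexists; exact: b1_cvg.
by exists n => // m /= nm; case/andP: (H m nm).
Qed.

Lemma b1_2 : b_ 1 2 = 1 / 2.
Proof. have := b1S 0; rewrite b10 b11; lra. Qed.
Lemma b1_3 : b_ 1 3 = 1 / 3.
Proof. have := b1S 1; rewrite b1_2 b11; lra. Qed.
Lemma b1_4 : b_ 1 4 = 3 / 8.
Proof. have := b1S 2; rewrite b1_2 b1_3; lra. Qed.
Lemma b1_5 : b_ 1 5 = 11 / 30.
Proof. have := b1S 3; rewrite b1_4 b1_3; lra. Qed.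

Lemma inve_bounds : 11 / 30 <= inve <= 3 / 8.
Proof. by apply: (@inve_stay 4); rewrite ?b1_4 ?b1_5; lra. Qed.

Lemma a2E n : a_ 2 n = b_ 1 n - (n == 0%N)%:R. Proof. exact: pr_protS. Qed.

Lemma a2_le n : a_ 2 n <= 1 / 2.
Proof.
rewrite a2E; case: n => [|[|n]]; rewrite /= ?subr0 ?b10 ?b11 ?subrr //; try lra.
by have /andP[] := @b1_stay 2 0 (1/2) ltac:(rewrite b1_2; lra) ltac:(rewrite b1_3; lra) n.+2 isT.
Qed.

Lemma a2_ge n : (4 <= n)%N -> 11 / 30 <= a_ 2 n.
Proof.
move=> n4; rewrite a2E; have -> : (n == 0)%N = false by case: n n4.
rewrite subr0.
by have /andP[] := @b1_stay 4 (11/30) (3/8) ltac:(rewrite b1_4; lra) ltac:(rewrite b1_5; lra) n n4.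
Qed.

(** The integral over [0, 1] of x^(j+l) (1-x) is 1 / ((j+l+1)(j+l+2)); so [v_ j] is the integral
of x^j exp(-x), as (1-x) times the generating function of b_1 is exp(-x). *)
Definition vterm (j l : nat) : R := b_ 1 l / ((j + l).+1%:R * (j + l).+2%:R).
Definition v_ j : R := limn (fun L => \sum_(l < L) vterm j l).

Lemma telescope2 j L : \sum_(l < L) ((j + l).+1%:R * (j + l).+2%:R)^-1 =
  j.+1%:R^-1 - (j + L).+1%:R^-1 :> R.
Proof.
elim: L => [|L IH]; first by rewrite big_ord0 addn0 subrr.
rewrite big_ord_recr /= IH addnS; set m := (j + L)%N.
have e : m.+2%:R = m.+1%:R + 1 :> R by rewrite natr1.
have m1 : m.+1%:R != 0 :> R by rewrite pnatr_eq0.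
have m2 : m.+1%:R + 1 != 0 :> R by rewrite natr1 pnatr_eq0.
by rewrite e; field; rewrite !nat1r ?natr1 !pnatr_eq0.
Qed.

Lemma cvg_invS j : (fun L => (j + L).+1%:R^-1) @ \oo --> (0 : R).
Proof.
rewrite (_ : (fun L => _) = [sequence (@harmonic R (n + j)%N)]_n); last first.
  by apply/funext => L /=; rewrite addnC.
by rewrite (cvg_shiftn j); exact: cvg_harmonic.
Qed.

Lemma vterm_ge0 j l : 0 <= vterm j l.
Proof. by rewrite divr_ge0// ?pr_ge0// mulr_ge0. Qed.

Lemma vterm_ubs j : ubs (vterm j) (j.+1%:R^-1).
Proof.
move=> L; apply: (@le_trans _ _ (\sum_(l < L) ((j + l).+1%:R * (j + l).+2%:R)^-1)).
  apply: ler_sum => l _; rewrite /vterm ler_piMl ?invr_ge0 ?mulr_ge0//.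
  exact: pr_le1.
by rewrite telescope2 lerBlDr lerDl invr_ge0.
Qed.

Lemma v_cvg j : (fun L => \sum_(l < L) vterm j l) @ \oo --> v_ j.
Proof. by apply: (ubs_cvg (vterm_ge0 j)); exact: vterm_ubs. Qed.

Lemma v_le j : v_ j <= j.+1%:R^-1.
Proof.
apply/lim_ubs; [exact: vterm_ge0| |exact: vterm_ubs].
by apply/cvg_ex; eexists; exact: v_cvg.
Qed.

Lemma v_ge0 j : 0 <= v_ j.
Proof.
apply: limr_ge; first by apply/cvg_ex; eexists; exact: v_cvg.
by apply: nearW => L; apply: sumr_ge0 => l _; exact: vterm_ge0.
Qed.

Lemma natS n : n.+1%:R = n%:R + 1 :> R. Proof. by rewrite natr1. Qed.

(** Integration by parts for the truncated series; the right-hand side tends to 1/e. *)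
Lemma vrec_fin j L : j.+1%:R * (\sum_(l < L.+1) vterm j l) - \sum_(l < L) vterm j.+1 l =
  L.+2%:R * b_ 1 L.+2 / (j + L).+2%:R.
Proof.
elim: L => [|L IH].
  rewrite big_ord1 big_ord0 /vterm b10 addn0 b1_2 subr0 !natS.
  have p1 : j%:R + 1 != 0 :> R by rewrite natr1 pnatr_eq0.
  have p2 : j%:R + 1 + 1 != 0 :> R by rewrite !natr1 pnatr_eq0.
  by field; rewrite ?p1 ?p2.
rewrite big_ord_recr mulrDr [X in _ - X]big_ord_recr opprD addrACA IH /=.
rewrite /vterm b1S (b1S L.+1) !addSn !addnS !natS natrD.
set x := b_ 1 L; set y := b_ 1 L.+1; have := b1S L; rewrite -/x -/y !natS.
set z := b_ 1 L.+2 => E.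
have jL : 0 <= j%:R + L%:R :> R by rewrite addr_ge0.
have p2 : j%:R + L%:R + 1 + 1 != 0 :> R by rewrite lt0r_neq0// ?addr_gt0// ltr_wpDl.
have p3 : j%:R + L%:R + 1 + 1 + 1 != 0 :> R by rewrite lt0r_neq0// ?addr_gt0// ltr_wpDl.
rewrite E; field.
by rewrite p2 p3.
Qed.

Lemma v_rec j : j.+1%:R * v_ j = inve + v_ j.+1.
Proof.
have H : (fun L => j.+1%:R * (\sum_(l < L.+1) vterm j l) - \sum_(l < L) vterm j.+1 l) @ \oo
    --> j.+1%:R * v_ j - v_ j.+1.
  apply: cvgB; last exact: v_cvg.
  apply: cvgMr; have := @v_cvg j; rewrite -(cvg_shiftS (fun L => \sum_(l < L) vterm j l)).
  exact.
have H' : (fun L => b_ 1 L.+2 * (1 - j%:R * (j.+1 + L).+1%:R^-1)) @ \oo --> inve * (1 - j%:R * 0).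
  apply: cvgM; first by have := b1_cvg; rewrite -cvg_shiftS -(cvg_shiftS [sequence _]_n).
  apply: cvgB; first exact: cvg_cst.
  by apply: cvgMr; exact: cvg_invS.
rewrite mulr0 subr0 mulr1 in H'.
have E : (fun L => j.+1%:R * (\sum_(l < L.+1) vterm j l) - \sum_(l < L) vterm j.+1 l) =
  (fun L => b_ 1 L.+2 * (1 - j%:R * (j.+1 + L).+1%:R^-1)).
  apply/funext => L; rewrite vrec_fin addSn [L.+2%:R * _]mulrC -mulrA; congr (_ * _).
  have p : (j + L).+2%:R != 0 :> R by rewrite pnatr_eq0.
  apply: (mulIf p); rewrite divfK// mulrBl mul1r divfK// -natrB; last lia.
  congr _%:R; lia.
rewrite E in H.
have := cvg_lim (@norm_hausdorff _ _) H; rewrite (cvg_lim (@norm_hausdorff _ _) H') => ->.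
by rewrite subrK.
Qed.

Lemma v0E : v_ 0 = 1 - inve.
Proof.
have E : (fun L => \sum_(l < L.+1) vterm 0 l) =
   (fun L => 1 - b_ 1 L.+1 - b_ 1 L * (1 + L).+1%:R^-1).
  apply/funext; elim=> [|L IH].
    rewrite big_ord1 /vterm /= addn0 b10 b11 addn0.
    by lra.
  rewrite big_ord_recr /= IH /vterm add0n !add1n !natS.
  have := b1S L; rewrite !natS.
  set x := b_ 1 L; set y := b_ 1 L.+1; set z := b_ 1 L.+2.
  have L0 : 0 <= L%:R :> R by [].
  have p2 : L%:R + 1 + 1 != 0 :> R by rewrite lt0r_neq0// ?addr_gt0// ltr_wpDl.
  have p3 : L%:R + 1 + 1 + 1 != 0 :> R by rewrite lt0r_neq0// ?addr_gt0// ltr_wpDl.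
  move=> E; have -> : z = ((L%:R + 1) * y + x) / (L%:R + 1 + 1) by rewrite -E mulrC mulKf.
  by field; rewrite p2 p3.
have H : (fun L => \sum_(l < L.+1) vterm 0 l) @ \oo --> v_ 0.
  by have := @v_cvg 0; rewrite -(cvg_shiftS (fun L => \sum_(l < L) vterm 0 l)).
have H' : (fun L => 1 - b_ 1 L.+1 - b_ 1 L * (1 + L).+1%:R^-1) @ \oo --> 1 - inve - inve * 0.
  apply: cvgB; first apply: cvgB; first exact: cvg_cst.
    by have := b1_cvg; rewrite -cvg_shiftS.
  by apply: cvgM; [exact: b1_cvg|exact: cvg_invS].
rewrite mulr0 subr0 -E in H'.
by rewrite -(cvg_lim (@norm_hausdorff _ _) H) (cvg_lim (@norm_hausdorff _ _) H').
Qed.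

Lemma v_ge j : inve / j.+1%:R <= v_ j.
Proof. by rewrite ler_pdivrMr ?ltr0n// mulrC v_rec lerDl v_ge0. Qed.

(** The limiting fraction of nodes whose fringe tree has size n+1. *)
Definition g0 n : R := (n.+1%:R * n.+2%:R)^-1.
(** The weight obtained from [g0] after moving the convolutions with b_0 and b_1 to its side. *)
Definition g2 n : R := v_ n.+1 / n.+1%:R.

Lemma g0_ge0 n : 0 <= g0 n. Proof. by rewrite invr_ge0 mulr_ge0. Qed.
Lemma g2_ge0 n : 0 <= g2 n. Proof. by rewrite divr_ge0// v_ge0. Qed.

Lemma g2_le n : g2 n <= g0 n.
Proof. by rewrite /g2 /g0 invfM mulrC ler_wpM2l ?invr_ge0// v_le. Qed.

Lemma g2_ge n : inve * g0 n <= g2 n.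
Proof. by rewrite /g2 /g0 invfM mulrCA [leRHS]mulrC ler_wpM2l ?invr_ge0// v_ge. Qed.

(** By [v_rec] the moment v_{n+1} is (1/e + v_{n+2}) / (n+2), and 1/e <= 3/8. *)
Lemma g2_le2 n M : (M <= n)%N -> g2 n <= (3 / 8 + M.+1%:R^-1) * g0 n.
Proof.
move=> Mn; rewrite /g2 /g0 invfM [leRHS]mulrCA [leLHS]mulrC ler_wpM2l ?invr_ge0//.
rewrite ler_pdivlMr ?ltr0n// mulrC v_rec lerD//.
  by have /andP[] := inve_bounds.
apply: (le_trans (v_le _)); rewrite lef_pV2 ?posrE ?ltr0n// ler_nat; lia.
Qed.

(** The weight after moving the convolution with b_2 as well. *)
Definition omega_term j l : R := b_ 2 l * g2 (j + l).+1.
Definition omega j : R := limn (fun L => \sum_(l < L) omega_term j l).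

Lemma omega_term_ge0 j l : 0 <= omega_term j l.
Proof. by rewrite mulr_ge0 ?g2_ge0// pr_ge0. Qed.

Lemma omega_ubs j : ubs (omega_term j) (j.+2%:R^-1).
Proof.
move=> L; apply: (@le_trans _ _ (\sum_(l < L) ((j.+1 + l).+1%:R * (j.+1 + l).+2%:R)^-1)).
  apply: ler_sum => l _; rewrite -[X in _ <= X]mul1r ler_pM ?g2_ge0 ?pr_ge0 ?pr_le1//.
  by rewrite addSn; exact: g2_le.
by rewrite telescope2 lerBlDr lerDl invr_ge0.
Qed.

Lemma omega_cvg j : (fun L => \sum_(l < L) omega_term j l) @ \oo --> omega j.
Proof. by apply: (ubs_cvg (omega_term_ge0 j)); exact: omega_ubs. Qed.

Lemma omega_le j y : ubs (omega_term j) y -> omega j <= y.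
Proof.
move=> H; apply/lim_ubs => //; first exact: omega_term_ge0.
by apply/cvg_ex; eexists; exact: omega_cvg.
Qed.

Lemma omega_ge0 j : 0 <= omega j.
Proof.
apply: limr_ge; first by apply/cvg_ex; eexists; exact: omega_cvg.
by apply: nearW => L; apply: sumr_ge0 => l _; exact: omega_term_ge0.
Qed.

End Bounds.

(** * The limits as series with explicit weights *)

Section LimitSeries.
Variable R : realType.
Implicit Types (u w f g G b phi F : nat -> R) (x y : R).
Notation a_ m := (pr R (prot m)).
Notation b_ m := (pr R (allkids (prot m))).
Notation c_ m := (pr R (height_le m)).
Notation v_ := (@v_ R). Notation omega := (@omega R). Notation g0 := (@g0 R). Notation g2 := (@g2 R).
Notation inve := (@inve R).

Lemma eq_ubs f g y : (forall n, f n = g n) -> ubs f y <-> ubs g y.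
Proof. by move=> /funext ->. Qed.

Lemma psum_lim (f : rtree -> nat) y : (forall T, fsum f T <= nodes T)%N ->
  limn (psum (fun j => Es j (fun T => (f T)%:R))) <= y <->
  ubs (fun n => Es n (fun T => (f T)%:R) * g0 n) y.
Proof.
move=> fn; apply: lim_ubs; last exact: psum_cvg.
by move=> n; rewrite mulr_ge0 ?g0_ge0//; apply: Es_ge0.
Qed.

Lemma rtail_ubs k y : rtail R k.+1 <= y <-> ubs (fun n => echain R k 1 n * g0 n) y.
Proof.
apply: psum_lim => T.
by rewrite -deep_rank_countE -size_spines; exact: count_size.
Qed.

Lemma lhead_ubs k y : lhead R k <= y <-> ubs (fun n => c_ k n * g0 n) y.
Proof.
apply: (@psum_lim (fun T => height_le k T : nat)) => T.
by rewrite -height_countE -size_spines; exact: count_size.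
Qed.

(** One more convolution, that with b_r, is moved from the chain count to the weight. *)
Lemma echain_adjoint i r g G y : (forall n, 0 <= g n) ->
  (forall j, (fun L => \sum_(l < L) b_ r l * g (j + l).+1) @ \oo --> G j) ->
  ubs (fun n => echain R i.+1 r.+1 n * g n) y <->
  ubs (fun j => echain R i r.+2 j / j.+1%:R * G j) y.
Proof.
move=> g0 cG; apply: (@ubs_adjoint _ _ (b_ r)) => // n; first by rewrite divr_ge0 ?echain_ge0.
- exact: pr_ge0.
- exact: echainS.
Qed.

Lemma rtail2_ubs i y : rtail R i.+2 <= y <-> ubs (fun n => echain R i 2 n * g0 n) y.
Proof.
apply: (iff_trans (rtail_ubs _ _)).
apply: (iff_trans (@echain_adjoint i 0 g0 (fun j => j.+2%:R^-1) y (@g0_ge0 R) _)).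
  move=> j; rewrite (_ : (fun L => _) = (fun L => j.+2%:R^-1 - (j.+1 + L).+1%:R^-1)).
    by rewrite -[X in _ --> X]subr0; apply: cvgB; [exact: cvg_cst|exact: cvg_invS].
  by apply/funext => L; rewrite -telescope2; apply: eq_bigr => l _; rewrite b0E mul1r.
by apply: eq_ubs => n; rewrite /g0 invfM mulrA.
Qed.

Lemma rtail3_ubs i y : rtail R i.+3 <= y <-> ubs (fun n => echain R i 3 n * g2 n) y.
Proof.
apply: (iff_trans (rtail2_ubs _ _)).
apply: (iff_trans (@echain_adjoint i 1 g0 (fun j => v_ j.+1) y (@g0_ge0 R) _)).
  exact: (fun j => @v_cvg R j.+1).
by apply: eq_ubs => n; rewrite /g2 mulrAC mulrA.
Qed.

Lemma rtail4_ubs i y : rtail R i.+4 <= y <-> ubs (fun j => echain R i 4 j / j.+1%:R * omega j) y.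
Proof.
apply: (iff_trans (rtail3_ubs _ _)).
apply: (@echain_adjoint i 2 g2 omega y (@g2_ge0 R)).
exact: (@omega_cvg R).
Qed.

(** Exact values: a number characterised by [ubs] is the limit of the partial sums. *)
Lemma ubs_closed f x l (s : nat -> R) : (forall y, x <= y <-> ubs f y) -> (forall n, 0 <= f n) ->
  (forall n, \sum_(j < n.+1) f j = s n) -> s @ \oo --> l -> x = l.
Proof.
move=> fx f0 fs sl.
have E : (fun n => \sum_(j < n) f j) @ \oo --> l.
  by rewrite -cvg_shiftS (_ : [sequence _]_n = s)//; apply/funext => n; exact: fs.
have H y : x <= y <-> l <= y.
  apply: (iff_trans (fx y)); rewrite -(cvg_lim (@norm_hausdorff _ _) E).
  by apply: iff_sym; apply: lim_ubs => //; apply/cvg_ex; eexists; exact: E.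
by apply/eqP; rewrite eq_le; apply/andP; split; apply/H.
Qed.

Lemma sum_a g m n : \sum_(j < n.+1) a_ m.+1 j * g j =
  \sum_(j < n.+1) b_ m j * g j - g 0%N.
Proof.
under eq_bigr do rewrite pr_protS mulrBl.
rewrite sumrB; congr (_ - _); rewrite big_ord_recl mul1r big1 ?addr0// => j _.
by rewrite mul0r.
Qed.

Lemma rtail1 : rtail R 1 = 1 / 2.
Proof.
apply: (@ubs_closed (fun n => a_ 1 n * g0 n) _ _ (fun n => 1 / 2 - (1 + n).+1%:R^-1)).
- by move=> y; apply: (iff_trans (rtail_ubs _ _)); apply: eq_ubs => n; rewrite echain0.
- by move=> n; rewrite mulr_ge0 ?pr_ge0 ?g0_ge0.
- move=> n; rewrite sum_a (eq_bigr (fun j : 'I_n.+1 => ((0 + j).+1%:R * (0 + j).+2%:R)^-1)).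
    rewrite telescope2 /g0 add0n add1n invr1 mul1r.
    by set z := (n.+2%:R)^-1; lra.
  by move=> j _; rewrite b0E mul1r.
- by rewrite -[X in _ --> X]subr0; apply: cvgB; [exact: cvg_cst|exact: cvg_invS].
Qed.

Lemma rtail2 : rtail R 2 = 1 / 2 - inve.
Proof.
apply: (@ubs_closed (fun n => a_ 2 n * g0 n) _ _
  (fun n => \sum_(j < n.+1) vterm R 0 j - 1 / 2)).
- by move=> y; apply: (iff_trans (rtail2_ubs _ _)); apply: eq_ubs => n; rewrite echain0.
- by move=> n; rewrite mulr_ge0 ?pr_ge0 ?g0_ge0.
- by move=> n; rewrite sum_a /g0; congr (_ - _); rewrite !mul1r.
- have -> : 1 / 2 - inve = v_ 0 - 1 / 2 by rewrite v0E; lra.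
  apply: cvgB; last exact: cvg_cst.
  by have := @v_cvg R 0; rewrite -(cvg_shiftS (fun L => \sum_(l < L) vterm R 0 l)).
Qed.

Lemma c0E n : c_ 0 n = (n == 0%N)%:R. Proof. exact: Es_single. Qed.

Lemma c_sol k : is_sol (c_ k) (c_ k.+1). Proof. exact: pr_allkids. Qed.

Lemma c_noninc k n : c_ k n.+1 <= c_ k n.
Proof.
elim: k n => [|k IH] n; first by rewrite !c0E ler_nat; case: n.
by apply: (sol_noninc (c_sol k)); rewrite ?pr_ge0 ?pr_le1//; exact: pr_ge0.
Qed.

Lemma c1E n : c_ 1 n = n`!%:R^-1.
Proof.
have [w0 wS] := c_sol 0; elim: n => [|n IH]; first by rewrite w0 fact0 invr1.
apply: (@mulfI _ (n.+1%:R)); first by rewrite pnatr_eq0.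
rewrite wS /cv big_ord_recl c0E mul1r subn0 big1 ?addr0; last by move=> j _; rewrite c0E mul0r.
by rewrite IH factS natrM invfM mulVKf// pnatr_eq0.
Qed.

Lemma lhead0 : lhead R 0 = 1 / 2.
Proof.
apply: (@ubs_closed (fun n => c_ 0 n * g0 n) _ _ (fun=> 1 / 2)).
- exact: lhead_ubs.
- by move=> n; rewrite mulr_ge0 ?pr_ge0 ?g0_ge0.
- move=> n; rewrite big_ord_recl big1 ?addr0; last by move=> j _; rewrite c0E mul0r.
  by rewrite c0E /g0 !mul1r.
- exact: cvg_cst.
Qed.

Lemma lhead1 : lhead R 1 = expR 1 - 2.
Proof.
apply: (@ubs_closed (fun n => c_ 1 n * g0 n) _ _ (fun n => series (exp_coeff 1) n.+3 - 2)).
- exact: lhead_ubs.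
- by move=> n; rewrite mulr_ge0 ?pr_ge0 ?g0_ge0.
- have eE k : exp_coeff (1 : R) k = k`!%:R^-1 by rewrite /exp_coeff /= expr1n mul1r.
  have sE k : series (exp_coeff (1 : R)) k.+1 = series (exp_coeff 1) k + k`!%:R^-1.
    by rewrite seriesSr eE.
  elim=> [|n IH]; first rewrite big_ord1 /= c1E !sE /g0 /series /= big_mkord big_ord0.
    by rewrite !factS fact0; lra.
  rewrite big_ord_recr /= IH (sE n.+3) [RHS]addrAC; congr (_ + _).
  by rewrite c1E /g0 -invfM; congr (_^-1); rewrite -!natrM; congr _%:R; rewrite !factS; lia.
- apply: cvgB; last exact: cvg_cst.
  have := @is_cvg_series_exp_coeff R 1.
  by rewrite -(cvg_shiftn 3) => H; under eq_fun do rewrite -addn3; exact: H.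
Qed.

End LimitSeries.

(** * Tail estimates *)

Section Tails.
Variable R : realType.
Implicit Types (u w f g G b phi F : nat -> R) (x y : R).
Notation b_ m := (pr R (allkids (prot m))).
Notation v_ := (@v_ R). Notation omega := (@omega R). Notation g0 := (@g0 R). Notation g2 := (@g2 R).
Notation inve := (@inve R).

Lemma sum_split f N n : (N <= n)%N ->
  \sum_(j < n) f j = \sum_(j < N) f j + \sum_(N <= j < n) f j.
Proof. by move=> Nn; rewrite -!(big_mkord xpredT f) (big_cat_nat _ Nn). Qed.

(** Here a_2 <= 1/2, and a_2 >= 11/30 from index 4 on, are inserted in the recursion of b_2. *)
Lemma b2_up n : n.+1%:R * b_ 2 n.+1 <= 1 / 2 * \sum_(i < n.+1) b_ 2 i.
Proof.
have [_ ->] := b_sol R 2; rewrite cvC /cv mulr_sumr; apply: ler_sum => j _.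
by rewrite mulrC ler_wpM2r ?pr_ge0// a2_le.
Qed.

Lemma b2_lo n : (4 <= n)%N -> 11 / 30 * \sum_(i < n - 3) b_ 2 i <= n.+1%:R * b_ 2 n.+1.
Proof.
move=> n4; have [_ ->] := b_sol R 2; rewrite cvC /cv mulr_sumr.
have le : (n - 3 <= n.+1)%N by lia.
rewrite (big_ord_widen _ (fun j => 11 / 30 * b_ 2 j) le) big_mkcond /=.
apply: ler_sum => j _; rewrite [leRHS]mulrC; case: ltnP => jn; last by rewrite mulr_ge0 ?pr_ge0.
by rewrite ler_wpM2r ?pr_ge0// a2_ge//; lia.
Qed.

Lemma Xtail_step (c b S : R) : 0 < c -> c * b <= 1 / 2 * S ->
  b / (c + 1) + (S + b) / (c + 1) <= S / c.
Proof.
move=> c0 H; have p2 : 0 < c + 1 by rewrite addr_gt0.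
have key : (b + (S + b)) * c <= S * (c + 1) by nra.
by rewrite -mulrDl ler_pdivrMr// mulrAC ler_pdivlMr.
Qed.

Lemma Ytail_step (c b S : R) : 0 < c -> c * b <= 1 / 2 * S ->
  b / ((c + 1) * (c + 1 + 1)) + (S + b) / (3 * (c + 1) * (c + 1 + 1)) <= S / (3 * c * (c + 1)).
Proof.
move=> p1 H.
have p2 : 0 < c + 1 by rewrite addr_gt0.
have p3 : 0 < c + 1 + 1 by rewrite addr_gt0.
have key : 0 <= 2 * S - 4 * (c * b) by lra.
rewrite -subr_ge0.
have -> : S / (3 * c * (c + 1)) - (b / ((c + 1) * (c + 1 + 1)) + (S + b) / (3 * (c + 1) * (c + 1 + 1)))
  = (2 * S - 4 * (c * b)) / (3 * c * (c + 1) * (c + 1 + 1)).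
  by field; rewrite !lt0r_neq0.
by rewrite divr_ge0 ?mulr_ge0// ?ltW.
Qed.

(** With S_n the sum of the first n terms, S_n / n is a potential: by [b2_up] it decreases at each
step by at least the new term of the series. *)
Lemma b2_Xtail N n : (0 < N)%N -> (N <= n)%N ->
  \sum_(N <= j < n) b_ 2 j / j.+1%:R <= (\sum_(j < N) b_ 2 j) / N%:R.
Proof.
case: N => // N _.
suff H k : \sum_(N.+1 <= j < N.+1 + k) b_ 2 j / j.+1%:R
   + (\sum_(j < N.+1 + k) b_ 2 j) / (N.+1 + k)%:R <= (\sum_(j < N.+1) b_ 2 j) / N.+1%:R.
  move=> Nn; have := H (n - N.+1)%N; rewrite subnKC//; apply: le_trans.
  by rewrite lerDl divr_ge0// sumr_ge0// => j _; exact: pr_ge0.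
elim: k => [|k IH]; first by rewrite addn0 big_geq// add0r.
rewrite addnS big_nat_recr ?leq_addr//=; apply: le_trans IH.
rewrite -addrA lerD2l; set m := (N + k)%N; rewrite !addSn -/m.
rewrite [X in _ + X / _](big_ord_recr (N + k).+1) /= -/m.
rewrite (natS _ m.+1); apply: Xtail_step (b2_up m); exact: ltr0Sn.
Qed.

(** The same argument with the potential S_n / (3 n (n+1)). *)
Lemma b2_Ytail M n : (0 < M)%N -> (M <= n)%N ->
  \sum_(M <= j < n) b_ 2 j * g0 j <= (\sum_(j < M) b_ 2 j) / (3 * M%:R * M.+1%:R).
Proof.
case: M => // M _.
suff H k : \sum_(M.+1 <= j < M.+1 + k) b_ 2 j * g0 j
   + (\sum_(j < M.+1 + k) b_ 2 j) / (3 * (M.+1 + k)%:R * (M.+1 + k).+1%:R)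
   <= (\sum_(j < M.+1) b_ 2 j) / (3 * M.+1%:R * M.+2%:R).
  move=> Mn; have := H (n - M.+1)%N; rewrite subnKC//; apply: le_trans.
  by rewrite lerDl divr_ge0 ?mulr_ge0// sumr_ge0// => j _; exact: pr_ge0.
elim: k => [|k IH]; first by rewrite addn0 big_geq// add0r.
rewrite addnS big_nat_recr ?leq_addr//=; apply: le_trans IH.
rewrite -addrA lerD2l; set m := (M + k)%N; rewrite !addSn -/m.
rewrite [X in _ + X / _](big_ord_recr (M + k).+1) /= -/m /g0.
rewrite (natS _ m.+2) (natS _ m.+1); apply: Ytail_step (b2_up m); exact: ltr0Sn.
Qed.

(** The tail is bounded below because l b_2(l) is at least [C] by [b2_lo] and because g_2 is at
least g_0 / e; the resulting sum telescopes. *)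
Lemma omega_lower j M C : (5 <= M)%N -> 0 <= C -> C <= 11 / 30 * \sum_(i < M - 4) b_ 2 i ->
  \sum_(l < M) b_ 2 l * g2 (j + l).+1 + C * inve / (2 * (j + M).+1%:R * (j + M).+2%:R) <= omega j.
Proof.
move=> M5 C0 CM; pose D := C * inve / 2.
have e0 : 0 <= inve by have /andP[] := inve_bounds R; lra.
pose t n : R := (n.+1%:R * n.+2%:R)^-1.
have H k : \sum_(l < M) b_ 2 l * g2 (j + l).+1 + D * (t (j + M)%N - t (j + (M + k))%N) <=
   \sum_(l < M + k) b_ 2 l * g2 (j + l).+1.
  elim: k => [|k IH]; first by rewrite addn0 subrr mulr0 addr0.
  rewrite addnS big_ord_recr /=.
  have -> : D * (t (j + M)%N - t (j + (M + k).+1)%N) = D * (t (j + M)%N - t (j + (M + k))%N)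
      + D * (t (j + (M + k))%N - t (j + (M + k).+1)%N) by ring.
  rewrite addrA lerD//; set l := (M + k)%N.
  have lb : C <= l%:R * b_ 2 l.
    have -> : l = (l.-1).+1 by rewrite prednK// /l; lia.
    apply: (le_trans CM); apply: le_trans (b2_lo _); last by rewrite /l; lia.
    rewrite ler_wpM2l//; apply: sum_nneg_le; [exact: pr_ge0|rewrite /l; lia].
  have gb := g2_ge R (j + l).+1.
  apply: (@le_trans _ _ (b_ 2 l * (inve * g0 (j + l).+1))); last by rewrite ler_wpM2l// pr_ge0.
  rewrite /D /t /g0 addnS; set m := (j + l)%N.
  have lm : l%:R <= m.+1%:R :> R by rewrite ler_nat /m; lia.
  have p1 : 0 < m.+1%:R :> R by rewrite ltr0n.
  rewrite !(natS _ m.+2) !(natS _ m.+1); set c := m.+1%:R in p1 lm *.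
  have p2 : 0 < c + 1 by rewrite addr_gt0.
  have p3 : 0 < c + 1 + 1 by rewrite addr_gt0.
  have -> : C * inve / 2 * ((c * (c + 1))^-1 - ((c + 1) * (c + 1 + 1))^-1) =
    inve / ((c + 1) * (c + 1 + 1)) * (C / c) by field; rewrite !lt0r_neq0.
  rewrite [leRHS]mulrC ler_wpM2l ?divr_ge0 ?e0 ?mulr_ge0 ?(ltW p2) ?(ltW p3)//.
  rewrite ler_pdivrMr// mulrC; apply: (le_trans lb); rewrite ler_wpM2r ?pr_ge0//.
have t0 : (fun k => t (j + (M + k))%N) @ \oo --> (0 : R).
  apply: (@squeeze_cvgr _ _ _ _ (cst 0) (fun k => (j + M + k).+1%:R^-1)).
  - apply: nearW => k; rewrite /t invr_ge0 mulr_ge0//= addnA invfM ler_piMr ?invr_ge0//.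
    by rewrite invf_le1 ?ltr0n// ler1n.
  - exact: cvg_cst.
  - exact: cvg_invS.
pose K := \sum_(l < M) b_ 2 l * g2 (j + l).+1.
have c1 : (fun k => K + D * (t (j + M)%N - t (j + (M + k))%N)) @ \oo --> K + D * (t (j + M)%N - 0).
  apply: cvgD; first exact: cvg_cst.
  by apply: cvgMr; apply: cvgB => //; exact: cvg_cst.
rewrite subr0 in c1.
have -> : C * inve / (2 * (j + M).+1%:R * (j + M).+2%:R) = D * t (j + M)%N.
  by rewrite /D /t -[2 * _ * _]mulrA invfM mulrA.
rewrite -/K -(cvg_lim (@norm_hausdorff _ _) c1); apply: limr_le.
  by apply/cvg_ex; eexists; exact: c1.
apply: nearW => k; apply: (le_trans (H k)).
have cf : cvgn (fun L => \sum_(l < L) omega_term R j l) by apply/cvg_ex; eexists; exact: omega_cvg.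
exact: (proj1 (lim_ubs (omega j) (omega_term_ge0 R j) cf) (lexx _)).
Qed.

Lemma b2_g2_tail j M n : (0 < M)%N -> (M <= n)%N ->
  \sum_(M <= l < n) b_ 2 l * g2 (j + l)%N <=
  (3 / 8 + M.+1%:R^-1) * ((\sum_(l < M) b_ 2 l) / (3 * M%:R * M.+1%:R)).
Proof.
move=> M0 Mn.
have c0 : 0 <= 3 / 8 + M.+1%:R^-1 :> R by rewrite addr_ge0 ?invr_ge0.
apply: (@le_trans _ _ (\sum_(M <= l < n) (3 / 8 + M.+1%:R^-1) * (b_ 2 l * g0 l))).
  apply: ler_sum_nat => l /andP[Ml _]; rewrite [leRHS]mulrCA ler_wpM2l ?pr_ge0//.
  apply: (le_trans (@g2_le2 R (j + l) M _)); first by lia.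
  rewrite ler_wpM2l// /g0 lef_pV2 ?posrE ?mulr_gt0 ?ltr0n//.
  by rewrite ler_pM// ler_nat; lia.
by rewrite -mulr_sumr ler_wpM2l// b2_Ytail.
Qed.

Lemma omega_upper j M : (0 < M)%N ->
  omega j <= \sum_(l < M) b_ 2 l * g2 (j + l).+1 +
  (3 / 8 + M.+1%:R^-1) * ((\sum_(l < M) b_ 2 l) / (3 * M%:R * M.+1%:R)).
Proof.
move=> M0; apply: omega_le => L.
apply: (@le_trans _ _ (\sum_(l < M + L) omega_term R j l)).
  by apply: sum_nneg_le; [exact: omega_term_ge0|exact: leq_addl].
rewrite (@sum_split (omega_term R j) M) ?leq_addr// lerD2l.
have := @b2_g2_tail j.+1 M (M + L) M0 (leq_addr _ _).
by rewrite /omega_term; under eq_bigr do rewrite addSn.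
Qed.

Lemma v_noninc j : v_ j.+1 <= v_ j.
Proof.
apply/lim_ubs; [exact: vterm_ge0|by apply/cvg_ex; eexists; exact: v_cvg|move=> L].
apply: (@le_trans _ _ (\sum_(l < L) vterm R j l)).
  apply: ler_sum => l _; rewrite /vterm ler_wpM2l ?pr_ge0// lef_pV2 ?posrE ?mulr_gt0 ?ltr0n//.
  by rewrite ler_pM// ler_nat addSn.
have cf : cvgn (fun L => \sum_(l < L) vterm R j l) by apply/cvg_ex; eexists; exact: v_cvg.
exact: (proj1 (lim_ubs (v_ j) (vterm_ge0 R j) cf) (lexx _)).
Qed.

Lemma g2_noninc n : g2 n.+1 <= g2 n.
Proof.
rewrite /g2 ler_pM ?v_ge0 ?invr_ge0 ?v_noninc//.
by rewrite lef_pV2 ?posrE ?ltr0n// ler_nat.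
Qed.

Lemma omega_noninc j j' : (j <= j')%N -> omega j' <= omega j.
Proof.
move=> /subnKC <-; elim: (j' - j)%N => [|k IH]; first by rewrite addn0.
apply: le_trans IH; rewrite addnS; set i := (j + k)%N; apply: omega_le => L.
apply: (@le_trans _ _ (\sum_(l < L) omega_term R i l)).
  by apply: ler_sum => l _; rewrite /omega_term ler_wpM2l ?pr_ge0// addSn g2_noninc.
have cf : cvgn (fun L => \sum_(l < L) omega_term R i l) by apply/cvg_ex; eexists; exact: omega_cvg.
exact: (proj1 (lim_ubs (omega i) (omega_term_ge0 R i) cf) (lexx _)).
Qed.

(** Exchange of the two sums, with the weight 1 in [cv_triangle]. *)
Lemma mass_conv phi b F Phi B : (forall n, 0 <= phi n) -> (forall n, 0 <= b n) ->
  0 <= Phi -> F 0%N = 0 -> (forall n, F n.+1 = cv phi b n) ->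
  ubs phi Phi -> ubs b B -> ubs F (Phi * B).
Proof.
move=> p0 b0 P0 F0 FS uphi ub n.
have B0 : 0 <= B by have := ub 0%N; rewrite big_ord0.
case: n => [|n]; first by rewrite big_ord0 mulr_ge0.
rewrite big_ord_recl F0 add0r.
have -> : \sum_(i < n) F (lift ord0 i) = \sum_(m < n) cv phi b m * 1.
  by apply: eq_bigr => i _; rewrite mulr1 FS.
rewrite (@cv_triangle R phi b (fun=> 1)).
apply: (@le_trans _ _ (\sum_(j < n) phi j * B)).
  by apply: ler_sum => j _; rewrite ler_wpM2l//; under eq_bigr do rewrite mulr1; exact: ub.
by rewrite -mulr_suml ler_wpM2r.
Qed.

(** Summing w_m = (w * u)_{m-1} / m over m >= N and exchanging the sums, the pairs with w-index at
least N contribute at most (U/(N+1) + X) times the tail of w itself, because the u-index j comes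
with a factor at most 1/(N+1) if j < N and 1/(j+1) otherwise.  Those with w-index below N and
u-index at least N contribute at most W X.  The pairs with both indices below N and sum at least
N-1 have total mass U W - V, as those with smaller sum make up the known quantities m w_m for m <
N, and they carry a factor at most 1/N.  The linear inequality obtained for the tail can be solved
when its factor is less than 1. *)
Lemma mass_sol u w N (U W V X tau : R) : is_sol u w -> (forall n, 0 <= u n) -> (0 < N)%N ->
  (forall n, (N <= n)%N -> \sum_(N <= j < n) u j / j.+1%:R <= X) ->
  \sum_(j < N) u j <= U -> \sum_(j < N) w j <= W -> V <= \sum_(j < N) j%:R * w j ->
  0 <= tau -> U / N.+1%:R + X <= 1 ->
  (U * W - V) / N%:R + W * X <= tau * (1 - (U / N.+1%:R + X)) ->
  forall n, (N <= n)%N -> \sum_(N <= j < n) w j <= tau.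
Proof.
move=> sw u0 N0 HX HU HW HV tau0 k1 Htau.
have w0 := sol_ge0 sw u0; have [w00 wS] := sw.
have X0 : 0 <= X by have := HX N (leqnn _); rewrite big_geq.
have W0 : 0 <= W by apply: le_trans HW; rewrite sumr_ge0.
have U0 : 0 <= U by apply: le_trans HU; rewrite sumr_ge0.
set kap := U / N.+1%:R + X.
pose T n := \sum_(N <= j < n) w j.
suff H n : (N <= n)%N -> T n.+1 <= (U * W - V) / N%:R + W * X + kap * T n.
  move=> n Nn; rewrite -(subnKC Nn); elim: (n - N)%N => [|k IH]; first by rewrite addn0 big_geq.
  rewrite addnS; apply: (le_trans (H _ (leq_addr _ _))).
  apply: (@le_trans _ _ (tau * (1 - kap) + kap * tau)); last by rewrite mulrBr mulr1 [kap * _]mulrC subrK.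
  by rewrite lerD// ler_wpM2l// /kap addr_ge0// divr_ge0.
(* the weight g makes the tail of w a full sum, to which the exchange of sums applies *)
move=> Nn; pose g k : R := if (N <= k)%N then k%:R^-1 else 0.
have g_ge0 k : 0 <= g k by rewrite /g; case: ifP => // _; rewrite invr_ge0.
have -> : T n.+1 = \sum_(m < n) cv w u m * g m.+1.
  transitivity (\sum_(m < n.+1) w m * (N <= m)%N%:R).
    rewrite (@sum_split (fun m => w m * (N <= m)%N%:R) N) ?(leqW Nn)// big1 ?add0r; last first.
      by move=> m _; rewrite leqNgt ltn_ord mulr0.
    by apply: eq_big_nat => m /andP[-> _]; rewrite mulr1.
  rewrite big_ord_recl leqNgt N0 mulr0 add0r; apply: eq_bigr => m _.
  rewrite cvC -wS /g /= /bump add1n; case: ifP => _; rewrite ?mulr0// mulr1.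
  by rewrite mulrAC mulfV ?mul1r// pnatr_eq0.
rewrite cv_triangle (@sum_split (fun l => w l * \sum_(j < n - l) u j * g (l + j).+1) _ _ Nn) lerD//; last first.
  rewrite /T mulr_sumr; apply: ler_sum_nat => l /andP[Nl ln]; rewrite mulrC ler_wpM2r//.
  apply: (@le_trans _ _ (\sum_(j < n) u j * (if (j < N)%N then N.+1%:R^-1 else j.+1%:R^-1))).
    apply: (@le_trans _ _ (\sum_(j < n - l) u j * (if (j < N)%N then N.+1%:R^-1 else j.+1%:R^-1))).
      apply: ler_sum => j _; rewrite ler_wpM2l// /g; have -> : (N <= (l + j).+1)%N by lia.
      by case: ifP => _; rewrite lef_pV2 ?posrE ?ltr0n// ler_nat; lia.
    apply: (@sum_nneg_le _ (fun j => u j * (if (j < N)%N then N.+1%:R^-1 else j.+1%:R^-1))).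
      by move=> j; rewrite mulr_ge0//; case: ifP => _; rewrite invr_ge0.
    exact: leq_subr.
  rewrite (@sum_split (fun j => u j * (if (j < N)%N then N.+1%:R^-1 else j.+1%:R^-1)) _ _ Nn).
  rewrite /kap lerD//.
    by rewrite (eq_bigr (fun j : 'I_N => u j / N.+1%:R)) -?mulr_suml ?ler_wpM2r ?invr_ge0// => j _; rewrite ltn_ord.
  apply: le_trans (HX _ Nn); apply: ler_sum_nat => j /andP[Nj _].
  by rewrite ltnNge Nj.
pose ind k : R := (N <= k)%N%:R.
apply: (@le_trans _ _ (\sum_(l < N) w l * (\sum_(j < N) u j * (ind (l + j).+1 / N%:R) + X))).
  apply: ler_sum => l _; rewrite ler_wpM2l//.
  apply: (@le_trans _ _ (\sum_(j < n) u j * g (l + j).+1)).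
    apply: (@sum_nneg_le _ (fun j => u j * g (l + j).+1)); [|exact: leq_subr].
    by move=> j; rewrite mulr_ge0.
  rewrite (@sum_split (fun j => u j * g (l + j).+1) _ _ Nn) lerD//.
    apply: ler_sum => j _; rewrite ler_wpM2l// /g /ind; case: ifP => Nj; rewrite ?mul0r// mul1r.
    by rewrite lef_pV2 ?posrE ?ltr0n// ler_nat.
  apply: le_trans (HX _ Nn); apply: ler_sum_nat => j /andP[Nj _]; rewrite ler_wpM2l// /g.
  by case: ifP => _; rewrite ?invr_ge0// lef_pV2 ?posrE ?ltr0n// ler_nat; lia.
under eq_bigr do rewrite mulrDr.
rewrite big_split /= -mulr_suml lerD//; last by rewrite ler_wpM2r.
have -> : \sum_(l < N) w l * (\sum_(j < N) u j * (ind (l + j).+1 / N%:R)) =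
   (\sum_(l < N) w l * \sum_(j < N) u j * ind (l + j).+1) / N%:R.
  rewrite mulr_suml; apply: eq_bigr => l _; rewrite -mulrA; congr (_ * _).
  by rewrite mulr_suml; apply: eq_bigr => j _; rewrite mulrA.
rewrite ler_wpM2r ?invr_ge0//.
(* the complementary pairs l + j < N - 1 are counted by the recursion of w *)
have E : \sum_(l < N) w l * \sum_(j < N) u j * ind (l + j).+1 =
   (\sum_(l < N) w l) * (\sum_(j < N) u j) - \sum_(j < N) j%:R * w j.
  have -> : \sum_(j < N) j%:R * w j = \sum_(m < N.-1) cv w u m * 1.
    case: (N) N0 => // N' _; rewrite big_ord_recl mul0r add0r; apply: eq_bigr => m _.
    by rewrite mulr1 cvC -wS.
  rewrite (@cv_triangle R w u (fun=> 1)).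
  have -> : \sum_(j < N.-1) w j * (\sum_(l < N.-1 - j) u l * 1) =
      \sum_(l < N) w l * (\sum_(j < N) u j * (1 - ind (l + j).+1)).
    have -> : \sum_(j < N.-1) w j * (\sum_(l < N.-1 - j) u l * 1) =
      \sum_(j < N) w j * (\sum_(l < N.-1 - j) u l * 1).
      case: (N) N0 => // N' _; rewrite [RHS]big_ord_recr /= subnn big_ord0 mulr0 addr0.
      by [].
    apply: eq_bigr => l _; congr (_ * _).
    have le : (N.-1 - l <= N)%N by lia.
    rewrite (big_ord_widen _ (fun j => u j * 1) le) big_mkcond /=.
    apply: eq_bigr => j _; rewrite /ind; case: ltnP => jl.
      have -> : (N <= (l + j).+1)%N = false by lia.
      by rewrite /= mulr0n subr0.
    have -> : (N <= (l + j).+1)%N by lia.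
    by rewrite /= mulr1n subrr mulr0.
  rewrite mulr_suml -sumrB; apply: eq_bigr => l _; rewrite -mulrBr; congr (_ * _).
  by rewrite -sumrB; apply: eq_bigr => j _; rewrite [in RHS]mulrBr mulr1 subKr.
rewrite E lerB// mulrC ler_pM//; exact: sumr_ge0.
Qed.

End Tails.

(** * Integer lists enclosing sequences *)

(** Throughout, [up] chooses between upper bounds with rounding up and lower bounds with rounding
down, so that each algorithm is written and verified once. *)
Definition rnd (up : bool) (a b : N) : N :=
  if up then N.div (N.add a (N.pred b)) b else N.div a b.

Fixpoint dot (u v : seq N) : N :=
  match u, v with
  | x :: u', y :: v' => N.add (N.mul x y) (dot u' v')
  | _, _ => N0
  end.

Fixpoint sumN (l : seq N) : N := if l is x :: l' then N.add x (sumN l') else N0.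

(** Solves W' = U W from the list [u] of first values of the source, [d] being used for all later
values: [rw] holds the values found so far, latest first, and [rs] their partial sums, so that the
contribution of the constant part of the source is a single product. *)
Fixpoint solN (up : bool) (d : N) (u : seq N) (K : nat) (den : N) (fuel : nat) (m : N)
  (rw rs : seq N) : seq N * seq N :=
  if fuel is f.+1 then
    let x := rnd up (N.add (dot u rw) (N.mul d (nth N0 rs K))) (N.mul m den) in
    solN up d u K den f (N.succ m) (x :: rw) (N.add x (head N0 rs) :: rs)
  else (rw, rs).

Fixpoint phiN (up : bool) (l : seq N) (m : N) : seq N :=
  if l is x :: l' then rnd up x m :: phiN up l' (N.succ m) else [::].

(** The convolution of [ph] and [b], one term after the other; [rb] is the part of [b] already
read, reversed. *)
Fixpoint spineN (up : bool) (ph b rb : seq N) (den : N) : seq N :=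
  if b is x :: b' then rnd up (dot ph (x :: rb)) den :: spineN up ph b' (x :: rb) den
  else [::].

(** The recursion [v_rec] run downwards, where it divides by j and so contracts the initial error.
*)
Fixpoint vN (up : bool) (e : N) (j : nat) (jN : N) (acc : seq N) : seq N :=
  if j is j'.+1 then vN up e j' (N.pred jN) (rnd up (N.add e (head N0 acc)) jN :: acc)
  else acc.

(** Correlations of [b] with the successive shifts of [g], each completed by an estimate of the
tail. *)
Fixpoint omN (up : bool) (b g : seq N) (tail : N -> N) (den : N) (c : nat) (j : N) {struct c} : seq N :=
  match c, g with
  | c'.+1, _ :: g' => rnd up (N.add (dot b g') (tail j)) den :: omN up b g' tail den c' (N.succ j)
  | _, _ => [::]
  end.

Section Enclosures.
Variable R : realType.
Implicit Types (D E : R) (a : N).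

Definition N2R (a : N) : R := (N.to_nat a)%:R.

Lemma N2R_ge0 a : 0 <= N2R a. Proof. exact: ler0n. Qed.
Lemma N2RD a b : N2R (N.add a b) = N2R a + N2R b.
Proof. by rewrite /N2R N2Nat.inj_add natrD. Qed.
Lemma N2RM a b : N2R (N.mul a b) = N2R a * N2R b.
Proof. by rewrite /N2R N2Nat.inj_mul natrM. Qed.
Lemma N2RS a : N2R (N.succ a) = N2R a + 1.
Proof. by rewrite /N2R N2Nat.inj_succ -natr1. Qed.
Lemma N2RB a b : N2R a - N2R b <= N2R (N.sub a b).
Proof.
rewrite lerBlDr /N2R -natrD ler_nat N2Nat.inj_sub; lia.
Qed.
Lemma N2R_le a b : N.leb a b -> N2R a <= N2R b.
Proof. by move=> /N.leb_le H; rewrite ler_nat; lia. Qed.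
Lemma N2R_lt a b : N.ltb a b -> N2R a < N2R b.
Proof. by move=> /N.ltb_lt H; rewrite ltr_nat; lia. Qed.

Definition bnd (up : bool) (x y : R) := if up then y <= x else x <= y.

Lemma bndD up x x' y y' : bnd up x y -> bnd up x' y' -> bnd up (x + x') (y + y').
Proof. by case: up => /=; exact: lerD. Qed.

Lemma bndM up x x' y y' : 0 <= x -> 0 <= x' -> 0 <= y -> 0 <= y' ->
  bnd up x y -> bnd up x' y' -> bnd up (x * x') (y * y').
Proof. by case: up => /= ? ? ? ? ? ?; exact: ler_pM. Qed.

Lemma bnd_refl up x : bnd up x x. Proof. by case: up => /=. Qed.

Lemma rnd_lo a b : N2R (N.div a b) * N2R b <= N2R a.
Proof.
rewrite -N2RM ler_nat.
case: b => [|b]; first by rewrite N.mul_0_r.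
have := N.Div0.mul_div_le a (Npos b); lia.
Qed.

Lemma rnd_hi a b : (0 < N2R b) -> N2R a <= N2R (rnd true a b) * N2R b.
Proof.
rewrite /rnd -N2RM ler_nat ltr0n => b0.
have bn0 : b <> N0 by move=> E; rewrite E in b0.
have := N.div_mod (N.add a (N.pred b)) b bn0.
have := N.mod_lt (N.add a (N.pred b)) b bn0.
set q := N.div _ _; set r := N.modulo _ _; lia.
Qed.

Lemma bnd_rnd up a b y : 0 < N2R b -> bnd up (N2R a) y -> bnd up (N2R (rnd up a b)) (y / N2R b).
Proof.
move=> b0; case: up => /= H.
  by rewrite ler_pdivrMr//; apply: le_trans H _; exact: rnd_hi.
by rewrite ler_pdivlMr//; apply: le_trans (rnd_lo _ _) H.
Qed.

Definition appr up D (l : seq N) (x : nat -> R) :=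
  forall i, (i < size l)%N -> bnd up (N2R (nth N0 l i)) (D * x i).

Lemma appr_cons up D a l x : bnd up (N2R a) (D * x 0%N) -> appr up D l (x \o S) ->
  appr up D (a :: l) x.
Proof. by move=> h0 hl [|i] //=; rewrite ltnS; exact: hl. Qed.

Lemma appr_behead up D l x : appr up D l x -> appr up D (behead l) (x \o S).
Proof. by case: l => [//|a l] H i il; exact: (H i.+1). Qed.

Lemma appr_take up D l x n : appr up D l x -> appr up D (take n l) x.
Proof.
move=> H i; rewrite size_take_min leq_min => /andP[iN il]; rewrite nth_take//; exact: H.
Qed.

Lemma appr_ext up D l x y : (forall i, x i = y i) -> appr up D l x -> appr up D l y.
Proof. by move=> E H i il; rewrite -E; exact: H. Qed.

Lemma dot_bnd up D E u v (x y : nat -> R) : 0 <= D -> 0 <= E ->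
  (forall i, 0 <= x i) -> (forall i, 0 <= y i) ->
  appr up D u x -> appr up E v y ->
  bnd up (N2R (dot u v)) (D * E * \sum_(i < minn (size u) (size v)) x i * y i).
Proof.
move=> D0 E0; elim: u v x y => [|a u IH] v x y x0 y0 Hu Hv.
  by rewrite min0n big_ord0 mulr0; exact: bnd_refl.
case: v Hv => [|b v] Hv; first by rewrite minn0 big_ord0 mulr0; exact: bnd_refl.
rewrite [dot _ _]/= [size _]/= [X in minn _ X]/= minnSS big_ord_recl N2RD N2RM mulrDr.
apply: bndD.
  rewrite mulrACA; apply: bndM; rewrite ?N2R_ge0 ?mulr_ge0//.
    exact: (Hu 0%N).
  exact: (Hv 0%N).
apply: (IH v (x \o S) (y \o S)) => [i|i||]; [exact: x0|exact: y0| |].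
  exact: (appr_behead Hu).
exact: (appr_behead Hv).
Qed.

Lemma sumN_bnd up D l x : appr up D l x -> bnd up (N2R (sumN l)) (D * \sum_(i < size l) x i).
Proof.
elim: l x => [|a l IH] x H; first by rewrite big_ord0 mulr0; exact: bnd_refl.
rewrite [sumN _]/= [size _]/= big_ord_recl N2RD mulrDr; apply: bndD; first exact: (H 0%N).
by apply: (IH (x \o S)); exact: (appr_behead H).
Qed.

Lemma phiN_appr up D l x m (c : R) : 0 < c -> N2R m = c -> appr up D l x ->
  appr up D (phiN up l m) (fun i => x i / (c + i%:R)).
Proof.
elim: l x m c => [//|a l IH] x m c c0 mc H; rewrite /=; apply: appr_cons.
  by rewrite addr0 mulrA -mc; apply: bnd_rnd; [rewrite mc|exact: (H 0%N)].
apply: (@appr_ext _ _ _ (fun i => x i.+1 / (c + 1 + i%:R))).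
  by move=> i /=; rewrite -addrA nat1r.
apply: (IH (x \o S)); [by rewrite addr_gt0|by rewrite N2RS mc|exact: (appr_behead H)].
Qed.

Lemma phiN1_appr up D l x : appr up D l x -> appr up D (phiN up l 1%num) (fun i => x i / i.+1%:R).
Proof.
move=> H; apply: (@appr_ext _ _ _ (fun i => x i / (1 + i%:R))); first by move=> i; rewrite nat1r.
exact: phiN_appr.
Qed.

Lemma size_phiN up l m : size (phiN up l m) = size l.
Proof. by elim: l m => //= a l IH m; rewrite IH. Qed.

Lemma bnd_trans up (x y z : R) : bnd up x y -> bnd up y z -> bnd up x z.
Proof. by case: up => /= h1 h2; [exact: le_trans h2 h1|exact: le_trans h1 h2]. Qed.

Lemma bnd_wM up (c x y : R) : 0 <= c -> bnd up x y -> bnd up (c * x) (c * y).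
Proof. by case: up => /= c0 h; rewrite ler_wpM2l. Qed.

Lemma bnd_sum up (I : Type) (r : seq I) (P : pred I) (F G : I -> R) :
  (forall i, P i -> bnd up (F i) (G i)) -> bnd up (\sum_(i <- r | P i) F i) (\sum_(i <- r | P i) G i).
Proof. by case: up => /= h; apply: ler_sum. Qed.

(** Both lists are in reverse order. *)
Definition inv_sol up D (w : nat -> R) n (rw rs : seq N) :=
  [/\ size rw = n.+1, size rs = n.+1,
      forall i, (i <= n)%N -> bnd up (N2R (nth N0 rw i)) (D * w (n - i)%N) &
      forall i, (i <= n)%N -> bnd up (N2R (nth N0 rs i)) (D * \sum_(k < (n - i).+1) w k)].

Lemma solN_spec up D Dw d u den (u_ w_ : nat -> R) :
  is_sol u_ w_ -> (forall n, 0 <= u_ n) -> 0 < D -> 0 <= Dw -> N2R den = D ->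
  appr up D u u_ -> (forall j, (size u <= j)%N -> bnd up (N2R d) (D * u_ j)) ->
  forall fuel n m rw rs, N2R m = n.+1%:R -> inv_sol up Dw w_ n rw rs ->
  let s := solN up d u (size u) den fuel m rw rs in inv_sol up Dw w_ (n + fuel) s.1 s.2.
Proof.
move=> sw u0 D0 Dw0 dE Hu Hd; have w0 := sol_ge0 sw u0; have [_ wS] := sw.
elim=> [|f IH] n m rw rs mE [srw srs Hrw Hrs]; first by rewrite /= addn0.
rewrite [solN _ _ _ _ _ _ _ _ _]/=.
set x := rnd _ _ _.
have Hx : bnd up (N2R x) (Dw * w_ n.+1).
  have -> : Dw * w_ n.+1 = (D * Dw * cv u_ w_ n) / N2R (N.mul m den).
    rewrite N2RM mE dE -wS; field.
    by rewrite lt0r_neq0//= nat1r pnatr_eq0.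
  apply: bnd_rnd; first by rewrite N2RM mE dE mulr_gt0// ltr0Sn.
  have Hy : appr up Dw rw (fun i => w_ (n - i)%N) by move=> i; rewrite srw ltnS; exact: Hrw.
  have Hdot := dot_bnd (ltW D0) Dw0 u0 (fun i => w0 (n - i)%N) Hu Hy.
  rewrite srw in Hdot.
  pose q := minn (size u) n.+1.
  have qn : (q <= n.+1)%N by exact: geq_minr.
  have -> : cv u_ w_ n = \sum_(i < q) u_ i * w_ (n - i)%N + \sum_(q <= i < n.+1) u_ i * w_ (n - i)%N.
    by rewrite /cv -!(big_mkord xpredT (fun i => u_ i * w_ (n - i)%N)) (big_cat_nat _ qn).
  rewrite N2RD mulrDr; apply: bndD; first exact: Hdot.
  rewrite N2RM; case: (leqP (size u) n) => Kn; last first.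
    rewrite [nth N0 rs _]nth_default ?srs// mulr0 /q (minn_idPr _)// big_geq// mulr0.
    exact: bnd_refl.
  have qE : q = size u by rewrite /q (minn_idPl _)// ltnW.
  rewrite qE; apply: (bnd_trans (y := N2R d * (Dw * \sum_(k < (n - size u).+1) w_ k))).
    by apply: bnd_wM; [exact: N2R_ge0|exact: Hrs].
  have -> : \sum_(k < (n - size u).+1) w_ k = \sum_(size u <= i < n.+1) w_ (n - i)%N.
    rewrite -[RHS]/(\sum_(0 + size u <= i < n.+1) w_ (n - i)%N) big_addn big_mkord subSn//.
    rewrite (reindex_inj rev_ord_inj) /=.
    by apply: eq_bigr => i _; congr w_; have := ltn_ord i; lia.
  rewrite !mulr_sumr big_nat_cond [X in bnd _ _ X]big_nat_cond.
  apply: bnd_sum => i /andP[/andP[ui _] _]; rewrite mulrA [D * Dw]mulrC -!mulrA mulrCA.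
  apply: bnd_wM => //; rewrite mulrA; rewrite -[N2R d * _]mulrC [D * _ * _]mulrC.
  by apply: bnd_wM => //; exact: Hd.
rewrite addnS -addSn; apply: IH; first by rewrite N2RS mE natr1.
split=> /=; rewrite ?srw ?srs//.
  by move=> [|i]; rewrite ?subn0// ltnS subSS => /Hrw.
move=> [|i]; last by rewrite ltnS subSS => /Hrs.
move=> _; rewrite subn0 N2RD big_ord_recr mulrDr addrC; apply: bndD => //=.
by have := Hrs 0%N isT; rewrite subn0 nth0.
Qed.

Lemma appr_rev up D w n rw rs : inv_sol up D w n rw rs -> appr up D (rev rw) w.
Proof.
move=> [srw _ H _] i; rewrite size_rev srw => il; rewrite nth_rev ?srw//.
have := H (n.+1 - i.+1)%N; rewrite subSS leq_subr subKn; last by lia.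
exact.
Qed.

Lemma spineN_spec up D E ph b den (phi b_ : nat -> R) : 0 <= D -> 0 < E ->
  (forall n, 0 <= phi n) -> (forall n, 0 <= b_ n) -> N2R den = E ->
  appr up D ph phi -> forall n rb, (n + size b <= size ph)%N -> size rb = n ->
  (forall i, (i < n)%N -> bnd up (N2R (nth N0 rb i)) (E * b_ (n.-1 - i)%N)) ->
  (forall i, (i < size b)%N -> bnd up (N2R (nth N0 b i)) (E * b_ (n + i)%N)) ->
  forall i, (i < size b)%N -> bnd up (N2R (nth N0 (spineN up ph b rb den) i)) (D * cv phi b_ (n + i)).
Proof.
move=> D0 E0 phi0 b0 dE Hph.
elim: b => [//|a b IH] n rb sz srb Hrb Hb [|i] /=; last first.
  rewrite ltnS => ib; rewrite addnS -addSn; apply: IH => //=.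
  - by move: sz => /=; lia.
  - by rewrite srb.
  - move=> [|j]; first by move=> _; rewrite subn0; have := Hb 0%N isT; rewrite addn0.
    rewrite ltnS => jn; have -> : (n - j.+1 = n.-1 - j)%N by lia.
    exact: Hrb.
  - by move=> j jb; have := Hb j.+1 jb; rewrite addnS -addSn.
move=> _; rewrite addn0.
have -> : D * cv phi b_ n = (D * E * cv phi b_ n) / N2R den.
  by rewrite dE; field; rewrite lt0r_neq0.
apply: bnd_rnd; first by rewrite dE.
have Ha : appr up E (a :: rb) (fun i => b_ (n - i)%N).
  move=> [|j] /=; first by move=> _; rewrite subn0; have := Hb 0%N isT; rewrite addn0.
  rewrite ltnS srb => jn; have -> : (n - j.+1 = n.-1 - j)%N by lia.
  exact: Hrb.
have := dot_bnd D0 (ltW E0) phi0 (fun i => b0 (n - i)%N) Hph Ha.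
rewrite /= srb (minn_idPr _); last by move: sz => /=; lia.
exact.
Qed.

Lemma size_spineN up ph b rb den : size (spineN up ph b rb den) = size b.
Proof. by elim: b rb => //= a b IH rb; rewrite IH. Qed.

Lemma vN_spec up D e (eR : R) (v : nat -> R) : 0 <= D -> (forall j, j.+1%:R * v j = eR + v j.+1) ->
  bnd up (N2R e) (D * eR) ->
  forall j jN acc, N2R jN = j%:R -> (0 < size acc)%N -> appr up D acc (fun i => v (j + i)%N) ->
  (size (vN up e j jN acc) = j + size acc)%N /\ appr up D (vN up e j jN acc) v.
Proof.
move=> D0 vS He; elim=> [|j IH] jN acc jE sa Ha; first by split.
have jE' : N2R (N.pred jN) = j%:R.
  rewrite /N2R; congr _%:R; move: jE => /eqP; rewrite /N2R eqr_nat => /eqP; lia.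
have [] // := IH (N.pred jN) (rnd up (N.add e (head N0 acc)) jN :: acc) jE' isT.
  apply: appr_cons; last first.
    by apply: (appr_ext _ Ha) => i /=; rewrite addnS.
  rewrite addn0.
  have -> : D * v j = (D * eR + D * v j.+1) / N2R jN.
    by rewrite jE -mulrDr -vS mulrCA mulrAC mulfV ?mul1r ?pnatr_eq0.
  apply: bnd_rnd; first by rewrite jE ltr0Sn.
  by rewrite N2RD; apply: bndD => //; have := Ha 0%N sa; rewrite addn0 nth0.
by move=> sz H; rewrite /= sz /= addnS.
Qed.

Lemma omN_spec up D E b (b_ g_ : nat -> R) tail (tR : nat -> R) den : 0 < D -> 0 <= E ->
  (forall n, 0 <= b_ n) -> (forall n, 0 <= g_ n) -> N2R den = D -> appr up D b b_ ->
  (forall j jN, N2R jN = j%:R -> bnd up (N2R (tail jN)) (D * E * tR j)) ->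
  forall c g j jN, N2R jN = j%:R -> appr up E g (fun i => g_ (j + i)%N) -> (c + size b <= size g)%N ->
  (size (omN up b g tail den c jN) = c) /\
  appr up E (omN up b g tail den c jN)
    (fun i => \sum_(l < size b) b_ l * g_ (j + i + l).+1 + tR (j + i)%N).
Proof.
move=> D0 E0 b0 g0 dE Hb Ht; elim=> [|c IH] g j jN jE Hg sz; first by split.
case: g Hg sz => [|x g] Hg; first by rewrite addSn.
rewrite addSn ltnS => sz /=.
have Hg' : appr up E g (fun i => g_ (j.+1 + i)%N).
  by move: (appr_behead Hg); apply: appr_ext => i /=; rewrite addnS.
have jE' : N2R (N.succ jN) = j.+1%:R by rewrite N2RS jE natr1.
have [sz' H] := IH g j.+1 (N.succ jN) jE' Hg' sz.
split; first by rewrite sz'.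
apply: appr_cons; last by apply: (appr_ext _ H) => i /=; rewrite addnS addSn.
rewrite addn0.
set S := \sum_(l < _) _.
have -> : E * (S + tR j) = (D * E * S + D * E * tR j) / N2R den.
    by rewrite dE; field; rewrite lt0r_neq0.
apply: bnd_rnd; first by rewrite dE.
rewrite N2RD; apply: bndD; last exact: Ht.
have := dot_bnd (ltW D0) E0 b0 (fun i => g0 (j.+1 + i)%N) Hb Hg'.
rewrite (minn_idPl _); last exact: leq_trans (leq_addl _ _) sz.
by rewrite /S; under eq_bigr do rewrite addSn.
Qed.

End Enclosures.

(** * Numerical values for layers *)

Record enc := Enc { eden : N; elo : N; ehi : N }.

Definition pow10 (e : nat) : N := iter e (N.mul 10%num) 1%num.

(** Cross-multiplied form of m - 1/2 <= 10^e (x - y) < m + 1/2 for x and y in the enclosures [s]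
and [t]. *)
Definition round_check (s t : enc) (m e : nat) : bool :=
  let T := N.mul 2%num (pow10 e) in
  let M := N.mul 2%num (N.of_nat m) in
  let DD := N.mul (eden s) (eden t) in
  [&& N.ltb 0%num DD, (100 <= m < 1000)%N,
    N.leb (N.add (N.mul (N.pred M) DD) (N.mul T (N.mul (ehi t) (eden s)))) (N.mul T (N.mul (elo s) (eden t))) &
    N.ltb (N.mul T (N.mul (ehi s) (eden t))) (N.add (N.mul (N.succ M) DD) (N.mul T (N.mul (elo t) (eden s))))].

Section Layers.
Variable R : realType.
Implicit Types (x y : R).
Notation N2R := (@N2R R).
Notation c_ m := (pr R (height_le m)).

Definition encl (x : R) (s : enc) :=
  N2R (elo s) <= N2R (eden s) * x /\ N2R (eden s) * x <= N2R (ehi s).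

Lemma N2R_pow10 e : N2R (pow10 e) = 10 ^+ e.
Proof. by elim: e => [|e IH]; rewrite /pow10 ?iterS ?N2RM -?/(pow10 e) ?IH ?exprS// expr0. Qed.

Lemma N2R_of_nat m : N2R (N.of_nat m) = m%:R.
Proof. by rewrite /N2R Nat2N.id. Qed.

Lemma round_check_aux x y (D1 l1 h1 D2 l2 h2 T m : R) : 0 < D1 -> 0 < D2 -> 0 < T ->
  l1 <= D1 * x -> D1 * x <= h1 -> l2 <= D2 * y -> D2 * y <= h2 ->
  (2 * m - 1) * (D1 * D2) + 2 * T * (h2 * D1) <= 2 * T * (l1 * D2) ->
  2 * T * (h1 * D2) < (2 * m + 1) * (D1 * D2) + 2 * T * (l2 * D1) ->
  m - 2^-1 <= (x - y) * T < m + 2^-1.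
Proof.
move=> D10 D20 T0 a b c d H1 H2.
have DD : 0 < D1 * D2 by rewrite mulr_gt0.
have T2 : 0 < 2 * T by rewrite mulr_gt0.
have a' : l1 * D2 <= D1 * D2 * x by rewrite mulrAC ler_wpM2r// ltW.
have b' : D1 * D2 * x <= h1 * D2 by rewrite mulrAC ler_wpM2r// ltW.
have c' : l2 * D1 <= D1 * D2 * y by rewrite mulrC -mulrA ler_wpM2l// ltW.
have d' : D1 * D2 * y <= h2 * D1 by rewrite [h2 * _]mulrC -mulrA ler_wpM2l// ltW.
have k1 : 2 * T * (l1 * D2) - 2 * T * (h2 * D1) <= 2 * T * (D1 * D2 * x - D1 * D2 * y).
  by rewrite -mulrBr ler_wpM2l ?(ltW T2)// lerB.
have k2 : 2 * T * (D1 * D2 * x - D1 * D2 * y) <= 2 * T * (h1 * D2) - 2 * T * (l2 * D1).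
  by rewrite -[leRHS]mulrBr ler_wpM2l ?(ltW T2)// lerB.
have k3 : (D1 * D2) * (m - 2^-1) <= (D1 * D2) * ((x - y) * T) by lra.
have k4 : (D1 * D2) * ((x - y) * T) < (D1 * D2) * (m + 2^-1) by lra.
by move: k3 k4; rewrite ler_pM2l// ltr_pM2l// => -> ->.
Qed.

Lemma round_checkP x y s t m e : encl x s -> encl y t -> round_check s t m e -> rounds3 (x - y) m e.
Proof.
move=> [sl sh] [tl th] /and4P[/(@N2R_lt R) DD mm /(@N2R_le R) H1 /(@N2R_lt R) H2]; split=> //.
have pE (a : N) : N.ltb 0%num a -> N2R (N.pred a) = N2R a - 1.
  by move=> /N.ltb_lt a0; rewrite /N2R -[X in _ - X]/(1%:R) -natrB; [congr _%:R; lia|lia].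
have m1 : N.ltb 0%num (N.mul 2%num (N.of_nat m)).
  by apply/N.ltb_lt; case/andP: mm; lia.
move: DD H1 H2; rewrite !(N2RD, N2RM, N2RS) pE// !N2RM N2R_pow10 N2R_of_nat.
rewrite [N2R 0%num]/(0%:R) [N2R 2%num]/(2%:R) => DD.
have d1 := N2R_ge0 R (eden s); have d2 := N2R_ge0 R (eden t).
have D10 : 0 < N2R (eden s) by rewrite lt_neqAle d1 andbT; apply/eqP => E; move: DD; rewrite -E mul0r ltxx.
have D20 : 0 < N2R (eden t) by rewrite lt_neqAle d2 andbT; apply/eqP => E; move: DD; rewrite -E mulr0 ltxx.
move=> H1 H2; apply: (@round_check_aux x y _ _ _ _ _ _ _ m%:R D10 D20 _ sl sh tl th H1 H2).
by rewrite exprn_gt0.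
Qed.

Fixpoint wsumN (up : bool) (l : seq N) (m : N) : N :=
  if l is x :: l' then N.add (rnd up x (N.mul m (N.succ m))) (wsumN up l' (N.succ m)) else 0%num.

(** The source c_k is nonincreasing, so that beyond the list it is bounded by 0 and the last
entry. *)
Definition layer_step (up : bool) (S : N) (prev : seq N) (fuel : nat) : seq N :=
  rev (solN up (if up then last 0%num prev else 0%num) prev (size prev) S fuel 1%num [:: S] [:: S]).1.

(** The weights 1 / ((j+1)(j+2)) sum to 1 / (L+1) over j >= L. *)
Definition layer_enc (S : N) (lo hi : seq N) : enc :=
  Enc S (wsumN false lo 1%num)
    (N.add (wsumN true hi 1%num) (rnd true (last 0%num hi) (N.succ (N.of_nat (size hi))))).

Fixpoint layer_run (S : N) (fuels : seq (nat * nat)) (plo phi : seq N) : seq enc :=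
  if fuels is f :: fs then
    let lo := layer_step false S plo f.1 in
    let hi := layer_step true S phi f.2 in
    layer_enc S lo hi :: layer_run S fs lo hi
  else [::].

Definition layer_ok (S : N) k (lo hi : seq N) :=
  [/\ appr false (N2R S) lo (c_ k), appr true (N2R S) hi (c_ k) & (0 < size hi)%N].

Lemma wsumN_bnd up D l (x : nat -> R) n m : N2R m = n.+1%:R -> appr up D l (fun i => x (n + i)%N) ->
  bnd up (N2R (wsumN up l m)) (D * \sum_(i < size l) x (n + i)%N * g0 R (n + i)%N).
Proof.
elim: l n m => [|a l IH] n m mE H; first by rewrite big_ord0 mulr0; exact: bnd_refl.
rewrite [wsumN _ _ _]/= [size _]/= big_ord_recl N2RD mulrDr; apply: bndD.
  rewrite addn0 mulrA; have -> : g0 R n = (N2R (N.mul m (N.succ m)))^-1.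
    by rewrite N2RM N2RS mE natr1.
  apply: bnd_rnd; last by have := H 0%N isT; rewrite addn0.
  by rewrite N2RM N2RS mE natr1 mulr_gt0// ltr0Sn.
under eq_bigr do rewrite addnS -addSn.
apply: IH; first by rewrite N2RS mE natr1.
by move: (appr_behead H); apply: appr_ext => i /=; rewrite addnS addSn.
Qed.

Lemma c_le k m n : (m <= n)%N -> c_ k n <= c_ k m.
Proof.
move=> /subnKC <-; elim: (n - m)%N => [|i IH]; first by rewrite addn0.
by rewrite addnS; apply: le_trans IH; exact: c_noninc.
Qed.

Lemma last_bnd S k hi j : appr true (N2R S) hi (c_ k) -> (0 < size hi)%N -> (size hi <= j.+1)%N ->
  N2R S * c_ k j <= N2R (last 0%num hi).
Proof.
move=> H s0 sj; rewrite -nth_last; apply: le_trans (H _ _); last by rewrite prednK.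
by rewrite ler_wpM2l ?N2R_ge0// c_le//; lia.
Qed.

Lemma layer_step_ok up S k prev fuel : 0 < N2R S -> (0 < size prev)%N ->
  appr up (N2R S) prev (c_ k) ->
  appr up (N2R S) (layer_step up S prev fuel) (c_ k.+1) /\
  (0 < size (layer_step up S prev fuel))%N.
Proof.
move=> S0 p0 H.
have I : inv_sol up (N2R S) (c_ k.+1) (0 + fuel)
   (solN up (if up then last 0%num prev else 0%num) prev (size prev) S fuel 1%num [:: S] [:: S]).1
   (solN up (if up then last 0%num prev else 0%num) prev (size prev) S fuel 1%num [:: S] [:: S]).2.
  apply: (@solN_spec R up (N2R S) (N2R S) _ _ _ (c_ k)) => //.
  - exact: c_sol.
  - exact: pr_ge0.
  - move=> j pj; case: (up) H => H /=; last by rewrite mulr_ge0 ?N2R_ge0 ?pr_ge0.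
    by apply: last_bnd => //; exact: leqW.
  - have [w0 _] := c_sol R k; split=> //= -[|i]//= _; rewrite ?big_ord1 w0 mulr1; exact: bnd_refl.
split; first exact: (appr_rev I).
by rewrite /layer_step size_rev; case: I => ->.
Qed.

Lemma layer_encP S k lo hi : 0 < N2R S -> layer_ok S k lo hi -> encl (lhead R k) (layer_enc S lo hi).
Proof.
move=> S0 [Hlo Hhi s0]; split=> /=.
  apply: le_trans (@wsumN_bnd false (N2R S) lo (c_ k) 0 1%num erefl Hlo) _.
  by rewrite ler_wpM2l ?N2R_ge0//; exact: (proj1 (lhead_ubs k (lhead R k)) (lexx _) (size lo)).
rewrite mulrC -ler_pdivlMr//; apply: (proj2 (lhead_ubs k _)) => n.
rewrite ler_pdivlMr// mulrC.
have g_ge0 j : 0 <= c_ k j * g0 R j by rewrite mulr_ge0 ?pr_ge0 ?g0_ge0.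
apply: (@le_trans _ _ (N2R S * \sum_(j < size hi + n) c_ k j * g0 R j)).
  by rewrite ler_wpM2l ?N2R_ge0//; apply: (@sum_nneg_le R (fun j => c_ k j * g0 R j)) => //; exact: leq_addl.
rewrite (@sum_split R (fun j => c_ k j * g0 R j) (size hi)) ?leq_addr// mulrDr N2RD lerD//.
  exact: (@wsumN_bnd true (N2R S) hi (c_ k) 0 1%num erefl Hhi).
set L := size hi.
apply: (@le_trans _ _ (N2R (last 0%num hi) / L.+1%:R)); last first.
  have := @bnd_rnd R true (last 0%num hi) (N.succ (N.of_nat L)) (N2R (last 0%num hi)).
  rewrite N2RS N2R_of_nat natr1; apply; [exact: ltr0Sn|exact: lexx].
apply: (@le_trans _ _ (\sum_(L <= j < L + n) N2R (last 0%num hi) * g0 R j)).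
  rewrite mulr_sumr; apply: ler_sum_nat => j /andP[Lj _].
  by rewrite mulrA ler_wpM2r ?g0_ge0// last_bnd//; exact: leqW.
rewrite -mulr_sumr ler_wpM2l ?N2R_ge0// -{1}[L]add0n big_addn addKn big_mkord.
under eq_bigr do rewrite addnC.
by rewrite telescope2 lerBlDr lerDl invr_ge0.
Qed.

Fixpoint encs_ok k (l : seq enc) : Prop :=
  if l is s :: l' then encl (lhead R k) s /\ encs_ok k.+1 l' else True.

Lemma layer_run_ok S fs k lo hi : 0 < N2R S -> (0 < size lo)%N -> layer_ok S k lo hi ->
  encs_ok k.+1 (layer_run S fs lo hi).
Proof.
move=> S0; elim: fs k lo hi => [//|f fs IH] k lo hi l0 [Hlo Hhi h0].
have [Hlo' l0'] := layer_step_ok f.1 S0 l0 Hlo.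
have [Hhi' h0'] := layer_step_ok f.2 S0 h0 Hhi.
by split; [exact: layer_encP|apply: IH].
Qed.

End Layers.

(** The lengths grow with k because ever larger trees have height at most k with a probability
that matters.  The lower lists may be shorter since the omitted terms are much smaller than the
bound for them.  The scale makes the accumulated rounding errors smaller than the distance to
the rounding boundaries. *)
Definition layer_scale : N := N.pow 2 28.
Definition layer_fuels : seq (nat * nat) :=
  [:: (8, 9); (19, 20); (40, 40); (63, 72); (118, 129); (153, 192); (275, 299); (319, 399)]%N.
Definition layer_data : seq enc :=
  layer_run layer_scale layer_fuels [:: layer_scale; 0%num] [:: layer_scale; 0%num].

Definition layer_checks (l : seq enc) : bool :=
  if l is [:: q1; q2; q3; q4; q5; q6; q7; q8] then
    [&& round_check q2 q1 114 3, round_check q3 q2 647 4, round_check q4 q3 384 4,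
        round_check q5 q4 235 4, round_check q6 q5 146 4, round_check q7 q6 928 5 &
        round_check q8 q7 595 5]
  else false.

Lemma layer_checks_true : layer_checks layer_data.
Proof. by vm_cast_no_check (erefl true). Qed.

(** * Numerical values for ranks *)

(** What is known of b_m at scale [bden]: enclosures of its first terms, and upper bounds for
their sum, for the rest of the series of b_m(j) / (j+1), and for the rest of the series of b_m(j).
*)
Record bdata := BData { bden : N; blo : seq N; bhi : seq N; bmass : N; bwtail : N; btail : N }.

(** The source of b_1 is 0, 1, 1, 1, ... *)
Definition b1list (D : N) (up : bool) : seq N :=
  rev (solN up D [:: 0%num] 1 D 12 1%num [:: D] [:: D]).1.
(** By [b1_stay] two consecutive terms of b_1 enclose all later ones and their limit 1/e. *)
Definition einf (D : N) (up : bool) : N :=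
  let l := b1list D up in
  if up then N.max (nth 0%num l 11) (nth 0%num l 12) else N.min (nth 0%num l 11) (nth 0%num l 12).

Definition b2sol (D D2 : N) (up : bool) (M : nat) : seq N * seq N :=
  solN up (einf D up) (0%num :: take 11 (behead (b1list D up))) 12 D M.-1 1%num [:: D2] [:: D2].

(** The downward recursion starts from e^-1 / (T+1) <= v_T <= 1 / (T+1). *)
Definition g2list (D : N) (up : bool) (T : nat) : seq N :=
  let TN := N.of_nat T in
  let top := if up then rnd true D (N.succ TN) else rnd false (einf D false) (N.succ TN) in
  phiN up (behead (vN up (einf D up) T TN [:: top])) 1%num.

(** The tails in [omega_upper] and [omega_lower], at scale D2 * D; the bounds 3/8 and 11/30 of 1/e
and b_1 are put over common denominators. *)
Definition tail_hi (D : N) (S : N) (M : nat) : N :=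
  let MN := N.of_nat M in
  rnd true (N.mul (N.mul S D) (N.add (N.mul 3%num (N.succ MN)) 8%num))
    (N.mul (N.mul 8%num (N.succ MN)) (N.mul (N.mul 3%num MN) (N.succ MN))).
Definition tail_lo (e S : N) (M : nat) (j : N) : N :=
  let jM := N.add j (N.of_nat M) in
  rnd false (N.mul (N.mul 11%num S) e) (N.mul 60%num (N.mul (N.succ jM) (N.succ (N.succ jM)))).

(** From b_m to b_{m+1}: the source a_{m+1} is b_m without its first term 1, and the tail follows
from [mass_sol]. *)
Definition next_b (N0 : nat) (B : bdata) (Dw : N) : bdata :=
  let NN := N.of_nat N0 in
  let D := bden B in
  let sl := solN false 0%num (0%num :: behead (blo B)) N0 D N0.-1 1%num [:: Dw] [:: Dw] in
  let sh := solN true D (0%num :: behead (bhi B)) N0 D N0.-1 1%num [:: Dw] [:: Dw] in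
  let lo := rev sl.1 in
  let hi := rev sh.1 in
  let W := head 0%num sh.2 in
  let V := dot lo (map N.of_nat (iota 0 N0)) in
  let U := N.sub (bmass B) D in
  let X := bwtail B in
  let kap := N.add (rnd true U (N.succ NN)) X in
  let num := N.add (rnd true (N.sub (N.mul U W) (N.mul V D)) NN) (N.mul W X) in
  let tau := rnd true num (N.sub D kap) in
  BData Dw lo hi W (rnd true tau (N.succ NN)) tau.

(** The contraction factor in [mass_sol] is less than 1. *)
Definition kap_ok (N0 : nat) (B : bdata) : bool :=
  N.ltb (N.add (rnd true (N.sub (bmass B) (bden B)) (N.succ (N.of_nat N0))) (bwtail B)) (bden B).

(** The lists b_m, ..., b_3, for increasing m; the latest one comes first because it starts the
chain of convolutions. *)
Fixpoint bdatas (N0 : nat) (Ds : seq N) (B : bdata) (acc : seq bdata) : seq (seq bdata) :=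
  if Ds is D :: Ds' then
    let B' := next_b N0 B D in (B' :: acc) :: bdatas N0 Ds' B' (B' :: acc)
  else [::].

(** An enclosure of an expected chain count, with a bound for its sum beyond the list.  [f_init]
is the count at depth 0, which is a_{m+1}, and each [f_step] applies [echainS] once; there, the
tail is the bound of [mass_conv] for the whole mass minus the mass in the list. *)
Record fdata := FData { flo : seq N; fhi : seq N; ftail : N }.

Definition f_init (Df : N) (B : bdata) : fdata :=
  FData (0%num :: [seq rnd false (N.mul x Df) (bden B) | x <- behead (blo B)])
        (0%num :: [seq rnd true (N.mul x Df) (bden B) | x <- behead (bhi B)])
        (rnd true (N.mul (btail B) Df) (bden B)).

Definition f_step (N0 : nat) (B : bdata) (F : fdata) : fdata :=
  let pl := phiN false (flo F) 1%num in
  let ph := phiN true (fhi F) 1%num in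
  (* the convolution is shifted by one *)
  let lo := 0%num :: spineN false pl (take N0.-1 (blo B)) [::] (bden B) in
  let hi := 0%num :: spineN true ph (take N0.-1 (bhi B)) [::] (bden B) in
  let Phi := N.add (sumN ph) (rnd true (ftail F) (N.succ (N.of_nat N0))) in
  FData lo hi (N.sub (rnd true (N.mul Phi (N.add (bmass B) (btail B))) (bden B)) (sumN lo)).

Definition f_run N0 (Bs : seq bdata) (F : fdata) : fdata := foldl (fun F B => f_step N0 B F) F Bs.

(** The sum in [rtail4_ubs]; beyond [N0] the weight is at most its value at [N0]. *)
Definition rank_enc (N0 : nat) (D Df : N) (omlo omhi : seq N) (Bs : seq bdata) : enc :=
  if Bs is B :: Bs' then
    let F := f_run N0 Bs' (f_init Df B) in
    Enc (N.mul Df D) (dot (phiN false (flo F) 1%num) omlo)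
      (N.add (dot (phiN true (fhi F) 1%num) omhi)
         (N.mul (rnd true (ftail F) (N.succ (N.of_nat N0))) (nth 0%num omhi N0)))
  else Enc 0%num 0%num 0%num.

(** The contraction conditions, and the enclosures of [rtail 3], [rtail 4], ...  The
series for [rtail 3] and for the weight [omega] are cut at [M], all others at [N0]; the scales [Ds] and [Dfs] of b_m and of the chain
counts increase with m because these quantities become very small. *)
Definition rank_data (N0 M : nat) (D D2 : N) (Ds Dfs : seq N) : bool * seq enc :=
  let sl := b2sol D D2 false M in
  let sh := b2sol D D2 true M in
  let lo := rev sl.1 in
  let hi := rev sh.1 in
  let gl := g2list D false (N0 + M + 8) in
  let gh := g2list D true (N0 + M + 8) in
  (* the sum of the first M - 4 terms, as in [omega_lower] *)
  let Sl := nth 0%num sl.2 4 in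
  let Sh := head 0%num sh.2 in
  let th := tail_hi D Sh M in
  let omlo := omN false lo gl (tail_lo (einf D false) Sl M) D2 N0 0%num in
  let omhi := omN true hi gh (fun=> th) D2 N0.+1 0%num in
  let p3 := Enc (N.mul D2 D) (dot (behead lo) (behead gl)) (N.add (dot (behead hi) (behead gh)) th) in
  let W2 := sumN (take N0 hi) in
  let B2 := BData D2 (take N0 lo) (take N0 hi) W2 (rnd true W2 (N.of_nat N0)) 0%num in
  let Bss := bdatas N0 Ds B2 [::] in
  (all (kap_ok N0) (B2 :: [seq head B2 Bs | Bs <- Bss]),
   p3 :: [seq rank_enc N0 D p.1 omlo omhi p.2 | p <- zip Dfs Bss]).

(** The lengths are dictated by the limit for rank 5, which is close to the rounding boundary
2.135e-6. *)
Definition rank_params := rank_data 70 700 (N.pow 2 32) (N.pow 2 24)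
  [:: N.pow 2 26; N.pow 2 28; N.pow 2 30; N.pow 2 32; N.pow 2 34; N.pow 2 34]
  [:: N.pow 2 34; N.pow 2 40; N.pow 2 46; N.pow 2 50; N.pow 2 58; N.pow 2 64].

(** [rtail 2] is 1/2 - 1/e. *)
Definition p2enc : enc :=
  let D := N.pow 2 42 in
  Enc (N.mul 2%num D) (N.sub D (N.mul 2%num (einf D true))) (N.sub D (N.mul 2%num (einf D false))).

Definition rank_checks (d : bool * seq enc) : bool :=
  d.1 && (if d.2 is [:: p3; p4; p5; p6; p7; p8; p9] then
    [&& round_check p2enc p3 124 3, round_check p3 p4 805 5, round_check p4 p5 168 6,
        round_check p5 p6 214 8, round_check p6 p7 188 10, round_check p7 p8 120 12 &
        round_check p8 p9 576 15]
  else false).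

(** * Correctness of the rank enclosures *)

(* The lists are never to be computed by simplification. *)
Arguments solN : simpl never.
Arguments vN : simpl never.
Arguments omN : simpl never.
Arguments spineN : simpl never.
Arguments rnd : simpl never.
Arguments b1list : simpl never.
Arguments einf : simpl never.
Arguments b2sol : simpl never.
Arguments g2list : simpl never.
Arguments tail_hi : simpl never.
Arguments tail_lo : simpl never.

Section FirstLists.
Variable R : realType.
Implicit Types (x y : R).
Notation N2R := (@N2R R).
Notation a_ m := (pr R (prot m)).
Notation b_ m := (pr R (allkids (prot m))).
Notation inve := (@inve R).

Lemma inv_sol0 up D (w : nat -> R) a : w 0%N = 1 -> N2R a = D ->
  inv_sol up D w 0 [:: a] [:: a].
Proof.
move=> w0 aD; split=> //= -[|i]//= _; rewrite ?big_ord1 w0 mulr1 aD; exact: bnd_refl.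
Qed.

(** The sources a_{m+1} and b_m agree except at 0. *)
Lemma appr_source up D l m : appr up D l (b_ m) -> appr up D (0%num :: behead l) (a_ m.+1).
Proof.
move=> H; apply: appr_cons; first by rewrite pr_protS; have [-> _] := b_sol R m; rewrite subrr mulr0; exact: bnd_refl.
by apply: (appr_ext _ (appr_behead H)) => i /=; rewrite pr_protS subr0.
Qed.

Lemma b1list_spec D up : 0 < N2R D -> appr up (N2R D) (b1list D up) (b_ 1) /\ size (b1list D up) = 13%N.
Proof.
move=> D0.
have a1 j : a_ 1 j = (j != 0%N)%:R.
  by rewrite pr_protS b0E; case: j => [|j] /=; rewrite ?subrr ?subr0.
have I := @solN_spec R up (N2R D) (N2R D) D [:: 0%num] D (a_ 1) (b_ 1) (b_sol R 1)
  (fun j => pr_ge0 R _ j) D0 (ltW D0) erefl.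
have [|j|||] := I _ _ 12 0%N 1%num [:: D] [:: D] _ (inv_sol0 up _ erefl).
- by move=> [|i]//= _; rewrite a1 mulr0; exact: bnd_refl.
- by move=> j0; rewrite a1 -lt0n j0 mulr1; exact: bnd_refl.
- by [].
- by have [] := b_sol R 1.
move=> s1 s2 H1 H2; split; last by rewrite size_rev s1.
by apply: (@appr_rev R up (N2R D) (b_ 1) 12 _ _ (And4 s1 s2 H1 H2)).
Qed.

Lemma einf_spec D up : 0 < N2R D -> bnd up (N2R (einf D up)) (N2R D * inve) /\
  forall j, (11 <= j)%N -> bnd up (N2R (einf D up)) (N2R D * b_ 1 j).
Proof.
move=> D0; have [H sz] := b1list_spec up D0.
rewrite /einf; move: (b1list D up) H sz => l H sz.
have h11 : bnd up (N2R (nth 0%num l 11)) (N2R D * b_ 1 11) by apply: H; rewrite sz.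
have h12 : bnd up (N2R (nth 0%num l 12)) (N2R D * b_ 1 12) by apply: H; rewrite sz.
move: (nth _ _ 11) (nth _ _ 12) h11 h12 => x y {H}; case: up => /= h11 h12.
  have hx : N2R x <= N2R (N.max x y) by rewrite ler_nat; lia.
  have hy : N2R y <= N2R (N.max x y) by rewrite ler_nat; lia.
  have r11 : 0 <= b_ 1 11 <= N2R (N.max x y) / N2R D.
    by rewrite pr_ge0 ler_pdivlMr// mulrC (le_trans h11).
  have r12 : 0 <= b_ 1 12 <= N2R (N.max x y) / N2R D.
    by rewrite pr_ge0 ler_pdivlMr// mulrC (le_trans h12).
  split=> [|j j11].
    by have /andP[_] := inve_stay r11 r12; rewrite ler_pdivlMr// mulrC.
  by have /andP[_] := b1_stay r11 r12 j11; rewrite ler_pdivlMr// mulrC.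
have hx : N2R (N.min x y) <= N2R x by rewrite ler_nat; lia.
have hy : N2R (N.min x y) <= N2R y by rewrite ler_nat; lia.
have r11 : N2R (N.min x y) / N2R D <= b_ 1 11 <= 1.
  by rewrite pr_le1 andbT ler_pdivrMr// mulrC (le_trans hx).
have r12 : N2R (N.min x y) / N2R D <= b_ 1 12 <= 1.
  by rewrite pr_le1 andbT ler_pdivrMr// mulrC (le_trans hy).
split=> [|j j11].
  by have /andP[+ _] := inve_stay r11 r12; rewrite ler_pdivrMr// mulrC.
by have /andP[+ _] := b1_stay r11 r12 j11; rewrite ler_pdivrMr// mulrC.
Qed.

Lemma b2sol_spec D D2 up M : 0 < N2R D -> 0 < N2R D2 -> (0 < M)%N ->
  inv_sol up (N2R D2) (b_ 2) M.-1 (b2sol D D2 up M).1 (b2sol D D2 up M).2.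
Proof.
move=> D0 D20 M0; have [H sz] := b1list_spec up D0; have [_ He] := einf_spec up D0.
rewrite /b2sol; move: (b1list D up) (einf D up) H sz He => l e H sz He.
set u := 0%num :: take 11 (behead l).
have su : size u = 12%N by rewrite /u /= size_take size_behead sz.
have Hu : appr up (N2R D) u (a_ 2) by exact: (@appr_take R up _ _ _ 12 (appr_source H)).
rewrite -su.
apply: (@solN_spec R up (N2R D) (N2R D2) e u D (a_ 2) (b_ 2) (b_sol R 2)
  (fun j => pr_ge0 R _ j) D0 (ltW D20) erefl Hu _ M.-1 0%N).
- rewrite su => j j12; rewrite pr_protS; have -> : (j == 0)%N = false by case: j j12.
  by rewrite subr0; apply: He; lia.
- by [].
- by apply: inv_sol0 => //; have [] := b_sol R 2.
Qed.

Lemma g2list_spec D up T : 0 < N2R D ->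
  appr up (N2R D) (g2list D up T) (g2 R) /\ size (g2list D up T) = T.
Proof.
move=> D0; have [He _] := einf_spec up D0; have [He' _] := einf_spec false D0.
rewrite /g2list; move: (einf D up) (einf D false) He He' => e e' He He'.
set TN := N.of_nat T.
set top := if up then rnd true D (N.succ TN) else rnd false e' (N.succ TN).
have Htop : bnd up (N2R top) (N2R D * v_ R T).
  have T0 : 0 < N2R (N.succ TN) by rewrite N2RS N2R_of_nat natr1 ltr0Sn.
  have TE : N2R (N.succ TN) = T.+1%:R by rewrite N2RS N2R_of_nat natr1.
  rewrite /top; case: (up).
    apply: (bnd_trans (y := N2R D / N2R (N.succ TN))); first by apply: bnd_rnd => //=.
    by rewrite /= ler_wpM2l ?(ltW D0)// TE; exact: v_le.
  apply: (bnd_trans (y := N2R D * inve / N2R (N.succ TN))); first exact: bnd_rnd.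
  by rewrite /= -mulrA ler_wpM2l ?(ltW D0)// TE; exact: v_ge.
have [] // := @vN_spec R up (N2R D) e inve (v_ R) (ltW D0) (v_rec R) He T TN [:: top].
  exact: N2R_of_nat.
  by move=> [|i]//= _; rewrite addn0.
move=> sz H; split; last by rewrite size_phiN size_behead sz addn1.
by apply: (appr_ext _ (phiN1_appr (appr_behead H))).
Qed.

End FirstLists.

Section NextList.
Variable R : realType.
Implicit Types (x y : R).
Notation N2R := (@N2R R).
Notation a_ m := (pr R (prot m)).
Notation b_ m := (pr R (allkids (prot m))).

Record bd_ok (N0 m : nat) (B : bdata) : Prop := BdOk {
  bk_den : 0 < N2R (bden B);
  bk_slo : size (blo B) = N0;
  bk_shi : size (bhi B) = N0;
  bk_lo : appr false (N2R (bden B)) (blo B) (b_ m);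
  bk_hi : appr true (N2R (bden B)) (bhi B) (b_ m);
  bk_mass : N2R (bden B) * (\sum_(j < N0) b_ m j) <= N2R (bmass B);
  bk_wtail : forall n, (N0 <= n)%N ->
    N2R (bden B) * (\sum_(N0 <= j < n) b_ m j / j.+1%:R) <= N2R (bwtail B) }.

Definition tail_ok N0 m B := forall n, (N0 <= n)%N ->
  N2R (bden B) * (\sum_(N0 <= j < n) b_ m j) <= N2R (btail B).

Lemma rnd_up a b : 0 < N2R b -> N2R a / N2R b <= N2R (rnd true a b).
Proof. by move=> b0; exact: (@bnd_rnd R true a b (N2R a) b0 (lexx _)). Qed.

Lemma N2R_ofS n : N2R (N.succ (N.of_nat n)) = n.+1%:R.
Proof. by rewrite N2RS N2R_of_nat natr1. Qed.

(** Beyond N0 the factor 1 / (j+1) is at most 1 / (N0+1). *)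
Lemma tail_weight (f : nat -> R) N0 n (T : R) : (forall j, 0 <= f j) -> (N0 <= n)%N ->
  \sum_(N0 <= j < n) f j <= T ->
  \sum_(N0 <= j < n) f j / j.+1%:R <= T / N0.+1%:R.
Proof.
move=> f0 Nn HT; apply: (@le_trans _ _ ((\sum_(N0 <= j < n) f j) / N0.+1%:R)); last first.
  by rewrite ler_wpM2r ?invr_ge0.
rewrite mulr_suml; apply: ler_sum_nat => j /andP[Nj _].
by rewrite ler_wpM2l// lef_pV2 ?posrE ?ltr0n// ler_nat.
Qed.

(** The hypotheses of [mass_sol] in terms of integer numerators over the scales [D] and [Dw]. *)
Lemma next_aux (D Dw U W V X N kap num tau : R) :
  0 < D -> 0 < Dw -> 0 <= tau -> kap < D ->
  U / (N + 1) + X <= kap ->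
  (U * W - V * D) / N + W * X <= num -> num / (D - kap) <= tau ->
  U / D / (N + 1) + X / D <= 1 /\
  (U / D * (W / Dw) - V / Dw) / N + W / Dw * (X / D) <= tau / Dw * (1 - (U / D / (N + 1) + X / D)).
Proof.
move=> D0 Dw0 t0 kD Hk Hn Ht.
have Dk : 0 < D - kap by rewrite subr_gt0.
have E : U / D / (N + 1) + X / D = (U / (N + 1) + X) / D by rewrite mulrDl; congr (_ + _); rewrite mulrAC.
rewrite E; split.
  by rewrite ler_pdivrMr// mul1r (le_trans Hk)// ltW.
have -> : (U / D * (W / Dw) - V / Dw) / N + W / Dw * (X / D) =
   ((U * W - V * D) / N + W * X) / (D * Dw).
  have -> : V / Dw = V * D / (D * Dw) by field; rewrite !lt0r_neq0.
  rewrite [RHS]mulrDl; congr (_ + _); last by rewrite mulf_div [Dw * D]mulrC.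
  by rewrite mulf_div -mulrBl mulrAC.
have H1 : num <= tau * (D - kap) by rewrite -ler_pdivrMr.
have H2 : 1 - (U / (N + 1) + X) / D >= (D - kap) / D.
  by rewrite mulrBl divff ?lt0r_neq0// lerB// ler_wpM2r ?invr_ge0// ltW.
have DD : 0 < D * Dw by rewrite mulr_gt0.
apply: (@le_trans _ _ (tau / Dw * ((D - kap) / D))); last first.
  by rewrite ler_wpM2l// divr_ge0// ltW.
rewrite mulf_div [Dw * D]mulrC ler_wpM2r ?invr_ge0 ?(ltW DD)//.
exact: le_trans Hn H1.
Qed.

Lemma sum_b_ge1 m N0 : (0 < N0)%N -> \sum_(j < N0) a_ m.+1 j = \sum_(j < N0) b_ m j - 1.
Proof.
case: N0 => // n _; have := @sum_a R (fun=> 1) m n.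
by under eq_bigr do rewrite mulr1; under [X in _ = X - _ -> _]eq_bigr do rewrite mulr1.
Qed.

Lemma next_b_ok N0 m B Dw : (0 < N0)%N -> 0 < N2R Dw -> bd_ok N0 m B -> kap_ok N0 B ->
  bd_ok N0 m.+1 (next_b N0 B Dw) /\ tail_ok N0 m.+1 (next_b N0 B Dw).
Proof.
move=> N00 Dw0 [D0 slo shi Hlo Hhi Hmass HX] /(@N2R_lt R) Hkap.
rewrite /next_b.
set D := bden B in D0 Hlo Hhi Hmass HX Hkap *.
have su l : size l = N0 -> size (0%num :: behead l) = N0 by move=> sl; rewrite /= size_behead sl prednK.
have a0 n : 0 <= a_ m.+1 n := pr_ge0 R _ n.
have b0 n : 0 <= b_ m.+1 n := pr_ge0 R _ n.
have [w0 _] := b_sol R m.+1.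
have Ilo := @solN_spec R false (N2R D) (N2R Dw) 0%num _ D (a_ m.+1) (b_ m.+1) (b_sol R m.+1)
  a0 D0 (ltW Dw0) erefl (appr_source Hlo) (fun j _ => mulr_ge0 (ltW D0) (a0 j))
  N0.-1 0%N 1%num _ _ erefl (inv_sol0 false w0 erefl).
have Hhi1 j : (size (0%num :: behead (bhi B)) <= j)%N -> bnd true (N2R D) (N2R D * a_ m.+1 j).
  by move=> _; rewrite /= ler_piMr ?(ltW D0)// pr_le1.
have Ihi := @solN_spec R true (N2R D) (N2R Dw) D _ D (a_ m.+1) (b_ m.+1) (b_sol R m.+1)
  a0 D0 (ltW Dw0) erefl (appr_source Hhi) Hhi1
  N0.-1 0%N 1%num _ _ erefl (inv_sol0 true w0 erefl).
rewrite (su _ slo) in Ilo; rewrite (su _ shi) in Ihi.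
move: Ilo Ihi; move: (solN false _ _ _ _ _ _ _ _) (solN true _ _ _ _ _ _ _ _) => sl sh.
rewrite add0n => Ilo Ihi.
have szlo : size (rev sl.1) = N0 by rewrite size_rev; case: Ilo => -> *; rewrite prednK.
have szhi : size (rev sh.1) = N0 by rewrite size_rev; case: Ihi => -> *; rewrite prednK.
have Alo := appr_rev Ilo; have Ahi := appr_rev Ihi.
set lo := rev sl.1 in szlo Alo *; set hi := rev sh.1 in szhi Ahi *.
have HW : N2R Dw * (\sum_(j < N0) b_ m.+1 j) <= N2R (head 0%num sh.2).
  case: Ihi => _ srs _ /(_ 0%N isT); rewrite subn0 prednK// nth0; exact.
set W := head 0%num sh.2 in HW *.
set V := dot lo _.
have HV : N2R V <= N2R Dw * \sum_(j < N0) j%:R * b_ m.+1 j.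
  have Ai : appr false 1 (map N.of_nat (iota 0 N0)) (fun i => i%:R : R).
    move=> i; rewrite size_map size_iota => iN.
    by rewrite (nth_map 0%N) ?size_iota// nth_iota// add0n N2R_of_nat mul1r; exact: bnd_refl.
  have := dot_bnd (ltW Dw0) ler01 b0 (fun i => ler0n R i) Alo Ai.
  rewrite szlo size_map size_iota minnn mulr1 -/V => H; apply: (le_trans H).
  by rewrite ler_wpM2l ?(ltW Dw0)//; apply: ler_sum => i _; rewrite mulrC.
set U := N.sub (bmass B) D.
have HU : N2R D * (\sum_(j < N0) a_ m.+1 j) <= N2R U.
  rewrite sum_b_ge1// mulrBr mulr1; apply: le_trans (N2RB _ _ _).
  by rewrite lerB.
set X := bwtail B in HX *.
have Npos : 0 < N2R (N.of_nat N0) by rewrite N2R_of_nat ltr0n.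
set NN := N.of_nat N0 in Npos *.
set kap := N.add (rnd true U (N.succ NN)) X in Hkap *.
set num := N.add _ (N.mul W X).
set tau := rnd true num (N.sub D kap).
have NE : N2R NN = N0%:R by rewrite N2R_of_nat.
have kapE : N2R (N.sub D kap) = N2R D - N2R kap.
  by move: Hkap; rewrite ltr_nat /N2R => H; rewrite -natrB; [congr _%:R; lia|lia].
have Dk : 0 < N2R D - N2R kap by rewrite subr_gt0.
have [k1 Htau] : N2R U / N2R D / (N0%:R + 1) + N2R X / N2R D <= 1 /\
  (N2R U / N2R D * (N2R W / N2R Dw) - N2R V / N2R Dw) / N0%:R + N2R W / N2R Dw * (N2R X / N2R D)
    <= N2R tau / N2R Dw * (1 - (N2R U / N2R D / (N0%:R + 1) + N2R X / N2R D)).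
  apply: (@next_aux _ _ _ _ _ _ _ (N2R kap) (N2R num)) => //.
  - rewrite /kap N2RD lerD2r -NE -N2RS; apply: rnd_up.
    by rewrite N2RS NE natr1 ltr0Sn.
  - rewrite /num N2RD N2RM lerD2r -NE; apply: (@le_trans _ _ (N2R (N.sub (N.mul U W) (N.mul V D)) / N2R NN)).
      by rewrite ler_wpM2r ?invr_ge0 ?(ltW Npos)// -!N2RM N2RB.
    exact: rnd_up.
  - by rewrite -kapE; apply: rnd_up; rewrite kapE.
have HT : tail_ok N0 m.+1 (BData Dw lo hi W (rnd true tau (N.succ NN)) tau).
  move=> n Nn /=; rewrite mulrC -ler_pdivlMr//.
  apply: (@mass_sol R (a_ m.+1) (b_ m.+1) N0 (N2R U / N2R D) (N2R W / N2R Dw) (N2R V / N2R Dw)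
    (N2R X / N2R D)) => //.
  - exact: b_sol.
  - move=> k Nk; rewrite ler_pdivlMr// mulrC; apply: le_trans (HX k Nk).
    rewrite ler_wpM2l ?(ltW D0)//; apply: ler_sum_nat => j /andP[Nj _].
    by rewrite ler_wpM2r ?invr_ge0// pr_protS lerBlDr lerDl.
  - by rewrite ler_pdivlMr// mulrC.
  - by rewrite ler_pdivlMr// mulrC.
  - by rewrite ler_pdivrMr// mulrC.
  - by rewrite divr_ge0 ?N2R_ge0.
  - by rewrite natS.
  - by rewrite natS.
split=> //; split=> //= n Nn.
have := @tail_weight (b_ m.+1) N0 n (N2R tau / N2R Dw) b0 Nn.
rewrite ler_pdivlMr// mulrC => /(_ (HT n Nn)) H.
apply: le_trans (rnd_up _ _); last by rewrite N2RS NE natr1 ltr0Sn.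
rewrite N2RS NE natr1; apply: (@le_trans _ _ (N2R Dw * (N2R tau / N2R Dw / N0.+1%:R))).
  by rewrite ler_wpM2l// ltW.
by rewrite mulrA mulrCA mulfV ?mulr1// lt0r_neq0.
Qed.

End NextList.

Section Chains.
Variable R : realType.
Notation N2R := (@N2R R).
Notation a_ m := (pr R (prot m)).
Notation b_ m := (pr R (allkids (prot m))).
Notation omega := (@omega R).

Record f_ok (N0 : nat) (Df : N) (f : nat -> R) (F : fdata) : Prop := FOk {
  fk_slo : size (flo F) = N0;
  fk_shi : size (fhi F) = N0;
  fk_lo : appr false (N2R Df) (flo F) f;
  fk_hi : appr true (N2R Df) (fhi F) f;
  fk_tail : forall n, (N0 <= n)%N -> N2R Df * (\sum_(N0 <= j < n) f j) <= N2R (ftail F) }.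

Lemma ubs_tail (f : nat -> R) N0 (T1 T2 : R) : (forall j, 0 <= f j) ->
  \sum_(j < N0) f j <= T1 -> (forall n, (N0 <= n)%N -> \sum_(N0 <= j < n) f j <= T2) ->
  ubs f (T1 + T2).
Proof.
move=> f0 H1 H2 n; apply: (@le_trans _ _ (\sum_(j < N0 + n) f j)).
  by apply: sum_nneg_le => //; exact: leq_addl.
by rewrite (@sum_split R f N0) ?leq_addr// lerD// H2// leq_addr.
Qed.

Lemma appr_scale up (D : N) (Df : N) l (f : nat -> R) : 0 < N2R D -> 0 <= N2R Df ->
  appr up (N2R D) l f -> appr up (N2R Df) [seq rnd up (N.mul x Df) D | x <- l] f.
Proof.
move=> D0 Df0 H i; rewrite size_map => il; rewrite (nth_map 0%num)//.
have -> : N2R Df * f i = (N2R D * f i * N2R Df) / N2R D by field; rewrite lt0r_neq0.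
apply: bnd_rnd => //; rewrite N2RM [_ * N2R Df]mulrC [_ * N2R Df]mulrC.
by apply: bnd_wM => //; exact: H.
Qed.

Lemma f_init_ok N0 m Df B : (0 < N0)%N -> bd_ok R N0 m B -> tail_ok R N0 m B ->
  f_ok N0 Df (echain R 0 m.+1) (f_init Df B).
Proof.
move=> N00 [D0 slo shi Hlo Hhi _ _] HT.
have -> : echain R 0 m.+1 = a_ m.+1 by apply/funext => n; rewrite echain0.
have A up l : appr up (N2R (bden B)) l (b_ m) ->
    appr up (N2R Df) (0%num :: [seq rnd up (N.mul x Df) (bden B) | x <- behead l]) (a_ m.+1).
  move=> H; apply: appr_cons.
    by rewrite pr_protS; have [-> _] := b_sol R m; rewrite subrr mulr0; exact: bnd_refl.
  apply: appr_scale => //.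
  by apply: (appr_ext _ (appr_behead H)) => i /=; rewrite pr_protS subr0.
split=> /=; rewrite ?size_map ?size_behead ?slo ?shi ?prednK//; [exact: A|exact: A|].
move=> n Nn; apply: le_trans (rnd_up _ D0); rewrite N2RM.
have -> : \sum_(N0 <= j < n) a_ m.+1 j = \sum_(N0 <= j < n) b_ m j.
  by apply: eq_big_nat => j /andP[Nj _]; rewrite pr_protS; case: j Nj => [|j]; rewrite ?subr0//; lia.
rewrite ler_pdivlMr// mulrC mulrCA [leRHS]mulrC ler_wpM2l ?N2R_ge0//.
exact: HT.
Qed.

Lemma f_step_ok N0 i r Df B F : (0 < N0)%N -> 0 < N2R Df -> bd_ok R N0 r B -> tail_ok R N0 r B ->
  f_ok N0 Df (echain R i r.+2) F -> f_ok N0 Df (echain R i.+1 r.+1) (f_step N0 B F).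
Proof.
move=> N00 Df0 [D0 bslo bshi Blo Bhi Bm _] BT [slo shi Flo Fhi FT].
set f := echain R i r.+2 in Flo Fhi FT.
pose phi j := f j / j.+1%:R.
have f0 j : 0 <= f j := echain_ge0 R _ _ _.
have phi0 j : 0 <= phi j by rewrite divr_ge0.
have b0 j : 0 <= b_ r j := pr_ge0 R _ _.
have FS n : echain R i.+1 r.+1 n.+1 = cv phi (b_ r) n := echainS R i r n.
have Plo := phiN1_appr Flo; have Phi := phiN1_appr Fhi.
set pl := phiN false _ _ in Plo; set ph := phiN true _ _ in Phi.
have spl : size pl = N0 by rewrite size_phiN.
have sph : size ph = N0 by rewrite size_phiN.
have stl l : size l = N0 -> size (take N0.-1 l) = N0.-1.
  by move=> sl; rewrite size_takel// sl leq_pred.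
have A up p l : size p = N0 -> size l = N0 -> appr up (N2R Df) p phi ->
   appr up (N2R (bden B)) l (b_ r) ->
   appr up (N2R Df) (0%num :: spineN up p (take N0.-1 l) [::] (bden B)) (echain R i.+1 r.+1).
  move=> sp sl Hp Hl; apply: appr_cons; first by rewrite mulr0; exact: bnd_refl.
  move=> k; rewrite size_spineN => kl /=; rewrite FS.
  apply: (@spineN_spec R up (N2R Df) (N2R (bden B)) p _ (bden B) phi (b_ r) (ltW Df0) D0 phi0 b0
     erefl Hp 0%N [::]) => //; first by rewrite stl// sp add0n leq_pred.
  by move=> j; rewrite add0n; exact: (@appr_take R up _ _ _ N0.-1 Hl).
have Alo := A _ _ _ spl bslo Plo Blo; have Ahi := A _ _ _ sph bshi Phi Bhi.
rewrite /f_step -/pl -/ph.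
set lo := 0%num :: _ in Alo *; set hi := 0%num :: _ in Ahi *.
have szlo : size lo = N0 by rewrite /lo /= size_spineN stl// prednK.
have szhi : size hi = N0 by rewrite /hi /= size_spineN stl// prednK.
split=> //= n Nn.
set PhiN := N.add _ _; set BN := N.add _ _.
have uphi : ubs phi (N2R PhiN / N2R Df).
  rewrite /PhiN N2RD mulrDl; apply: (@ubs_tail phi N0) => // [|k Nk].
    by rewrite ler_pdivlMr// mulrC -sph; exact: (@sumN_bnd R true _ _ _ Phi).
  have FT' : \sum_(N0 <= j < k) f j <= N2R (ftail F) / N2R Df by rewrite ler_pdivlMr// mulrC FT.
  apply: (le_trans (tail_weight f0 Nk FT')); rewrite mulrAC ler_wpM2r ?invr_ge0 ?(ltW Df0)//.
  by rewrite -N2R_ofS; apply: rnd_up; rewrite N2R_ofS ltr0Sn.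
have ub : ubs (b_ r) (N2R BN / N2R (bden B)).
  rewrite /BN N2RD mulrDl; apply: (@ubs_tail (b_ r) N0) => // [|k Nk]; rewrite ler_pdivlMr// mulrC//.
  exact: BT.
have Phi0 : 0 <= N2R PhiN / N2R Df by rewrite divr_ge0 ?N2R_ge0.
have H := @mass_conv R phi (b_ r) (echain R i.+1 r.+1) _ _ phi0 b0 Phi0 (echainS0 R i r.+1) FS uphi ub n.
rewrite (@sum_split R _ N0)// in H.
apply: le_trans (N2RB _ _ _); rewrite lerBrDr.
apply: (@le_trans _ _ (N2R Df * (\sum_(N0 <= j < n) echain R i.+1 r.+1 j)
  + N2R Df * \sum_(j < N0) echain R i.+1 r.+1 j)).
  by rewrite lerD2l; have := @sumN_bnd R false _ _ _ Alo; rewrite szlo.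
rewrite -mulrDr addrC; apply: le_trans (rnd_up _ D0); rewrite N2RM.
apply: (@le_trans _ _ (N2R Df * (N2R PhiN / N2R Df * (N2R BN / N2R (bden B))))).
  by rewrite ler_wpM2l ?(ltW Df0)// addrC.
by rewrite mulrA mulrA [N2R Df * _]mulrCA mulfV ?lt0r_neq0// mulr1.
Qed.

Fixpoint bds_ok N0 m (l : seq bdata) : Prop :=
  if l is B :: l' then
    [/\ m = (size l' + 3)%N, bd_ok R N0 m B, tail_ok R N0 m B & bds_ok N0 m.-1 l']
  else m = 2%N.

Lemma f_run_ok N0 i m Df l F : (0 < N0)%N -> 0 < N2R Df -> bds_ok N0 m l ->
  f_ok N0 Df (echain R i m.+2) F -> f_ok N0 Df (echain R (i + size l)%N 4) (f_run N0 l F).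
Proof.
move=> N00 Df0; elim: l i m F => [|B l IH] i m F; first by move=> /= ->; rewrite addn0.
rewrite [size _]/= [f_run _ _ _]/=.
move=> [mE Bok Tok lok] Fok; rewrite addnS -addSn; apply: (IH _ m.-1) => //.
have -> : m.-1.+2 = m.+1 by rewrite mE; lia.
exact: f_step_ok.
Qed.

Lemma rank_enc_ok N0 (D Df : N) omlo omhi m Bs : (0 < N0)%N -> 0 < N2R D -> 0 < N2R Df ->
  size omlo = N0 -> size omhi = N0.+1 ->
  appr false (N2R D) omlo omega -> appr true (N2R D) omhi omega ->
  Bs <> [::] -> bds_ok N0 m Bs ->
  encl (rtail R m.+1) (rank_enc N0 D Df omlo omhi Bs).
Proof.
move=> N00 D0 Df0 sol soh Hol Hoh; case: Bs => // B Bs _ [mE Bok Tok lok].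
have Fok := f_run_ok N00 Df0 lok (i := 0) (F := f_init Df B).
have -> : m.+1 = (size Bs).+4 by rewrite mE; lia.
have {}Fok : f_ok N0 Df (echain R (size Bs) 4) (f_run N0 Bs (f_init Df B)).
  apply: Fok; have -> : m.-1.+2 = m.+1 by rewrite mE; lia.
  exact: f_init_ok Bok Tok.
rewrite /rank_enc; set F := f_run _ _ _ in Fok *.
case: Fok => slo shi Flo Fhi FT.
set f := echain R (size Bs) 4 in Flo Fhi FT *.
have f0 j : 0 <= f j := echain_ge0 R _ _ _.
pose phi j := f j / j.+1%:R.
have phi0 j : 0 <= phi j by rewrite divr_ge0.
have om0 j : 0 <= omega j := omega_ge0 R j.
have Plo := phiN1_appr Flo; have Phi := phiN1_appr Fhi.
split=> /=; rewrite N2RM.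
  have := dot_bnd (ltW Df0) (ltW D0) phi0 om0 Plo Hol.
  rewrite size_phiN slo sol minnn => H; apply: (le_trans H).
  rewrite ler_wpM2l ?mulr_ge0 ?N2R_ge0//.
  exact: (proj1 (rtail4_ubs (size Bs) (rtail R (size Bs).+4)) (lexx _) N0).
have DD : 0 < N2R Df * N2R D by rewrite mulr_gt0.
rewrite mulrC -ler_pdivlMr//; apply: (proj2 (rtail4_ubs _ _)).
rewrite N2RD N2RM mulrDl; apply: (@ubs_tail (fun j => phi j * omega j) N0) => [j||n Nn].
- by rewrite mulr_ge0.
- rewrite ler_pdivlMr// mulrC.
  have := dot_bnd (ltW Df0) (ltW D0) phi0 om0 Phi Hoh.
  by rewrite size_phiN shi soh (minn_idPl _).
have FT' : \sum_(N0 <= j < n) f j <= N2R (ftail F) / N2R Df by rewrite ler_pdivlMr// mulrC FT.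
have Hw := tail_weight f0 Nn FT'.
apply: (@le_trans _ _ ((\sum_(N0 <= j < n) f j / j.+1%:R) * omega N0)).
  rewrite mulr_suml; apply: ler_sum_nat => j /andP[Nj _].
  by rewrite ler_wpM2l ?divr_ge0// omega_noninc.
rewrite ler_pdivlMr//.
have H1 : N2R Df * (\sum_(N0 <= j < n) f j / j.+1%:R) <= N2R (rnd true (ftail F) (N.succ (N.of_nat N0))).
  apply: (@le_trans _ _ (N2R (ftail F) / N0.+1%:R)).
    apply: (@le_trans _ _ (N2R Df * (N2R (ftail F) / N2R Df / N0.+1%:R))).
      by rewrite ler_wpM2l ?(ltW Df0).
    by rewrite mulrA [N2R Df * _]mulrC divfK// lt0r_neq0.
  by rewrite -N2R_ofS; apply: rnd_up; rewrite N2R_ofS ltr0Sn.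
have H2 : N2R D * omega N0 <= N2R (nth 0%num omhi N0) by apply: Hoh; rewrite soh.
rewrite mulrC mulrACA; apply: ler_pM => //.
  by rewrite mulr_ge0 ?N2R_ge0// sumr_ge0// => j _; rewrite divr_ge0.
by rewrite mulr_ge0 ?N2R_ge0.
Qed.

Lemma bdatas_ok B0 N0 Ds B m acc : (0 < N0)%N -> bd_ok R N0 m B ->
  (acc = [::] -> m = 2%N) -> bds_ok N0 m acc -> all (fun D => N.ltb 0%num D) Ds ->
  all (kap_ok N0) (B :: [seq head B0 Bs | Bs <- bdatas N0 Ds B acc]) ->
  forall k, (k < size Ds)%N ->
    nth [::] (bdatas N0 Ds B acc) k <> [::] /\
    bds_ok N0 (m + k).+1 (nth [::] (bdatas N0 Ds B acc) k).
Proof.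
move=> N00; elim: Ds B m acc => [//|D Ds IH] B m acc Bok acc0 accok /= /andP[D0 Ds0] /andP[kB].
set B' := next_b N0 B D; move=> /andP[kB' kl] k.
have Dp : 0 < N2R D by have := N2R_lt R D0.
have [B'ok T'ok] := next_b_ok N00 Dp Bok kB.
have ok' : bds_ok N0 m.+1 (B' :: acc).
  split=> //; case: (acc) accok => [->//|B2 l] /= [-> _ _ _]; lia.
case: k => [|k] /=; first by rewrite addn0.
rewrite ltnS => kD; rewrite addnS -addSn; apply: (IH B' m.+1 (B' :: acc)) => //=.
by rewrite kB'.
Qed.

End Chains.

Section RankData.
Variable R : realType.
Notation N2R := (@N2R R).
Notation b_ m := (pr R (allkids (prot m))).
Notation inve := (@inve R).
Notation omega := (@omega R).
Notation g2 := (@g2 R).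

Lemma tail_lo_spec D D2 e S M j jN : (5 <= M)%N ->
  N2R e <= D * inve -> N2R S <= D2 * \sum_(i < M - 4) b_ 2 i -> N2R jN = j%:R ->
  N2R (tail_lo e S M jN) <= D2 * D *
   ((11 / 30 * \sum_(i < M - 4) b_ 2 i) * inve / (2 * (j + M).+1%:R * (j + M).+2%:R)).
Proof.
move=> M5 He HS jE; set T := \sum_(i < _) _ in HS *.
set den := N.mul 60%num (N.mul (N.succ (N.add jN (N.of_nat M))) (N.succ (N.succ (N.add jN (N.of_nat M))))).
have denE : N2R den = 60 * ((j + M).+1%:R * (j + M).+2%:R).
  by rewrite /den !(N2RM, N2RS, N2RD) N2R_of_nat jE -!natrD !natr1.
have den0 : 0 < N2R den by rewrite denE !mulr_gt0// ltr0Sn.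
have H := @bnd_rnd R false (N.mul (N.mul 11%num S) e) den (11 * (D2 * T) * (D * inve)) den0.
have -> : D2 * D * (11 / 30 * T * inve / (2 * (j + M).+1%:R * (j + M).+2%:R)) = 11 * (D2 * T) * (D * inve) / N2R den.
  rewrite denE; set p := (j + M).+1%:R; set q := (j + M).+2%:R.
  have p0 : p != 0 by rewrite pnatr_eq0.
  have q0 : q != 0 by rewrite pnatr_eq0.
  clearbody p q; field; by rewrite p0 q0.
apply: H; rewrite /bnd !N2RM; apply: ler_pM; rewrite ?mulr_ge0 ?N2R_ge0//.
by rewrite ler_wpM2l// N2R_ge0.
Qed.

Lemma tail_hi_spec D D2 S M : (0 < M)%N -> 0 <= D2 -> N2R D * (D2 * \sum_(l < M) b_ 2 l) <= N2R D * N2R S ->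
  D2 * N2R D * ((3 / 8 + M.+1%:R^-1) * ((\sum_(l < M) b_ 2 l) / (3 * M%:R * M.+1%:R))) <= N2R (tail_hi D S M).
Proof.
move=> M0 D20; set T := \sum_(l < M) _ => HS.
rewrite /tail_hi; set den := N.mul _ (N.mul _ _); set num := N.mul _ (N.add _ _).
have denE : N2R den = 8 * M.+1%:R * (3 * M%:R * M.+1%:R).
  by rewrite /den !(N2RM, N2RS) N2R_of_nat natr1.
have M1 : 0 < M%:R :> R by rewrite ltr0n.
have M2 : 0 < M.+1%:R :> R by rewrite ltr0n.
have den0 : 0 < N2R den by rewrite denE !mulr_gt0.
apply: le_trans (rnd_up _ den0).
have numE : N2R num = N2R S * N2R D * (3 * M.+1%:R + 8).
  by rewrite /num !(N2RM, N2RD, N2RS) N2R_of_nat natr1.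
rewrite numE denE.
have -> : D2 * N2R D * ((3 / 8 + M.+1%:R^-1) * (T / (3 * M%:R * M.+1%:R))) =
   (N2R D * (D2 * T)) * (3 * M.+1%:R + 8) / (8 * M.+1%:R * (3 * M%:R * M.+1%:R)).
  have m1 : M%:R != 0 :> R by rewrite lt0r_neq0.
  have m2 : M.+1%:R != 0 :> R by rewrite lt0r_neq0.
  move: (M.+1%:R) (M%:R) m1 m2 => p q m1 m2; field; by rewrite m1 m2.
rewrite ler_wpM2r ?invr_ge0 -?denE ?(ltW den0)// ler_wpM2r ?addr_ge0 ?mulr_ge0//.
by rewrite [leRHS]mulrC.
Qed.

Lemma nth_rs up D n rw rs (w : nat -> R) i : inv_sol up D w n rw rs -> (i <= n)%N ->
  bnd up (N2R (nth 0%num rs i)) (D * \sum_(k < (n - i).+1) w k).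
Proof. by case=> _ _ _; apply. Qed.

Lemma rank3_enc D D2 lo hi gl gh th M : (0 < M)%N -> 0 < N2R D -> 0 < N2R D2 ->
  appr false (N2R D2) lo (b_ 2) -> appr true (N2R D2) hi (b_ 2) ->
  appr false (N2R D) gl g2 -> appr true (N2R D) gh g2 ->
  size hi = M -> (M <= size gh)%N ->
  N2R D2 * N2R D * ((3 / 8 + M.+1%:R^-1) * ((\sum_(l < M) b_ 2 l) / (3 * M%:R * M.+1%:R))) <= N2R th ->
  encl (rtail R 3) (Enc (N.mul D2 D) (dot (behead lo) (behead gl)) (N.add (dot (behead hi) (behead gh)) th)).
Proof.
move=> M0 D0 D20 Hlo Hhi Hgl Hgh shi sgh Hth.
have g0 n : 0 <= g2 n := g2_ge0 R n.
have b0 n : 0 <= b_ 2 n := pr_ge0 R _ n.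
have aE n : echain R 0 3 n * g2 n = (if n is n'.+1 then b_ 2 n'.+1 * g2 n'.+1 else 0).
  rewrite echain0 pr_protS; case: n => [|n]; last by rewrite subr0.
  by have [-> _] := b_sol R 2; rewrite subrr mul0r.
have sumE n : \sum_(j < n.+1) echain R 0 3 j * g2 j = \sum_(j < n) b_ 2 j.+1 * g2 j.+1.
  by rewrite big_ord_recl aE add0r; apply: eq_bigr => j _; rewrite aE.
split=> /=; rewrite N2RM.
  have := dot_bnd (ltW D20) (ltW D0) (fun i => b0 i.+1) (fun i => g0 i.+1) (appr_behead Hlo) (appr_behead Hgl).
  move=> H; apply: (le_trans H); rewrite ler_wpM2l ?mulr_ge0 ?N2R_ge0// -sumE.
  exact: (proj1 (rtail3_ubs 0 (rtail R 3)) (lexx _)).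
have DD : 0 < N2R D2 * N2R D by rewrite mulr_gt0.
rewrite mulrC -ler_pdivlMr//; apply: (proj2 (rtail3_ubs _ _)).
rewrite N2RD mulrDl; apply: (@ubs_tail R (fun n => echain R 0 3 n * g2 n) M) => [j||n Mn].
- by rewrite mulr_ge0 ?echain_ge0.
- rewrite ler_pdivlMr// mulrC; case: M M0 shi sgh {Hth} => // M _ shi sgh; rewrite sumE.
  have := dot_bnd (ltW D20) (ltW D0) (fun i => b0 i.+1) (fun i => g0 i.+1) (appr_behead Hhi) (appr_behead Hgh).
  rewrite !size_behead shi /= (minn_idPl _)//; lia.
rewrite ler_pdivlMr// mulrC; apply: le_trans Hth; rewrite ler_wpM2l ?(ltW DD)//.
apply: (le_trans _ (@b2_g2_tail R 0 M n M0 Mn)).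
by apply: ler_sum_nat => -[|j] /andP[Mj _]; rewrite aE add0n; [rewrite mulr_ge0|].
Qed.

Definition ranks_ok (l : seq enc) := forall k, (k < size l)%N ->
  encl (rtail R (k + 3)) (nth (Enc 0%num 0%num 0%num) l k).

Lemma size_bdatas N0 Ds B acc : size (bdatas N0 Ds B acc) = size Ds.
Proof. by elim: Ds B acc => //= D Ds IH B acc; rewrite IH. Qed.

Lemma rank_data_ok N0 M D D2 Ds Dfs : (0 < N0)%N -> (5 <= M)%N -> (N0 <= M)%N ->
  N.ltb 0%num D -> N.ltb 0%num D2 -> size Ds = size Dfs ->
  all (fun D => N.ltb 0%num D) Ds -> all (fun D => N.ltb 0%num D) Dfs ->
  (rank_data N0 M D D2 Ds Dfs).1 -> ranks_ok (rank_data N0 M D D2 Ds Dfs).2.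
Proof.
move=> N00 M5 NM /(@N2R_lt R) D0 /(@N2R_lt R) D20 sD Ds0 Dfs0.
have M0 : (0 < M)%N by lia.
have Ilo := b2sol_spec false D0 D20 M0; have Ihi := b2sol_spec true D0 D20 M0.
have [Glo sgl] := g2list_spec false (N0 + M + 8) D0.
have [Ghi sgh] := g2list_spec true (N0 + M + 8) D0.
have [He _] := einf_spec false D0.
rewrite /rank_data.
move: (b2sol D D2 false M) (b2sol D D2 true M) (g2list D false _) (g2list D true _) (einf D false)
  Ilo Ihi Glo sgl Ghi sgh He => sl sh gl gh e Ilo Ihi Glo sgl Ghi sgh He.
have Alo := appr_rev Ilo; have Ahi := appr_rev Ihi.
have slo : size (rev sl.1) = M by rewrite size_rev; case: Ilo => -> *; rewrite prednK.
have shi : size (rev sh.1) = M by rewrite size_rev; case: Ihi => -> *; rewrite prednK.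
have HSl : N2R (nth 0%num sl.2 4) <= N2R D2 * \sum_(i < M - 4) b_ 2 i.
  have := nth_rs Ilo (i := 4); have -> : ((M.-1 - 4).+1 = M - 4)%N by lia.
  by apply; lia.
have HSh : N2R D2 * (\sum_(i < M) b_ 2 i) <= N2R (head 0%num sh.2).
  by have := nth_rs Ihi (i := 0) isT; rewrite subn0 prednK// nth0.
move: (rev sl.1) (rev sh.1) (nth 0%num sl.2 4) (head 0%num sh.2) Alo Ahi slo shi HSl HSh
  => lo hi Sl Sh Alo Ahi slo shi HSl HSh {Ilo Ihi sl sh}.
have HSh' : N2R D * (N2R D2 * \sum_(l < M) b_ 2 l) <= N2R D * N2R Sh by rewrite ler_wpM2l ?N2R_ge0.
have Hth := tail_hi_spec M0 (ltW D20) HSh'.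
set th := tail_hi D Sh M in Hth *.
have b0 n : 0 <= b_ 2 n := pr_ge0 R _ n.
have [szol Aol] := @omN_spec R false (N2R D2) (N2R D) lo (b_ 2) g2 (tail_lo e Sl M)
  (fun j => (11 / 30 * \sum_(i < M - 4) b_ 2 i) * inve / (2 * (j + M).+1%:R * (j + M).+2%:R))
  D2 D20 (ltW D0) b0 (@g2_ge0 R) erefl Alo (fun j jN jE => tail_lo_spec M5 He HSl jE)
  N0 gl 0%N 0%num erefl Glo ltac:(rewrite slo sgl; lia).
have {}Aol : appr false (N2R D) (omN false lo gl (tail_lo e Sl M) D2 N0 0%num) omega.
  move=> i il; apply: (bnd_trans (Aol i il)); rewrite /bnd ler_wpM2l ?(ltW D0)// slo.
  under eq_bigr do rewrite add0n.
  apply: omega_lower => //; rewrite mulr_ge0 ?sumr_ge0//.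
have [szoh Aoh] := @omN_spec R true (N2R D2) (N2R D) hi (b_ 2) g2 (fun=> th)
  (fun=> (3 / 8 + M.+1%:R^-1) * ((\sum_(l < M) b_ 2 l) / (3 * M%:R * M.+1%:R)))
  D2 D20 (ltW D0) b0 (@g2_ge0 R) erefl Ahi (fun j jN jE => Hth)
  N0.+1 gh 0%N 0%num erefl Ghi ltac:(rewrite shi sgh; lia).
have {}Aoh : appr true (N2R D) (omN true hi gh (fun=> th) D2 N0.+1 0%num) omega.
  move=> i il; apply: (bnd_trans (Aoh i il)); rewrite /bnd ler_wpM2l ?(ltW D0)// shi.
  under eq_bigr do rewrite add0n.
  exact: omega_upper.
move: (omN false _ _ _ _ _ _) (omN true _ _ _ _ _ _) szol Aol szoh Aoh => omlo omhi szol Aol szoh Aoh.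
have N0p : 0 < N2R (N.of_nat N0) by rewrite N2R_of_nat ltr0n.
set B2 := BData _ _ _ _ _ _.
have mass2 : N2R D2 * (\sum_(j < N0) b_ 2 j) <= N2R (sumN (take N0 hi)).
  have := @sumN_bnd R true _ _ _ (@appr_take R true _ _ _ N0 Ahi).
  by rewrite size_takel// shi.
have B2ok : bd_ok R N0 2 B2.
  split=> //=; rewrite ?size_takel ?slo ?shi//; try exact: appr_take.
  move=> n Nn; apply: le_trans (rnd_up _ N0p).
  apply: (@le_trans _ _ (N2R D2 * ((\sum_(j < N0) b_ 2 j) / N0%:R))).
    by rewrite ler_wpM2l ?(ltW D20)// b2_Xtail.
  by rewrite mulrA N2R_of_nat ler_wpM2r ?invr_ge0.
have sgM : (M <= size gh)%N by rewrite sgh -addnA addnCA leq_addr.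
have p3ok := @rank3_enc D D2 lo hi gl gh th M M0 D0 D20 Alo Ahi Glo Ghi shi sgM Hth.
have bok := @bdatas_ok R B2 N0 Ds B2 2 [::] N00 B2ok (fun=> erefl) erefl Ds0.
rewrite [fst _]/= [snd _]/=.
clearbody th B2; clear Hth Alo Ahi Glo Ghi slo shi HSl HSh HSh' mass2 sgl sgh B2ok He.
move=> kap [|k]; first by move=> _; exact: p3ok.
rewrite [size _]/= ltnS size_map size_zip size_bdatas sD minnn => kD.
rewrite addSnnS [nth _ _ _]/= (nth_map (0%num, [::])); last by rewrite size_zip size_bdatas sD minnn.
rewrite nth_zip ?size_bdatas//=.
have kD' : (k < size Ds)%N by rewrite sD.
have [ne ok] := bok kap k kD'.
have -> : (k + 4 = (2 + k).+1.+1)%N by lia.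
apply: rank_enc_ok => //.
by have /allP/(_ _ (mem_nth 0%num kD)) /(@N2R_lt R) := Dfs0.
Qed.

Lemma rtail2_enc : encl (rtail R 2) p2enc.
Proof.
have D0 : 0 < N2R (N.pow 2 42) by apply: (@N2R_lt R 0%num).
have [Hl _] := einf_spec false D0; have [Hh _] := einf_spec true D0.
rewrite rtail2 /p2enc.
move: (N.pow 2 42) (einf _ false) (einf _ true) D0 Hl Hh => D el eh D0 Hl Hh.
have eb := inve_bounds R.
have H2 : N2R (N.mul 2%num D) * (1 / 2 - inve) = N2R D - 2 * (N2R D * inve).
  have aux (d e : R) : 2 * d * (1 / 2 - e) = d - 2 * (d * e) by field.
  by rewrite N2RM; exact: aux.
suff : N2R (N.sub D (N.mul 2%num eh)) <= N2R D - 2 * (N2R D * inve) /\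
    N2R D - 2 * (N2R D * inve) <= N2R (N.sub D (N.mul 2%num el)) by rewrite -H2.
split; last first.
  apply: le_trans (N2RB _ _ _); rewrite N2RM lerB// ler_wpM2l//; exact: Hl.
have pos : 0 <= N2R D - 2 * (N2R D * inve).
  have -> : N2R D - 2 * (N2R D * inve) = N2R D * (1 - 2 * inve) by ring.
  by rewrite mulr_ge0 ?(ltW D0)//; lra.
case: (leqP (N.to_nat (N.mul 2%num eh)) (N.to_nat D)) => H.
  have -> : N2R (N.sub D (N.mul 2%num eh)) = N2R D - N2R (N.mul 2%num eh).
    by rewrite /N2R -natrB//; congr _%:R; lia.
  by rewrite lerB// N2RM ler_wpM2l//; exact: Hh.
have -> : N.sub D (N.mul 2%num eh) = 0%num by lia.
exact: pos.
Qed.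

End RankData.

(** * The values *)

Lemma rank_checks_true : rank_checks rank_params.
Proof. by vm_cast_no_check (erefl true). Qed.

Lemma rank_limE (R : realType) k : rank_lim R k = rtail R k - rtail R k.+1.
Proof. by apply: cvg_lim; [exact: norm_hausdorff|exact: cvg_rank_frac]. Qed.

Lemma layer_limE (R : realType) k : layer_lim R k.+1 = lhead R k.+1 - lhead R k.
Proof. by apply: cvg_lim; [exact: norm_hausdorff|exact: cvg_layer_frac]. Qed.

Lemma layer_lim0E (R : realType) : layer_lim R 0 = lhead R 0.
Proof. by apply: cvg_lim; [exact: norm_hausdorff|exact: cvg_layer_frac0]. Qed.

Lemma layer_values (R : realType) :
  [/\ rounds3 (layer_lim R 2) 114 3, rounds3 (layer_lim R 3) 647 4,
      rounds3 (layer_lim R 4) 384 4 & rounds3 (layer_lim R 5) 235 4] /\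
  [/\ rounds3 (layer_lim R 6) 146 4, rounds3 (layer_lim R 7) 928 5 &
      rounds3 (layer_lim R 8) 595 5].
Proof.
have S0 : 0 < N2R R layer_scale by exact: (@N2R_lt R 0%num).
have ok0 : layer_ok R layer_scale 0 [:: layer_scale; 0%num] [:: layer_scale; 0%num].
  have H up : appr up (N2R R layer_scale) [:: layer_scale; 0%num] (pr R (height_le 0)).
    by move=> [|[|]]//= _; rewrite c0E ?mulr1 ?mulr0; exact: bnd_refl.
  by [].
have := @layer_run_ok R layer_scale layer_fuels 0
  [:: layer_scale; 0%num] [:: layer_scale; 0%num] S0 isT ok0.
(* the data become variables here, lest the case analysis compute them *)
have := layer_checks_true; rewrite -/layer_data; move: layer_data => l.
case: l => // q1 [|q2 [|q3 [|q4 [|q5 [|q6 [|q7 [|q8 [|]]]]]]]] // chk.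
move=> [e1 [e2 [e3 [e4 [e5 [e6 [e7 [e8 _]]]]]]]].
case/and4P: chk => c2 c3 c4 /and4P[c5 c6 c7 c8].
rewrite !layer_limE; do 2!split; [exact: round_checkP e2 e1 c2|exact: round_checkP e3 e2 c3|
 exact: round_checkP e4 e3 c4|exact: round_checkP e5 e4 c5|exact: round_checkP e6 e5 c6|
 exact: round_checkP e7 e6 c7|exact: round_checkP e8 e7 c8].
Qed.

Lemma rank_params_ok (R : realType) : rank_params.1 -> ranks_ok R rank_params.2.
Proof.
have ok N0 M D D2 Ds Dfs (chk : [&& (0 < N0)%N, (5 <= M)%N, (N0 <= M)%N, N.ltb 0%num D, N.ltb 0%num D2,
    size Ds == size Dfs, all (fun D => N.ltb 0%num D) Ds & all (fun D => N.ltb 0%num D) Dfs]) :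
    (rank_data N0 M D D2 Ds Dfs).1 -> ranks_ok R (rank_data N0 M D D2 Ds Dfs).2.
  by case/and5P: chk => ? ? ? ? /and4P[? /eqP ? ? ?]; exact: rank_data_ok.
rewrite /rank_params; apply ok. vm_cast_no_check (erefl true).
Qed.

Lemma rank_values (R : realType) :
  [/\ rounds3 (rank_lim R 2) 124 3, rounds3 (rank_lim R 3) 805 5,
      rounds3 (rank_lim R 4) 168 6 & rounds3 (rank_lim R 5) 214 8] /\
  [/\ rounds3 (rank_lim R 6) 188 10, rounds3 (rank_lim R 7) 120 12 &
      rounds3 (rank_lim R 8) 576 15].
Proof.
have := @rank_params_ok R; have := rank_checks_true.
(* the data become variables here, lest the case analysis compute them *)
move: rank_params => [kap l] /andP[/= k chk] /(_ k).
case: l chk => // p3 [|p4 [|p5 [|p6 [|p7 [|p8 [|p9 [|]]]]]]] // chk ok.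
have o3 := ok 0%N isT; have o4 := ok 1%N isT; have o5 := ok 2%N isT; have o6 := ok 3%N isT.
have o7 := ok 4%N isT; have o8 := ok 5%N isT; have o9 := ok 6%N isT.
case/and4P: chk => c2 c3 c4 /and4P[c5 c6 c7 c8].
have o2 := rtail2_enc R.
rewrite !rank_limE; do 2!split; apply: round_checkP; [exact: o2|exact: o3|exact: c2|
 exact: o3|exact: o4|exact: c3|exact: o4|exact: o5|exact: c4|exact: o5|exact: o6|exact: c5|
 exact: o6|exact: o7|exact: c6|exact: o7|exact: o8|exact: c7|exact: o8|exact: o9|exact: c8].
Qed.

Theorem corollary2p1 (R : realType) :
  (forall k : nat, (k <= 8)%N ->
     cvgn (rank_frac R k) /\ cvgn (layer_frac R k)) /\
  (rank_lim R 0 = 1 / 2 /\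
   rank_lim R 1 = 1 / expR 1 /\
   rounds3 (rank_lim R 2) 124 3 /\    (* 0.124 *)
   rounds3 (rank_lim R 3) 805 5 /\    (* 0.00805 *)
   rounds3 (rank_lim R 4) 168 6 /\    (* 1.68e-4 *)
   rounds3 (rank_lim R 5) 214 8 /\    (* 2.14e-6 *)
   rounds3 (rank_lim R 6) 188 10 /\   (* 1.88e-8 *)
   rounds3 (rank_lim R 7) 120 12 /\   (* 1.20e-10 *)
   rounds3 (rank_lim R 8) 576 15) /\  (* 5.76e-13 *)
  (layer_lim R 0 = 1 / 2 /\
   layer_lim R 1 = expR 1 - 5 / 2 /\
   rounds3 (layer_lim R 2) 114 3 /\    (* 0.114 *)
   rounds3 (layer_lim R 3) 647 4 /\    (* 0.0647 *)
   rounds3 (layer_lim R 4) 384 4 /\    (* 0.0384 *)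
   rounds3 (layer_lim R 5) 235 4 /\    (* 0.0235 *)
   rounds3 (layer_lim R 6) 146 4 /\    (* 0.0146 *)
   rounds3 (layer_lim R 7) 928 5 /\    (* 0.00928 *)
   rounds3 (layer_lim R 8) 595 5).     (* 0.00595 *)
Proof.
have [[r2 r3 r4 r5] [r6 r7 r8]] := rank_values R.
have [[l2 l3 l4 l5] [l6 l7 l8]] := layer_values R.
have r0 : rank_lim R 0 = 1 / 2 by rewrite rank_limE rtail1 /=; lra.
have r1 : rank_lim R 1 = 1 / expR 1.
  by rewrite rank_limE rtail1 rtail2 /inve expRN div1r; lra.
have l0 : layer_lim R 0 = 1 / 2 by rewrite layer_lim0E lhead0.
have l1 : layer_lim R 1 = expR 1 - 5 / 2 by rewrite layer_limE lhead1 lhead0; lra.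
split; last first.
  split; [by split=> //; split=> //; do 6!(split; first by []) | by split=> //; split=> //; do 6!(split; first by [])].
move=> k _; split; first by apply/cvg_ex; eexists; exact: cvg_rank_frac.
case: k => [|k]; first by apply/cvg_ex; eexists; exact: cvg_layer_frac0.
by apply/cvg_ex; eexists; exact: cvg_layer_frac.
Qed.
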